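(* Let $\kappa$ be an infinite cardinal for which $\boxed{\diamondsuit}_\kappa$ holds. Then there is $T\subseteq\mathbb{S}_\kappa$ which is $\varrho_2$-coherent and $\varrho_2$-full with respect to $\kappa^+$. Consequently, there is a minimal non-$\sigma$-scattered linear order of cardinality $\kappa^+$ which is moreover $\kappa^+$-Countryman.
   Context: $\boxed{\diamondsuit}_\kappa$ asserts the existence of a sequence $\langle (C_\delta,X_\delta):\delta<\kappa^+\rangle$ such that: (1) for limit $\delta<\kappa^+$, $C_\delta$ is a closed unbounded subset of $\delta$ of order type at most $\kappa$; (2) $X_\delta\subseteq\delta$ for all $\delta$; (3) if $\alpha\in\mathrm{acc}(C_\delta)$ (the set of elements of $C_\delta$ that are limit points of $C_\delta$), then $C_\alpha=C_\delta\cap\alpha$ and $X_\alpha=X_\delta\cap\alpha$; (4) for every $X\subseteq\kappa^+$ and every club $C\subseteq\kappa^+$ there is a limit $\delta\in C$ with $C_\delta\subseteq C$, $\mathrm{otp}(C_\delta)=\kappa$ and $X\cap\delta=X_\delta$. $\mathbb{S}_\kappa$ is the set of all $t:\gamma+1\to\omega$ with $\gamma<\kappa^+$ such that: (a) for each integer $n\ge-1$, $C^t_n:=\{\beta<\gamma+1:t(\beta)\le n\}$ is closed; (b) for each limit $\beta\le\gamma$, $t(\beta)$ is the least $n$ such that $C^t_n$ is unbounded in $\beta$; (c) for each $n$, if $I$ is a maximal open interval of $\gamma+1$ disjoint from $C^t_{n-1}$, then $\mathrm{otp}(C^t_n\cap I)<\kappa\cdot\omega$. A $\varrho_2$-modifier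 is a continuous $\mathbb{Z}$-valued sequence of successor length (for each limit $\beta$ in the domain it is constant on $[\eta,\beta]$ for some $\eta<\beta$); $t$ is a $\varrho_2$-modification of $s$ if $|s|=|t|$ and $t-s$ is a $\varrho_2$-modifier. $X$ is $\varrho_2$-coherent if for $s,t\in X$ with $|s|\le|t|$, $t\restriction|s|$ is a $\varrho_2$-modification of $s$; $X\subseteq{}^{<\kappa^+}\omega$ is $\varrho_2$-full with respect to $\kappa^+$ if $|X|=\kappa^+$ and $X$ is closed under initial segments of successor length and under $\varrho_2$-modifications (with values in $\omega$). A linear order is scattered if it has no copy of $\mathbb{Q}$, $\sigma$-scattered if a countable union of scattered suborders; a minimal non-$\sigma$-scattered linear order is one that is not $\sigma$-scattered and embeds into each of its non-$\sigma$-scattered suborders. A linear order $C$ is $\kappa^+$-Countryman if $|C|=\kappa^+$ and $C\times C$ is a union of $\kappa$ chains in the coordinatewise order. *)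

(* Defs.v *)
From HB Require Import structures.
From mathcomp Require Import all_boot all_order all_algebra.
From mathcomp Require Import mathcomp_extra boolp classical_sets functions.
From mathcomp Require Import cardinality set_interval.

Set Implicit Arguments.
Unset Strict Implicit.
Unset Printing Implicit Defensive.

Import Order.TTheory GRing.Theory Num.Theory.

Local Open Scope order_scope.
Local Open Scope card_scope.
Local Open Scope classical_set_scope.

(* The ordinal kappa^+ is represented by an arbitrary well-ordered type W of
   that order type.  An element a : W stands for the ordinal
   `]-oo, a[ = {x | x < a} of its predecessors, so that kappa itself is an
   element of W, and the successor ordinal a + 1 is `]-oo, a]. *)

Section Ordinals.
Context {d : Order.disp_t} {W : orderType d}.
Implicit Types (D A : set W) (a b k : W).

Definition is_infinite_cardinal k : Prop :=
  infinite_set `]-oo, k[%classic /\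
  forall a, a < k -> ~ (`]-oo, k[%classic #<= `]-oo, a[%classic).

(* [W] has order type k^+: it is the least ordinal that does not inject
   into k. *)
Definition is_cardinal_successor k : Prop :=
  [/\ well_founded (fun x y : W => x < y),
      forall a, `]-oo, a[%classic #<= `]-oo, k[%classic
    & ~ ([set: W] #<= `]-oo, k[%classic)].

Definition is_limit a : Prop :=
  (exists x, x < a) /\ forall x, x < a -> exists2 y, x < y & y < a.

Definition unbounded_in D A : Prop :=
  forall x, D x -> exists2 y, (D `&` A) y & x <= y.

Definition limit_point A a : Prop :=
  is_limit a /\ unbounded_in `]-oo, a[%classic A.

(* In the next two definitions D is an initial segment of W: an ordinal
   below kappa^+, or kappa^+ itself. *)
Definition closed_in D A : Prop :=
  forall a, D a -> limit_point A a -> A a.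

Definition club_in D A : Prop :=
  [/\ A `<=` D, closed_in D A & unbounded_in D A].

Definition acc A : set W := [set a | A a /\ limit_point A a].

End Ordinals.

Section OrderTypes.
Context {d d' : Order.disp_t} {T : orderType d} {U : orderType d'}.

Definition order_iso (A : set T) (B : set U) : Prop :=
  exists f : T -> U, set_bij A B f /\ {in A &, {mono f : x y / x < y}}.

End OrderTypes.

Section OrderTypeBounds.
Context {d : Order.disp_t} {W : orderType d}.
Implicit Types (A : set W) (k : W).

Definition otp_eq A k : Prop := order_iso A `]-oo, k[%classic.

Definition otp_le A k : Prop := exists2 a, a <= k & otp_eq A a.

(* The ordinal k * omega is omega copies of k, one after the other, i.e. the
   set of pairs (n, x) with x < k, ordered lexicographically. *)
Definition otp_lt_mul_omega A k : Prop :=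
  exists2 p : nat *l W, p.2 < k &
    order_iso A [set q : nat *l W | q.2 < k /\ q < p].

End OrderTypeBounds.

Section BoxDiamond.
Context {d : Order.disp_t} {W : orderType d}.

Definition box_diamond (k : W) : Prop :=
  exists (C : W -> set W) (X : W -> set W),
  [/\ forall a, is_limit a ->
        club_in `]-oo, a[%classic (C a) /\ otp_le (C a) k,
      forall a, X a `<=` `]-oo, a[%classic,
      forall a b, acc (C a) b ->
        C b = C a `&` `]-oo, b[%classic /\ X b = X a `&` `]-oo, b[%classic
    & forall (Y E : set W), club_in setT E ->
        exists2 a, is_limit a /\ E a &
          [/\ C a `<=` E, otp_eq (C a) k & Y `&` `]-oo, a[%classic = X a]].

End BoxDiamond.

(* A sequence of length at most kappa^+ is a partial function on W whose
   domain is an initial segment. *)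
Section Sequences.
Context {d : Order.disp_t} {W : orderType d}.

Definition dom (A : Type) (s : W -> option A) : set W := [set x | s x <> None].

Definition restr (A : Type) (s : W -> option A) (D : set W) : W -> option A :=
  fun x => if x \in D then s x else None.

Definition successor_length (A : Type) (s : W -> option A) : Prop :=
  exists a, dom s = `]-oo, a]%classic.

Implicit Types (s t : W -> option nat) (X : set (W -> option nat)).

(* C^t_n *)
Definition level t (n : int) : set W :=
  [set x | exists2 m, t x = Some m & (m%:Z <= n)%R].

Definition open_interval_of (D I : set W) : Prop :=
  exists2 i : interval W, itv_open_ends i & I = D `&` [set` i].

Definition maximal_open_interval_avoiding (D A I : set W) : Prop :=
  [/\ open_interval_of D I, I `&` A = set0
    & forall J, open_interval_of D J -> J `&` A = set0 -> I `<=` J -> I = J].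

Definition Sk (k : W) : set (W -> option nat) := [set t |
  exists2 c, dom t = `]-oo, c]%classic &
  [/\ forall n : int, (-1 <= n)%R -> closed_in `]-oo, c]%classic (level t n),
      forall b m, is_limit b -> t b = Some m ->
        unbounded_in `]-oo, b[%classic (level t m%:Z) /\
        forall n : int, (-1 <= n)%R ->
          unbounded_in `]-oo, b[%classic (level t n) -> (m%:Z <= n)%R
    & forall n : nat, forall I : set W,
        maximal_open_interval_avoiding `]-oo, c]%classic
          (level t (n%:Z - 1)%R) I ->
        otp_lt_mul_omega (level t n%:Z `&` I) k]].

Definition rho2_modifier (f : W -> option int) : Prop :=
  successor_length f /\
  forall b, dom f b -> is_limit b ->
    exists2 e, e < b & forall x, e <= x <= b -> f x = f b.

Definition seq_diff t s : W -> option int := fun x =>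
  if (t x, s x) is (Some m, Some n) then Some (m%:Z - n%:Z)%R else None.

Definition rho2_modification t s : Prop :=
  dom t = dom s /\ rho2_modifier (seq_diff t s).

(* For sequences, the length of s is at most that of t exactly when
   dom s is included in dom t. *)
Definition rho2_coherent X : Prop :=
  forall s t, X s -> X t -> dom s `<=` dom t ->
    rho2_modification (restr t (dom s)) s.

Definition rho2_full X : Prop :=
  [/\ forall s, X s -> exists a, dom s = `]-oo, a[%classic,
      X #= [set: W],
      forall s a, X s -> dom s a -> X (restr s `]-oo, a]%classic)
    & forall s t, X s -> rho2_modification t s -> X t].

End Sequences.

Section LinearOrders.
Context {d : Order.disp_t} {L : orderType d}.

Definition scattered (A : set L) : Prop :=
  ~ exists f : rat -> L, (forall q, A (f q)) /\ {mono f : x y / x < y}.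

Definition sigma_scattered (A : set L) : Prop :=
  exists2 F : nat -> set L, A = \bigcup_n F n & forall n, scattered (F n).

Definition minimal_non_sigma_scattered : Prop :=
  ~ sigma_scattered [set: L] /\
  forall A : set L, ~ sigma_scattered A ->
    exists f : L -> L, (forall x, A (f x)) /\ {mono f : x y / x < y}.

(* W is of cardinality kappa^+ and k of cardinality kappa; [L *p L] carries
   the coordinatewise order. *)
Definition countryman {d' : Order.disp_t} {W : orderType d'} (k : W) : Prop :=
  [set: L] #= [set: W] /\
  exists2 F : W -> set (L *p L),
    \bigcup_(x in `]-oo, k[%classic) F x = setT &
    forall x, x < k -> total_on (F x) (fun p q : L *p L => p <= q).

End LinearOrders.

Arguments minimal_non_sigma_scattered {d} L.
Arguments countryman {d} L {d' W} k.

(* Main.v *)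
(* A node of level a is a map [0, a] -> omega which differs from a fixed base
   map F a by a function that is locally constant at limits, hence, by
   compactness, by a step function with finitely many jumps.  At a limit a the
   base map is 0 cofinally along C_a, and on each block of C_a it is a
   modification of an earlier base map with positive values.  Hence values at
   limits are lower limits, and order types stay below kappa * omega.  Coherence
   of C along accumulation points makes the base maps coherent.

   On the blocks there is freedom, which is spent on the set X_a guessed by the
   diamond: at the i-th block a bookkeeping function names a modification, and
   the block is chosen so that this modification of F a leaves the guessed set
   of nodes, if that is possible.  Let A be a set of nodes of unbounded levels
   and guess its downward closure at a level a.  Some modification of F a lies in
   it, so at the block where it was considered leaving was impossible: there is
   a node u all of whose extensions with new values above the last value of u
   have an extension in A.  The whole lexicographic order L of the nodes embeds
   above u: by finitely many changes at successor ordinals one codes the part of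
   a node below a suitable level, and one copies the part above that level.  A
   set of nodes of bounded level is sigma-scattered, by induction on the number
   of jumps, so every suborder which is not sigma-scattered has unbounded levels.

   For the Countryman property, each point x of a node s is given a code of size
   kappa: the order types, for n <= s x, of the runs of the value n that lead to
   x.  If two nodes agree below x and the codes of x and of a later point x'
   agree, then the value at x increases from the first node to the second.  The
   codes at the jumps of t - s then tell apart incomparable pairs (s, t). *)

Require Import Defs.
From HB Require Import structures.
From mathcomp Require Import all_boot all_order all_algebra.
From mathcomp Require Import mathcomp_extra boolp classical_sets functions.
From mathcomp Require Import cardinality set_interval.
From mathcomp Require Import zify.

Set Implicit Arguments.
Unset Strict Implicit.
Unset Printing Implicit Defensive.

Import Order.TTheory GRing.Theory Num.Theory.

Local Open Scope order_scope.
Local Open Scope card_scope.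
Local Open Scope classical_set_scope.

(** * Well-orders and cardinal arithmetic *)

Section WellOrder.
Context {d : Order.disp_t} {W : orderType d}.
Hypothesis wf : well_founded (fun x y : W => x < y).

Lemma wo_ind (P : W -> Prop) :
  (forall x, (forall y, y < x -> P y) -> P x) -> forall x, P x.
Proof. exact: (well_founded_ind wf). Qed.

Lemma wo_min (A : set W) : A !=set0 ->
  exists x, A x /\ forall y, A y -> x <= y.
Proof.
move=> [a Aa]; apply: contrapT => /forallNP nmin.
suff: forall x, ~ A x by move=> /(_ a).
apply: wo_ind => x IH Ax; apply: (nmin x); split=> // y Ay.
by rewrite leNgt; apply/negP => /IH.
Qed.

Definition cut (Y : Type) (y0 : Y) (x : W) (f : W -> Y) : W -> Y :=
  fun y => if y < x then f y else y0.

Definition wfrec (Y : Type) (y0 : Y) (Psi : W -> (W -> Y) -> Y) : W -> Y :=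
  Fix wf (fun _ => Y) (fun x rec => Psi x
    (fun y => if pselect (y < x) is left h then rec y h else y0)).

Lemma wfrecE (Y : Type) (y0 : Y) Psi x :
  wfrec y0 Psi x = Psi x (cut y0 x (wfrec y0 Psi)).
Proof.
rewrite /wfrec Fix_eq; last first.
  move=> {}x f g fg; congr (Psi x _); apply/funext => y.
  by case: pselect.
congr (Psi x _); apply/funext => y; rewrite /cut.
by case: pselect => [->//|/negP/negbTE ->].
Qed.

Definition least (v0 : W) (S : set W) : W :=
  xget v0 [set v | S v /\ forall w, S w -> v <= w].

Lemma leastP v0 (S : set W) : S !=set0 ->
  S (least v0 S) /\ forall w, S w -> least v0 S <= w.
Proof. by move=> /wo_min h; rewrite /least; apply: xgetPex h. Qed.

Lemma least_eq v0 (S : set W) x :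
  S x -> (forall w, S w -> x <= w) -> least v0 S = x.
Proof.
move=> Sx xmin; have [Sl lmin] : S (least v0 S) /\ _ := leastP v0 (ex_intro _ x Sx).
by apply/eqP; rewrite eq_le lmin ?xmin.
Qed.

End WellOrder.

Lemma wf_prodlexi (d1 d2 d' : Order.disp_t) (U : orderType d1) (V : orderType d2) :
  well_founded (fun x y : U => x < y) -> well_founded (fun x y : V => x < y) ->
  well_founded (fun x y : U *lexi[d'] V => x < y).
Proof.
move=> wfU wfV; suff H : forall u v, Acc (fun x y : U *lexi[d'] V => x < y) (u, v).
  by case.
apply: (wo_ind wfU) => u IHu; apply: (wo_ind wfV) => v IHv.
constructor=> -[u' v']; rewrite ltxi_pair => /andP[].
rewrite le_eqVlt => /orP[/eqP ->|uu _]; last exact: IHu.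
by rewrite lexx /= => /IHv.
Qed.

Lemma wf_nat : well_founded (fun x y : nat => (x < y)%O).
Proof.
by elim/ltn_ind => n IH; constructor=> k; rewrite ltEnat => /IH.
Qed.

(** * Collapsing maps between well-orders *)

Section Collapse.
Context {d1 d2 : Order.disp_t} {U : orderType d1} {V : orderType d2}.
Hypothesis wfU : well_founded (fun x y : U => x < y).
Hypothesis wfV : well_founded (fun x y : V => x < y).
Variable v0 : V.
Implicit Types (P : set V) (A : set U).

(** A Mostowski-style collapse of [A] into [P]. The argument need not lie in [A], so at a later
    point the value measures the order type of [A] before it. [v0] is taken only where [rk_def]
    fails. *)
Definition rk P A : U -> V := wfrec wfU v0 (fun x f =>
  least v0 [set v | P v /\ forall y, A y -> y < x -> f y < v]).

Lemma rkE P A x :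
  rk P A x = least v0 [set v | P v /\ forall y, A y -> y < x -> rk P A y < v].
Proof.
rewrite {1}/rk wfrecE; congr (least v0 _); apply/seteqP.
by split=> v /= [Pv h]; split=> // y Ay yx; move: (h y Ay yx); rewrite /cut yx.
Qed.

Definition rk_def P A x :=
  exists v, P v /\ forall y, A y -> y < x -> rk P A y < v.

Lemma rk_defP P A x : rk_def P A x ->
  [/\ P (rk P A x), forall y, A y -> y < x -> rk P A y < rk P A x
   & forall v, P v -> (forall y, A y -> y < x -> rk P A y < v) ->
     rk P A x <= v].
Proof.
move=> h; have := leastP wfV v0 h; rewrite -rkE => -[[Pr rb] rmin].
by split=> // v Pv vb; apply: rmin.
Qed.

(** The values fill an initial segment of [P]: at the first [y] with value at least [v], the element
    [v] already bounds the earlier values. *)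
Lemma rk_onto P A x v : P v -> ~ (forall y, A y -> y < x -> rk P A y < v) ->
  (forall y, A y -> y < x -> rk_def P A y) ->
  exists y, [/\ A y, y < x & rk P A y = v].
Proof.
move=> Pv nb rd.
have : [set y | [/\ A y, y < x & v <= rk P A y]] !=set0.
  apply: contrapT => n; apply: nb => y Ay yx; rewrite ltNge; apply/negP => vy.
  by apply: n; exists y.
move=> /(wo_min wfU)[y [[Ay yx vy]] ymin]; exists y; split=> //.
apply/eqP; rewrite eq_le vy andbT.
have [_ _] := rk_defP (rd y Ay yx); apply=> // z Az zy.
rewrite ltNge; apply/negP => vz; have := ymin z (And3 Az (lt_trans zy yx) vz).
by rewrite leNgt zy.
Qed.

Lemma rk_embed P A (h : U -> V) x :
  (forall y, A y -> y <= x -> P (h y)) ->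
  (forall y z, A y -> A z -> y < z -> z <= x -> h y < h z) -> A x ->
  rk_def P A x /\ rk P A x <= h x.
Proof.
move=> Ph hm; move: x Ph hm; apply: (wo_ind wfU) => x IH Ph hm Ax.
have r y : A y -> y < x -> rk P A y <= h y.
  move=> Ay yx; have yx' := ltW yx; apply IH => //.
    by move=> z Az zy; apply: Ph => //; exact: le_trans yx'.
  by move=> z w Az Aw zw wy; apply: hm => //; exact: le_trans yx'.
have b y : A y -> y < x -> rk P A y < h x.
  by move=> Ay yx; apply: le_lt_trans (r y Ay yx) _; apply: hm.
have rd : rk_def P A x by exists (h x); split=> //; exact: Ph.
by split=> //; have [_ _] := rk_defP rd; apply=> //; exact: Ph.
Qed.

Lemma eq_rk P A B x : (forall y, y < x -> A y <-> B y) -> rk P A x = rk P B x.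
Proof.
move: x; apply: (wo_ind wfU) => x IH AB; rewrite !rkE; congr (least v0 _).
apply/seteqP; split=> v /= [Pv h]; split=> // y Ay yx.
- by rewrite -IH ?h ?AB // => z zy; apply: AB; exact: lt_trans zy yx.
- by rewrite IH ?h -?AB // => z zy; apply: AB; exact: lt_trans zy yx.
Qed.

End Collapse.

(** * Cardinal comparison by injections *)

Section Cards.
Context {T U : Type}.
Implicit Types (A : set T) (B : set U).

Lemma inj_cardle A B (f : T -> U) : (forall x, A x -> B (f x)) ->
  (forall x y, A x -> A y -> f x = f y -> x = y) -> A #<= B.
Proof.
move=> fAB finj.
have /injfunPex[g] : exists2 g : T -> U, set_fun A B g & set_inj A g.
  by exists f => // x y /set_mem Ax /set_mem Ay; exact: finj.
exact: inj_card_le g.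
Qed.

Lemma cardle_inj A B (u0 : U) : A #<= B -> exists f : T -> U,
  (forall x, A x -> B (f x)) /\
  (forall x y, A x -> A y -> f x = f y -> x = y).
Proof.
move=> /card_leP[f].
have mA x : A x -> x \in A by move=> /mem_set.
exists (fun x => if pselect (A x) is left h then val (f (SigSub (mA x h))) else u0).
split=> [x Ax|x y Ax Ay].
  by case: pselect => // h; apply: set_mem; apply: valP.
case: pselect => // hx; case: pselect => // hy /val_inj fxy.
by have /(congr1 val) := 'inj_f (mem_set I) (mem_set I) fxy.
Qed.

End Cards.

(** * Squares of infinite well-ordered sets *)

Section CardArith.
Context {d : Order.disp_t} {W : orderType d}.
Hypothesis wf : well_founded (fun x y : W => x < y).

Definition square (T : Type) (P : set T) : set (T * T) :=
  [set z | P z.1 /\ P z.2].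

Lemma square_cardle (T U : Type) (A : set T) (B : set U) (u0 : U) :
  A #<= B -> square A #<= square B.
Proof.
move=> /(cardle_inj u0)[f [fB finj]].
apply: (inj_cardle (f := fun z => (f z.1, f z.2))).
  by move=> [x y] [/= Ax Ay]; split; apply: fB.
by move=> [x y] [x' y'] [/= ? ?] [/= ? ?] [/finj-> // /finj-> //].
Qed.

(** Hilbert's hotel: values on a copy [g] of the natural numbers inside [B] are shifted by one,
    which frees [g 0] for the new point. *)
Lemma cardle_add1 (T U : Type) (A : set T) (B : set U) (t : T) :
  infinite_set B -> A #<= B -> (A `|` [set t]) #<= B.
Proof.
move=> Binf0 AB; have [u _] := infinite_setN0 Binf0.
move: Binf0 => /infiniteP Binf.
have [f [fB finj]] := cardle_inj u AB.
have [g [gB ginj']] := cardle_inj u Binf.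
have ginj : injective g by move=> x y; apply: ginj'.
pose h x := if pselect (exists n, g n = f x) is left e then g (projT1 (cid e)).+1
            else f x.
have hE x : (exists2 n, f x = g n & h x = g n.+1) \/
            ((forall n, f x <> g n) /\ h x = f x).
  rewrite /h; case: pselect => [e|/forallNP ne]; last first.
    by right; split=> // n e; apply: (ne n).
  by left; case: (cid e) => n /= <-; exists n.
apply: (inj_cardle (f := fun x => if pselect (x = t) then g 0%N else h x)).
  move=> x xA; case: (pselect (x = t)) => [xt|xt]; first exact: gB.
  case: xA => [Ax|//]; have [[n _ ->]|[_ ->]] := hE x; [exact: gB|exact: fB].
move=> x y xA yA; case: (pselect (x = t)) => [xt|xt]; case: (pselect (y = t)) => [yt|yt] /=;
  first by rewrite xt yt.
- case: yA => [Ay|//]; have [[n _ ->]|[nn ->]] := hE y.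
    by move=> /ginj.
  by move=> e; have := nn 0%N; rewrite -e.
- case: xA => [Ax|//]; have [[n _ ->]|[nn ->]] := hE x.
    by move=> /ginj.
  by move=> e; have := nn 0%N; rewrite -e.
- case: xA => [Ax|//]; case: yA => [Ay|//].
  have [[n e ->]|[nn ->]] := hE x; have [[m e' ->]|[mm ->]] := hE y.
  + by move=> /ginj[nm]; apply: finj => //; rewrite e e' nm.
  + by move=> e2; case: (mm n.+1).
  + by move=> e2; case: (nn m.+1).
  + by move=> /finj; apply.
Qed.

(** At a first point without rank the earlier ranks would exhaust [P] by [rk_onto], and choosing
    preimages would inject [P] into a segment of [A]. *)
Lemma rk_total (d1 d2 : Order.disp_t) (U : orderType d1) (V : orderType d2)
    (wfU : well_founded (fun x y : U => x < y))
    (wfV : well_founded (fun x y : V => x < y)) (v0 : V) (P : set V) (A : set U) :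
  (forall x, A x -> ~ (P #<= [set y | A y /\ y < x])) ->
  forall x, A x -> rk_def wfU v0 P A x.
Proof.
move=> small; apply: (wo_ind wfU) => x IH Ax; apply: contrapT => nd.
apply: (small x Ax).
have ex v : exists y, P v -> [/\ A y, y < x & rk wfU v0 P A y = v].
  have [Pv|nPv] := pselect (P v); last by exists x.
  have [||y [Ay yx e]] := rk_onto wfV (x := x) (A := A) Pv (wfU := wfU) (v0 := v0).
  - by move=> nb; apply: nd; exists v.
  - by move=> y Ay yx; apply: IH.
  - by exists y.
have [f fP] := choice ex.
apply: (inj_cardle (f := f)) => [v /fP[]//|v w /fP[_ _ ev] /fP[_ _ ew] fvw].
by rewrite -ev fvw.
Qed.

(* Goedel's ordering of pairs: by maximum first, then lexicographically. *)
Lemma initial_square (P : set W) :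
  (forall m, P m -> ~ (P #<= square [set x | x <= m])) -> square P #<= P.
Proof.
move=> big; have [[p0 Pp0]|P0] := pselect (P !=set0); last first.
  have -> : square P = set0; last exact: card_ge0.
  by apply/seteqP; split=> // z [Pz _]; apply: P0; exists z.1.
pose U := (W *lexi[d] (W *lexi[d] W))%type.
have wfU : well_founded (fun x y : U => x < y).
  exact: (wf_prodlexi wf (wf_prodlexi wf wf)).
pose mx (x y : W) : W := Order.max x y.
pose key : W * W -> U := fun z : W * W => pair (mx z.1 z.2) z.
pose A : set U := fun u : W * (W * W) => square P u.2 /\ u.1 = mx u.2.1 u.2.2.
have rd : forall x, A x -> rk_def wfU p0 P A x.
  apply: rk_total => // -[m z] [/= [Pz1 Pz2] mz] le.
  have Pm : P m by rewrite mz /mx; case: leP.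
  apply: (big m Pm); apply: card_le_trans le _.
  apply: (inj_cardle (f := fun u => u.2)).
    move=> [m' [x y]] [[/= _ ->]]; rewrite ltxi_pair => /andP[le _].
    by split=> /=; apply: le_trans le; rewrite /mx le_max lexx ?orbT.
  by move=> [m1 z1] [m2 z2] [[/= _ ->] _] [[/= _ ->] _] ->.
have Akey z : square P z -> A (key z) by split.
apply: (inj_cardle (f := rk wfU p0 P A \o key)).
  by move=> z /Akey/rd/(rk_defP wf)[].
move=> x y Px Py /= e.
have [lt|lt|] := ltgtP (key x) (key y).
- have [_ /(_ _ (Akey x Px) lt)] := rk_defP wf (rd _ (Akey y Py)).
  by rewrite e ltxx.
- have [_ /(_ _ (Akey y Py) lt)] := rk_defP wf (rd _ (Akey x Px)).
  by rewrite e ltxx.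
- by move=> /(congr1 snd).
Qed.

Lemma Iic_Iio (m : W) : [set x | x <= m] = [set x | x < m] `|` [set m].
Proof.
apply/seteqP; split=> x /=; first by rewrite le_eqVlt => /orP[/eqP|]; auto.
by case=> [/ltW//|->].
Qed.

(** Hessenberg's theorem by induction: either [a] injects into some smaller [b], or every [m < a]
    has a square too small for [a] and [initial_square] applies. *)
Lemma square_segment a : infinite_set [set x | x < a] ->
  square [set x : W | x < a] #<= [set x | x < a].
Proof.
move: a; apply: (wo_ind wf) => a IH ainf.
have [[b [ba ab]]|nb] :=
    pselect (exists b, b < a /\ [set x : W | x < a] #<= [set x | x < b]).
  have binf : infinite_set [set x | x < b].
    by move=> fb; apply: ainf; exact: card_le_finite ab fb.
  apply: card_le_trans (square_cardle a ab) _.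
  apply: card_le_trans (IH b ba binf) _.
  by apply: subset_card_le => x /= xb; exact: lt_trans xb ba.
apply: initial_square => m /= ma le.
have [fm|minf] := pselect (finite_set [set x | x < m]).
  apply: ainf; apply: card_le_finite le _.
  have fm' : finite_set [set x | x <= m].
    by rewrite Iic_Iio finite_setU; split.
  have -> : square [set x | x <= m] = [set x | x <= m] `*` [set x | x <= m] by [].
  exact: finite_setX.
apply: nb; exists m; split=> //; apply: card_le_trans le _.
apply: card_le_trans (IH m ma minf); apply: square_cardle => //.
by rewrite Iic_Iio; exact: cardle_add1.
Qed.

End CardArith.

(** * Coding finite sequences by iterated pairing *)

Section SeqCode.
Context {X : Type} (P : set X) (p : X * X -> X) (i : nat -> X).
Hypothesis pP : forall z, square P z -> P (p z).
Hypothesis pinj : forall z w, square P z -> square P w -> p z = p w -> z = w.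
Hypothesis iP : forall n, P (i n).
Hypothesis iinj : injective i.

Fixpoint all_in (s : seq X) : Prop := if s is x :: s' then P x /\ all_in s' else True.

Let fold s := foldr (fun x a => p (x, a)) (i 0%N) s.

(** The length is stored because the iterated pairing alone need not reveal where the sequence
    ends. *)
Definition encs (s : seq X) : X := p (i (size s), fold s).

Lemma fold_P s : all_in s -> P (fold s).
Proof. by elim: s => [_|x s IH [Px /IH Ps]] //=; apply: pP. Qed.

Lemma encs_P s : all_in s -> P (encs s).
Proof. by move=> Ps; apply: pP; split=> //=; apply: fold_P. Qed.

Lemma encs_inj s t : all_in s -> all_in t -> encs s = encs t -> s = t.
Proof.
move=> Ps Pt e; have [] : (i (size s), fold s) = (i (size t), fold t).
  by apply: pinj e; split=> //=; exact: fold_P.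
move=> /iinj; elim: s t Ps Pt {e} => [|x s IH] [|y t] //= [Px Ps] [Py Pt] [st] e.
have [-> e'] : (x, fold s) = (y, fold t).
  by apply: pinj e; split=> //=; exact: fold_P.
by rewrite (IH t).
Qed.

End SeqCode.

(** * The ordinal kappa^+: successors, regularity, closure points *)

Section SuccessorCardinal.
Context {d : Order.disp_t} {W : orderType d} {k : W}.
Hypothesis kcard : is_infinite_cardinal k.
Hypothesis Wsucc : is_cardinal_successor k.
Implicit Types (a b c x y : W).

Lemma IioE a : `]-oo, a[%classic = [set x | x < a].
Proof. by apply/seteqP; split=> x /=; rewrite in_itv. Qed.

Lemma IicE a : `]-oo, a]%classic = [set x | x <= a].
Proof. by apply/seteqP; split=> x /=; rewrite in_itv. Qed.

Notation K := [set x | x < k].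

Lemma succ_wf : well_founded (fun x y : W => x < y).
Proof. by case: Wsucc. Qed.

Let wf := succ_wf.

Lemma K_inf : infinite_set K.
Proof. by case: kcard; rewrite IioE. Qed.

Lemma K_initial a : a < k -> ~ (K #<= [set x | x < a]).
Proof. by case: kcard => _ /(_ a); rewrite !IioE. Qed.

Lemma Iio_small a : [set x | x < a] #<= K.
Proof. by case: Wsucc => _ /(_ a); rewrite !IioE. Qed.

Lemma Iic_small a : [set x | x <= a] #<= K.
Proof. rewrite Iic_Iio; apply: cardle_add1 K_inf _; exact: Iio_small. Qed.

Lemma W_big : ~ ([set: W] #<= K).
Proof. by case: Wsucc => _ _; rewrite IioE. Qed.

Lemma square_small (T : Type) (A : set T) : A #<= K -> square A #<= K.
Proof.
move=> AK; apply: card_le_trans (square_cardle k AK) _.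
have := square_segment wf K_inf.
exact.
Qed.

Lemma exists_gt a : exists b, a < b.
Proof.
apply: contrapT => /forallNP n; apply: W_big.
apply: card_le_trans (Iic_small a); apply: subset_card_le => x _ /=.
by rewrite leNgt; apply/negP/n.
Qed.

Definition succ a := least a [set b | a < b].

Lemma succP a : a < succ a /\ forall b, a < b -> succ a <= b.
Proof. exact: (leastP wf a (S := [set b | a < b])) (exists_gt a). Qed.

Lemma lt_succ a : a < succ a. Proof. by case: (succP a). Qed.

Lemma succ_le a b : (succ a <= b) = (a < b).
Proof.
apply/idP/idP => [|ab]; first exact/lt_le_trans/lt_succ.
by case: (succP a) => _; apply.
Qed.

Lemma lt_succ_le a b : (b < succ a) = (b <= a).
Proof. by rewrite ltNge succ_le leNgt. Qed.

Lemma succ_lt a b : (succ a < succ b) = (a < b).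
Proof. by rewrite lt_succ_le succ_le. Qed.

Lemma succ_inj : injective succ.
Proof.
move=> a b e; apply/eqP; rewrite eq_le -lt_succ_le -e lt_succ.
by rewrite -lt_succ_le e lt_succ.
Qed.

Lemma succ_limit a b : is_limit b -> (succ a < b) = (a < b).
Proof.
move=> [_ lb]; apply/idP/idP => [|ab]; first exact/lt_trans/lt_succ.
by have [c ac cb] := lb _ ab; apply: le_lt_trans cb; rewrite succ_le.
Qed.

Lemma succ_nlimit a : ~ is_limit (succ a).
Proof. by move=> /(succ_limit a); rewrite lt_succ ltxx. Qed.

Lemma bottom_or_succ a : ~ is_limit a ->
  (forall x, a <= x) \/ exists b, a = succ b.
Proof.
move=> nl; have [n|] := pselect (forall x, a <= x); first by left.
move=> /existsNP[x /negP]; rewrite -ltNge => xa; right.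
apply: contrapT => /forallNP ns; apply: nl; split; first by exists x.
move=> y ya; exists (succ y); first exact: lt_succ.
by rewrite lt_neqAle succ_le ya andbT; apply/eqP => e; apply: (ns y).
Qed.

(** Regularity of kappa^+: were [A] cofinal, each [b] would be determined by an element of [A] not
    below it and its place under that element, so kappa^+ would inject into the square of kappa. *)
Lemma bounded (A : set W) : A #<= K -> exists b, forall x, A x -> x < b.
Proof.
move=> AK; apply: contrapT => /forallNP nb; apply: W_big.
have /choice[g gP] : forall b, exists x, A x /\ b <= x.
  move=> b; have /existsNP[x /not_implyP[Ax /negP]] := nb b.
  by rewrite -leNgt => bx; exists x.
have [f [fK finj]] := cardle_inj k AK.
have /choice[e eP] a := cardle_inj k (Iic_small a).
apply: card_le_trans (square_small (card_lexx K)).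
apply: (inj_cardle (f := fun b => (f (g b), e (g b) b))) => [b _|b c _ _ []].
  have [Ag bg] := gP b; split=> /=; first exact: fK.
  by have [+ _] := eP (g b); apply.
have [Ag bg] := gP b; have [Ah ch] := gP c => /finj => /(_ Ag Ah) gg.
by rewrite -gg in ch *; have [_] := eP (g b); apply.
Qed.

Lemma bounded_seq (f : nat -> W) : exists b, forall n, f n < b.
Proof.
have [|b bP] := @bounded (range f).
  apply: card_le_trans (card_image_le f setT) _.
  by apply/infiniteP; exact: K_inf.
by exists b => n; apply: bP; exists n.
Qed.

Lemma pairing_K : exists p : W * W -> W,
  (forall z, square K z -> p z < k) /\
  (forall z w, square K z -> square K w -> p z = p w -> z = w).
Proof. exact: cardle_inj k (square_small (card_lexx K)). Qed.

Lemma nat_K : exists i : nat -> W, (forall n, i n < k) /\ injective i.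
Proof.
have /infiniteP h := K_inf; have [f [fK finj]] := cardle_inj k h.
by exists f; split=> [n|x y]; [exact: fK|exact: finj].
Qed.

Lemma pairing_W : exists p : W * W -> W, injective p.
Proof.
have le : square [set: W] #<= [set: W].
  apply: (initial_square wf) => m _ le; apply: W_big.
  exact: card_le_trans le (square_small (Iic_small m)).
by have [p [_ pinj]] := cardle_inj k le; exists p => z w; apply: pinj.
Qed.

Definition closure_points (g : W -> W) : set W :=
  [set e | forall x, x < e -> g x < e].

Lemma closure_points_unbounded g a :
  exists e, [/\ a < e, is_limit e & closure_points g e].
Proof.
have /choice[h hP] x : exists b, x < b /\ forall y, y <= x -> g y < b.
  have [|b bP] := @bounded (g @` [set y | y <= x]).
    exact: card_le_trans (card_image_le _ _) (Iic_small x).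
  have [c xc] := exists_gt x.
  exists (Order.max b c); rewrite lt_max xc orbT; split=> // y yx.
  by rewrite lt_max bP //; exists y.
(* The supremum of these iterates is a closure point, since [h] dominates [g] on all points up to
   its argument. *)
pose s n := iter n h (succ a).
have s_lt n : s n < s n.+1 by rewrite /s iterS; case: (hP (iter n h (succ a))).
have [b0 b0P] := bounded_seq s.
have := leastP wf b0 (S := [set b | forall n, s n < b]) (ex_intro _ b0 b0P).
set e := least _ _ => -[eb emin].
have ex x : x < e -> exists n, x < s n.
  move=> xe; apply: contrapT => /forallNP nx.
  suff : e <= x by rewrite leNgt xe.
  apply: emin => n; apply: lt_le_trans (s_lt n) _.
  by rewrite leNgt; apply/negP/nx.
exists e; split; first exact: lt_trans (lt_succ a) (eb 0%N).
- split; first by exists a; exact: lt_trans (lt_succ a) (eb 0%N).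
  by move=> x /ex[n xn]; exists (s n).
- move=> x /ex[n xn]; apply: lt_trans (eb n.+1).
  by rewrite /s iterS; case: (hP (iter n h (succ a))) => _; apply; exact: ltW.
Qed.

Lemma closure_points_club g : club_in setT (closure_points g).
Proof.
split=> // [a _ [la ub] x xa|x _].
  have [|y [ya ey] xy] := ub (succ x); first by rewrite IioE /= succ_limit.
  move: ya; rewrite IioE /= => ya; apply: lt_trans ya; apply: ey.
  by rewrite -succ_le.
have [e [xe _ ee]] := closure_points_unbounded g x.
by exists e; [split|exact: ltW].
Qed.

End SuccessorCardinal.

(** * Step functions on ordinals *)

Section StepFunctions.
Context {d : Order.disp_t} {W : orderType d} {k : W}.
Hypothesis kcard : is_infinite_cardinal k.
Hypothesis Wsucc : is_cardinal_successor k.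
Implicit Types (a b c x y z : W) (f g h : W -> int) (l : seq (W * int)).
Local Open Scope ring_scope.
Local Open Scope order_scope.

Let wf := succ_wf Wsucc.

(** The condition of a rho2-modifier at the single limit [b]. *)
Definition cont_at f b := exists2 e, e < b & forall x, e <= x -> x <= b -> f x = f b.

Lemma cont_eq f g a b : is_limit b -> a < b ->
  (forall x, a < x -> x <= b -> f x = g x) -> cont_at g b -> cont_at f b.
Proof.
move=> lb ab fg [e eb ge]; exists (Order.max e (succ a)).
  by rewrite gt_max eb (succ_limit kcard Wsucc).
move=> x; rewrite ge_max (succ_le kcard Wsucc) => /andP[ex ax] xb.
by rewrite !fg // ge.
Qed.

Lemma cont_eqW f g b : is_limit b -> (forall x, x <= b -> f x = g x) ->
  cont_at g b -> cont_at f b.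
Proof. by move=> lb fg; have [[a ab] _] := lb; apply: (cont_eq lb ab) => x _; apply: fg. Qed.

Lemma cont_cst (c : int) b : is_limit b -> cont_at (fun=> c) b.
Proof. by move=> [[a ab] _]; exists a. Qed.

Lemma cont_opp f b : cont_at f b -> cont_at (fun x => - f x) b.
Proof. by move=> [e eb fe]; exists e => // x ex xb; rewrite fe. Qed.

Lemma cont_add f g b :
  cont_at f b -> cont_at g b -> cont_at (fun x => f x + g x) b.
Proof.
move=> [e eb fe] [e' eb' ge]; exists (Order.max e e'); first by rewrite gt_max eb.
by move=> x; rewrite ge_max => /andP[ex ex'] xb; rewrite fe ?ge.
Qed.

Lemma cont_trans g f h b : is_limit b -> cont_at (fun x => f x - g x) b ->
  cont_at (fun x => g x - h x) b -> cont_at (fun x => f x - h x) b.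
Proof.
move=> lb cf cg; apply: (cont_eqW lb) (cont_add cf cg) => x _.
by rewrite addrA subrK.
Qed.

Lemma cont_sym f g b : is_limit b -> cont_at (fun x => f x - g x) b ->
  cont_at (fun x => g x - f x) b.
Proof. by move=> lb /cont_opp; apply: (cont_eqW lb) => x _; rewrite opprB. Qed.

(* Entries at limits are ignored, so that [st l] is always continuous. *)
Definition st l x : int := \sum_(p <- l | (p.1 <= x)%O && ~~ `[< is_limit p.1 >]) p.2.

Lemma st_nil x : st [::] x = 0. Proof. by rewrite /st big_nil. Qed.

Lemma st_cons p l x :
  st (p :: l) x = (if (p.1 <= x)%O && ~~ `[< is_limit p.1 >] then p.2 else 0) + st l x.
Proof. by rewrite /st big_cons; case: ifP => // _; rewrite add0r. Qed.

Definition oppl l := [seq (p.1, - p.2) | p <- l].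

Lemma st_opp l x : st (oppl l) x = - st l x.
Proof. by rewrite /st big_map /= sumrN. Qed.

Lemma st_cont l b : is_limit b -> cont_at (st l) b.
Proof.
move=> lb; elim: l => [|[z c] l IH].
  by apply: (cont_eqW lb) (cont_cst 0 lb) => x _; rewrite st_nil.
apply: (cont_eqW lb) (cont_add _ IH) => [x _|]; first exact: st_cons.
rewrite /=; have [lz|nlz] := pselect (is_limit z).
  apply: (cont_eqW lb) (cont_cst 0 lb) => x _.
  by rewrite (introT (asboolP _) lz) andbF.
rewrite (introF (asboolP _) nlz).
have [zb|bz|zb] := ltgtP z b.
- by exists z => // x zx xb; rewrite zx (ltW zb).
- apply: (cont_eqW lb) (cont_cst 0 lb) => x xb.
  by rewrite leNgt (le_lt_trans xb bz).
- by case: nlz; rewrite zb.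
Qed.

Definition trunc a l := [seq p <- l | (p.1 <= a)%O].

Lemma trunc_le a l p : p \in trunc a l -> (p.1 <= a)%O.
Proof. by rewrite mem_filter => /andP[]. Qed.

Lemma st_trunc a l x : st (trunc a l) x = st l (Order.min a x).
Proof.
rewrite /st big_filter_cond; apply: eq_bigl => p.
by rewrite le_min andbA.
Qed.

Lemma st_truncE a l x : (x <= a)%O -> st (trunc a l) x = st l x.
Proof. by move=> xa; rewrite st_trunc min_r. Qed.

Lemma st_tail a l x : (forall p, p \in l -> (p.1 <= a)%O) -> (a <= x)%O ->
  st l x = st l a.
Proof.
move=> la ax; rewrite /st [LHS]big_seq_cond [RHS]big_seq_cond; apply: eq_bigl => p.
case pl: (p \in l) => //=; have pa := la _ pl.
by rewrite pa (le_trans pa ax).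
Qed.

(** Induction on [a]: at a limit [f] is constant on a final segment, so an earlier list suffices; at
    a successor one jump is added. *)
Lemma compactness f a : (forall b, is_limit b -> (b <= a)%O -> cont_at f b) ->
  exists l, (forall p, p \in l -> (p.1 <= a)%O) /\
    forall x, (x <= a)%O -> f x = st l x.
Proof.
move: a; apply: (wo_ind wf) => a IH fc.
suff [l lP] : exists l, forall x, (x <= a)%O -> f x = st l x.
  exists (trunc a l); split=> [p|x xa]; first exact: trunc_le.
  by rewrite lP // st_truncE.
have IH' y : (y < a)%O -> exists l, (forall p, p \in l -> (p.1 <= y)%O) /\
    forall x, (x <= y)%O -> f x = st l x.
  move=> ya; apply: IH => // b lb ab; apply: fc => //.
  exact: le_trans ab (ltW ya).
have [la|nla] := pselect (is_limit a).
  have [e ea fe] := fc a la (lexx a); have [l [le lP]] := IH' e ea.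
  exists l => x xa; have [xe|ex] := leP x e; first exact: lP.
  by rewrite fe ?(ltW ex) // (st_tail le) ?(ltW ex) // -lP // fe // ltW.
have [amin|[b ab]] := bottom_or_succ kcard Wsucc nla.
  exists [:: (a, f a)] => x xa; have -> : x = a by apply/eqP; rewrite eq_le xa amin.
  by rewrite st_cons st_nil /= lexx (introF (asboolP _) nla) /= addr0.
have ba : (b < a)%O by rewrite ab; exact: (lt_succ kcard Wsucc).
have [l [lb lP]] := IH' b ba.
exists ((a, f a - f b) :: l) => x xa; rewrite st_cons /= (introF (asboolP _) nla) andbT.
have [xb|bx] := leP x b.
  by rewrite leNgt (le_lt_trans xb ba) add0r lP.
have -> : x = a.
  by apply/eqP; rewrite eq_le xa ab (succ_le kcard Wsucc).
by rewrite lexx (st_tail lb) ?(ltW ba) // -lP // subrK.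
Qed.

(** The limit of [st l] from the left at [x]; [jump] is the remaining step at [x] itself. *)
Definition stlt l x : int := \sum_(p <- l | (p.1 < x)%O && ~~ `[< is_limit p.1 >]) p.2.
Definition jump l x : int := \sum_(p <- l | (p.1 == x)%O && ~~ `[< is_limit p.1 >]) p.2.

Lemma st_jump l x : st l x = stlt l x + jump l x.
Proof.
elim: l => [|p l IH]; first by rewrite /st /stlt /jump !big_nil.
move: IH; rewrite /st /stlt /jump !big_cons.
by case: (ltgtP p.1 x) => [px|px|px] /=; case: (`[< is_limit p.1 >]) => /= ->;
  rewrite ?addrA // (addrC p.2).
Qed.

Lemma stlt_near l z : (exists x, (x < z)%O) ->
  exists2 m, (m < z)%O & forall x, (m <= x)%O -> (x < z)%O -> st l x = stlt l z.
Proof.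
move=> [x0 x0z]; elim: l => [|[y c] l [m mz IH]].
  by exists x0 => // x _ _; rewrite st_nil /stlt big_nil.
have [yz|zy] := ltP y z.
  exists (Order.max m y) => [|x]; first by rewrite gt_max mz.
  rewrite ge_max => /andP[mx yx] xz; rewrite st_cons /= yx /= IH //.
  by rewrite /stlt [RHS]big_cons /= yz /=; case: ifP => // _; rewrite add0r.
exists m => // x mx xz; rewrite st_cons /= leNgt (lt_le_trans xz zy) /= add0r IH //.
by rewrite /stlt [RHS]big_cons /= ltNge zy.
Qed.

Lemma stlt_eq l l' z : (forall x, (x < z)%O -> st l x = st l' x) ->
  stlt l z = stlt l' z.
Proof.
move=> ll; have [ex|nex] := pselect (exists x, (x < z)%O).
  have [m mz mP] := stlt_near l ex; have [m' mz' mP'] := stlt_near l' ex.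
  have mm : (Order.max m m' < z)%O by rewrite gt_max mz.
  by rewrite -(mP (Order.max m m')) ?le_max ?lexx // ll // mP' // le_max lexx orbT.
by rewrite /stlt !big1 // => p /andP[pz _]; case: nex; exists p.1.
Qed.

Lemma jump_mem l z : jump l z <> 0 -> z \in [seq p.1 | p <- l].
Proof.
apply: contra_notT => zl; rewrite /jump big_seq_cond big1 // => p.
move=> /andP[pl /andP[/eqP e _]]; move/negP: zl; case; apply/mapP.
by exists p.
Qed.

(** Both functions have the same left limit at [z], so a difference there comes from a nonzero jump
    of one of them. *)
Lemma st_agree l l' z : (forall x, (x < z)%O -> st l x = st l' x) ->
  st l z <> st l' z -> z \in [seq p.1 | p <- l] \/ z \in [seq p.1 | p <- l'].
Proof.
move=> /stlt_eq e; rewrite !st_jump e => ne.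
have [|nj] := pselect (jump l z = 0); last by left; apply: jump_mem.
have [|nj] := pselect (jump l' z = 0); last by right; apply: jump_mem.
by move=> j j'; case: ne; rewrite j j'.
Qed.

(** An embedding of [A] into [m] copies of kappa, by block number and place in the block. This form
    of order type below kappa times omega passes directly to subsets and to finitely many
    consecutive pieces. *)
Definition thin (A : set W) := exists (m : nat) (h : W -> nat) (g : W -> W),
  (forall a, A a -> (h a < m)%N /\ (g a < k)%O) /\
  forall a b, A a -> A b -> (a < b)%O ->
    (h a < h b)%N \/ (h a = h b /\ (g a < g b)%O).

Lemma thin_sub (A B : set W) : A `<=` B -> thin B -> thin A.
Proof.
move=> AB [m [h [g [hB gB]]]]; exists m, h, g; split=> [a /AB/hB //|a b /AB Aa /AB].
exact: gB.
Qed.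

Lemma thin_split z (A : set W) : thin (A `&` [set x | (x < z)%O]) ->
  thin (A `&` [set x | (z <= x)%O]) -> thin A.
Proof.
move=> [m [h [g [hA gA]]]] [m' [h' [g' [hA' gA']]]].
exists (m + m')%N, (fun x => if (x < z)%O then h x else (m + h' x)%N),
  (fun x => if (x < z)%O then g x else g' x); split.
  move=> a Aa; case: ltP => az.
    by have [] := hA a (conj Aa az); split=> //; lia.
  by have [] := hA' a (conj Aa az); split=> //; lia.
move=> a b Aa Ab ab; case: (ltP a z) => az; case: (ltP b z) => bz.
- exact: gA.
- by left; have [] := hA a (conj Aa az); lia.
- by move: (lt_trans ab bz); rewrite ltNge az.
- have [lt|[-> gg]] := gA' a b (conj Aa az) (conj Ab bz) ab; last by right.
  by left; lia.
Qed.

Lemma thin1 z (A : set W) : (forall x, A x -> x = z) -> thin A.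
Proof.
move=> Az; exists 1%N, (fun=> 0%N), (fun=> xget k [set x | (x < k)%O]).
split=> [a _|a b /Az -> /Az ->]; last by rewrite ltxx.
split=> //; have [x xk] := infinite_setN0 (K_inf kcard).
exact: (xgetI (P := [set x | (x < k)%O]) k xk).
Qed.

Definition convex (I : set W) := forall x y z, I x -> I z -> (x <= y)%O ->
  (y <= z)%O -> I y.

(** Clause (c) of [Sk] for all convex sets and all integer levels, a form preserved by adding step
    functions. *)
Definition level_thin c f := forall (n : int) (I : set W), convex I ->
  (forall x, I x -> (x <= c)%O /\ n <= f x) -> thin (I `&` [set x | f x = n]).

Lemma level_thin_eq c f g : (forall x, (x <= c)%O -> f x = g x) ->
  level_thin c g -> level_thin c f.
Proof.
move=> fg gt n I cI In.
have /thin_sub : I `&` [set x | f x = n] `<=` I `&` [set x | g x = n].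
  by move=> x [Ix /=]; rewrite fg //; case: (In x Ix).
apply; apply: gt => // x Ix; have [xc] := In x Ix.
by rewrite fg.
Qed.

Lemma convex_lt I z : convex I -> convex (I `&` [set x | (x < z)%O]).
Proof.
move=> cI x y w [Ix xz] [Iw wz] xy yw; split; first exact: (cI x y w).
exact: le_lt_trans yw wz.
Qed.

Lemma convex_ge I z : convex I -> convex (I `&` [set x | (z <= x)%O]).
Proof.
move=> cI x y w [Ix xz] [Iw wz] xy yw; split; first exact: (cI x y w).
exact: le_trans xz xy.
Qed.

(** Split the convex set at [z]: level [n] of the sum is level [n] of [f] before [z] and level
    [n - e] of [f] from [z] on. *)
Lemma level_thin_step c f z (e : int) : level_thin c f ->
  level_thin c (fun x => (if (z <= x)%O then e else 0) + f x).
Proof.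
move=> ft n I cI In; apply: (@thin_split z).
  apply: thin_sub (ft n _ (convex_lt (z := z) cI) _).
    move=> x [[Ix /=] + xz]; rewrite leNgt [(x < z)%O]xz add0r => fx.
    by do !split.
  by move=> x [Ix xz]; have [xc] := In x Ix; rewrite leNgt [(x < z)%O]xz add0r.
apply: thin_sub (ft (n - e) _ (convex_ge (z := z) cI) _).
  move=> x [[Ix /=] + xz]; rewrite [(z <= x)%O]xz => fx.
  by do !split; rewrite //= -fx addrAC subrr add0r.
move=> x [Ix xz]; have [xc] := In x Ix; rewrite [(z <= x)%O]xz => nx; split=> //.
by rewrite lerBlDl.
Qed.

Lemma level_thin_st c f l : level_thin c f ->
  level_thin c (fun x => f x + st l x).
Proof.
move=> ft; elim: l => [|[z e] l IH].
  by apply: level_thin_eq ft => x _; rewrite st_nil addr0.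
have [lz|nlz] := pselect (is_limit z).
  apply: level_thin_eq IH => x _.
  by rewrite st_cons /= (introT (asboolP _) lz) andbF add0r.
apply: level_thin_eq (level_thin_step (z := z) (e := e) IH) => x _.
by rewrite st_cons /= (introF (asboolP _) nlz) andbT addrCA.
Qed.

(** The value at [b] is the lower limit from below, attained cofinally; this yields clauses (a) and
    (b) of [Sk]. *)
Definition liminf_at f b :=
  (forall e, (e < b)%O -> exists x, [/\ (e < x)%O, (x < b)%O & f x <= f b]) /\
  exists2 e, (e < b)%O & forall x, (e < x)%O -> (x < b)%O -> f b <= f x.

Lemma liminf_cont f g b : is_limit b -> cont_at (fun x => f x - g x) b ->
  liminf_at g b -> liminf_at f b.
Proof.
move=> lb [e0 e0b fg] [gu [e eb ge]].
have fE x : (e0 <= x)%O -> (x <= b)%O -> f x = g x + (f b - g b).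
  by move=> ex xb; rewrite -(fg x ex xb) addrC subrK.
split=> [e1 e1b|].
  have [|x [ex xb gx]] := gu (Order.max e0 e1); first by rewrite gt_max e0b.
  move: ex; rewrite gt_max => /andP[e0x e1x]; exists x; split=> //.
  by rewrite fE ?(ltW e0x) ?(ltW xb) //; lia.
exists (Order.max e0 e); first by rewrite gt_max e0b.
move=> x; rewrite gt_max => /andP[e0x ex] xb.
by rewrite (fE x) ?(ltW e0x) ?(ltW xb) //; have := ge x ex xb; lia.
Qed.

End StepFunctions.

Arguments thin {d W} k A.
Arguments level_thin {d W} k c f.

(** * The guessed base sequences *)

Section BaseSequences.
Context {d : Order.disp_t} {W : orderType d} {k : W}.
Hypothesis kcard : is_infinite_cardinal k.
Hypothesis Wsucc : is_cardinal_successor k.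
Context (C X : W -> set W).
Hypothesis C_club : forall a, is_limit a ->
  club_in `]-oo, a[%classic (C a) /\ otp_le (C a) k.
Hypothesis CX_acc : forall a b, acc (C a) b ->
  C b = C a `&` `]-oo, b[%classic /\ X b = X a `&` `]-oo, b[%classic.
Context (unp : W -> W * W) (en : W -> W -> seq (W * int)).
Context (code : W * seq (W * int) -> W).
Implicit Types (a b c e x y z : W) (f g h s v : W -> int) (l : seq (W * int)).
Local Open Scope ring_scope.
Local Open Scope order_scope.

Let wf := succ_wf Wsucc.

Definition rank (D : set W) := rk wf k setT D.

(** The list tested at [c]: the rank of [c] decodes to a pair (j, i), which names the i-th list
    attached to the j-th element of [D]. Only the part of [D] up to [c] is consulted, as coherence
    demands. *)
Definition cand (D : set W) c : seq (W * int) := let z := unp (rank D c) in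
  en (xget c [set y | [/\ D y, y <= c & rank D y = z.1]]) z.2.

Definition below (D : set W) x : set W := [set c | D c /\ c < x].
Definition is_max (S : set W) : set W := [set c | S c /\ forall c', S c' -> c' <= c].
Definition next_in (D S : set W) := least k [set c | D c /\ ~ S c].
Definition upto (Y : Type) (y0 : Y) e (f : W -> Y) : W -> Y :=
  fun x => if x <= e then f x else y0.
Definition splice s c v x : int :=
  if x <= c then s x else if x <= succ c then 0 else v x.

(* [v] continues [s] on the block from [c] to [e] so that its shift by [st l]
   leaves, before [e], the set of nodes coded by [Xe]. *)
Definition escapes (F : W -> W -> int) (Xe : set W) c e l s v : Prop :=
  [/\ forall b, is_limit b -> b <= e -> cont_at (fun x => v x - F e x) b,
      forall x, x <= e -> succ c < x -> 1 <= v x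
    & exists xi l', [/\ succ c < xi, xi < e, code (xi, l') < e,
        ~ Xe (code (xi, l'))
      & forall x, x <= xi -> splice s c v x + st l x = F xi x + st l' x]].

(** The default adds 1 so that, with [F] nonnegative, either choice is positive on the block and
    zeros stay confined to marked points. *)
Definition continuation F Xe c e l s : W -> int :=
  if pselect (exists v, escapes F Xe c e l s v) is left h then projT1 (cid h)
  else fun x => F e x + 1.

Definition marked (D : set W) x := acc D x \/ exists2 c, D c & x = succ c.

(** The block of [x] runs from the last club point [c] before [x] to the first club point [e] at or
    after it. Base maps, guessed set and previous values are truncated at [e] and [c], so that
    levels whose clubs share an initial part make the same choices there. *)
Definition branch_step a (F : W -> W -> int) x (s : W -> int) : int :=
  let S := below (C a) x in let e := next_in (C a) S in
  if pselect (marked (C a) x) then 0 else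
  if pselect (is_max S !=set0) is left h then
    let c := projT1 (cid h) in
    continuation (upto (fun=> 0) e F) (X a `&` [set x | x < e]) c e (cand (C a) c)
      (upto 0 c s) x
  else F e x + 1.

Definition base_step a (F : W -> W -> int) : W -> int :=
  if pselect (is_limit a) then
    fun x => if x < a then wfrec wf 0 (branch_step a F) x else 0
  else fun x => if x < a then F (xget k [set b | a = succ b]) x else 0.

Definition base : W -> W -> int := wfrec wf (fun=> 0) base_step.

Notation F := base.

Lemma base_nlimit a : ~ is_limit a ->
  F a = fun x => if x < a then F (xget k [set b | a = succ b]) x else 0.
Proof.
move=> nla; rewrite {1}/base wfrecE /base_step; case: pselect => //= _.
apply/funext => x; case: ifP => // xa; congr (_ x); rewrite /cut.
case: xgetP => [b _ ab|nb]; first by rewrite {1}ab (lt_succ kcard Wsucc).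
have [amin|[b ab]] := bottom_or_succ kcard Wsucc nla; last by case: (nb b).
by move: xa; rewrite ltNge amin.
Qed.

Lemma base_top a x : a <= x -> F a x = 0.
Proof.
move=> ax; have [la|/base_nlimit ->] := pselect (is_limit a); last first.
  by rewrite ltNge ax.
by rewrite /base wfrecE /base_step; case: pselect => //= _; rewrite ltNge ax.
Qed.

Lemma base_bottom a x : (forall y, a <= y) -> F a x = 0.
Proof. by move=> amin; apply: base_top. Qed.

Lemma base_succ b x : F (succ b) x = if x <= b then F b x else 0.
Proof.
rewrite base_nlimit; last exact: (succ_nlimit kcard Wsucc).
rewrite (lt_succ_le kcard Wsucc); case: ifP => // _; congr (F _ x).
by apply: xget_unique => //= y /(succ_inj kcard Wsucc).
Qed.

Section Limit.
Variable a : W.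
Hypothesis la : is_limit a.
Notation D := (C a).

Lemma D_lt c : D c -> c < a.
Proof. by have [[sub _ _] _] := C_club la => /sub; rewrite IioE. Qed.

Lemma D_cofinal x : x < a -> exists c, [/\ D c, x < c & c < a].
Proof.
move=> xa; have [[_ _ ub] _] := C_club la.
have [|c [ca Dc] xc] := ub (succ x).
  by rewrite IioE /= (succ_limit kcard Wsucc).
by exists c; rewrite -(succ_le kcard Wsucc) D_lt.
Qed.

Lemma D_closed x : x < a -> is_limit x ->
  (forall y, y < x -> exists c, [/\ D c, y < c & c < x]) -> acc D x.
Proof.
move=> xa lx ub; have lp : limit_point D x.
  split=> // y; rewrite IioE /= => /ub[c [Dc yc cx]].
  by exists c; [split|exact: ltW].
by split=> //; have [[_ cl _] _] := C_club la; apply: cl => //; rewrite IioE.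
Qed.

Lemma next_lt x : x < a -> let e := next_in D (below D x) in
  [/\ D e, x <= e, e < a & forall c, D c -> x <= c -> e <= c].
Proof.
move=> xa e.
have [|[De ne] emin] := leastP wf k (S := [set c | D c /\ ~ below D x c]).
  have [c [Dc xc _]] := D_cofinal xa; exists c; split=> //.
  by move=> [_]; rewrite ltNge (ltW xc).
have xe : x <= e by rewrite leNgt; apply/negP => ex; apply: ne.
split=> //; first exact: D_lt.
by move=> c Dc xc; apply: emin; split=> // -[_]; rewrite ltNge xc.
Qed.

(** Without a maximum, the supremum of the club points below [x] is an accumulation point. It is not
    [x] by hypothesis, and if smaller it would be a club point below its own strict bound. *)
Lemma max_below x c : x < a -> ~ acc D x -> D c -> c < x ->
  is_max (below D x) !=set0.
Proof.
move=> xa nacc Dc cx; apply: contrapT => nmax.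
have gt c' : below D x c' -> exists c'', below D x c'' /\ c' < c''.
  move=> bc; apply: contrapT => /forallNP n; apply: nmax; exists c'; split=> //.
  move=> c'' bc''; rewrite leNgt; apply/negP => lt; apply: (n c''); by split.
have [|yub ymin] := leastP wf k (S := [set y | forall c', below D x c' -> c' < y]).
  by exists x => c' [].
set y := least _ _ in yub ymin.
have yx : y <= x by apply: ymin => c' [].
have ub z : z < y -> exists c', below D x c' /\ z < c'.
  move=> zy; apply: contrapT => /forallNP n.
  have [c' [bc' zc']] : exists c', below D x c' /\ z <= c'.
    apply: contrapT => /forallNP n'; suff : y <= z by rewrite leNgt zy.
    by apply: ymin => c' bc'; rewrite ltNge; apply/negP => zc'; apply: (n' c').
  have [c'' [bc'' lt]] := gt c' bc'; apply: (n c''); split=> //.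
  exact: le_lt_trans zc' lt.
have ly : is_limit y.
  split; first by exists c; apply: yub.
  by move=> z /ub[c' [bc' zc']]; exists c' => //; apply: yub.
have ay : acc D y.
  apply: D_closed => //; first exact: le_lt_trans yx xa.
  by move=> z /ub[c' [bc' zc']]; exists c'; split=> //; [case: bc'|exact: yub].
move: yx; rewrite le_eqVlt => /orP[/eqP yx|yx]; first by apply: nacc; rewrite -yx.
by have := yub y (conj ay.1 yx); rewrite ltxx.
Qed.

(** The recursion equation freed of its truncations: only base maps of levels up to [e < a] and
    values before [x] are consulted. *)
Lemma base_limit x : x < a -> F a x = branch_step a F x (F a).
Proof.
move=> xa.
have Fa y : y < a -> F a y = wfrec wf 0 (branch_step a (cut (fun=> 0) a F)) y.
  by move=> ya; rewrite {1}/base wfrecE /base_step; case: pselect => //= _; rewrite ya.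
rewrite Fa // wfrecE /branch_step.
have [De xe ea _] := next_lt xa; set e := next_in _ _ in De xe ea *.
case: pselect => //= _; case: pselect => [h|_]; last by rewrite /cut ea.
case: (cid h) => c /= [[Dc cx] _].
congr (continuation _ _ c e _ _ x); apply/funext => y; rewrite /upto.
  by case: ifP => // ye; rewrite /cut (le_lt_trans ye ea).
case: ifP => // yc; rewrite /cut (le_lt_trans yc cx) Fa //.
exact: le_lt_trans yc (D_lt Dc).
Qed.

Lemma marked0 x : x < a -> marked D x -> F a x = 0.
Proof. by move=> xa m; rewrite base_limit // /branch_step; case: pselect. Qed.

End Limit.

(** Below [b] the clubs and guessed sets of [a] and [b] coincide, so both recursions choose the same
    block, candidate and continuation. *)
Lemma base_acc a b x : is_limit a -> b < a -> acc (C a) b -> x < b -> F b x = F a x.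
Proof.
move=> la ba ab; have [Cb Xb] := CX_acc ab; have lb : is_limit b by case: ab => _ [].
have bE y : y <= b -> below (C b) y = below (C a) y.
  move=> yb; rewrite Cb IioE; apply/seteqP; split=> c /=; first by case=> -[].
  by move=> [Dc cy]; do !split=> //; exact: lt_le_trans cy yb.
move: x; apply: (wo_ind wf) => x IH xb; have xa := lt_trans xb ba.
rewrite !base_limit // /branch_step bE ?(ltW xb) //.
have [De xe ea emin] := next_lt la xa.
have [De' xe' eb' emin'] := next_lt lb xb.
have -> : next_in (C b) (below (C a) x) = next_in (C a) (below (C a) x).
  move: De' xe' eb' emin'; rewrite bE ?(ltW xb) // => De' xe' eb' emin'.
  apply/eqP; rewrite eq_le emin ?andbT //; last by move: De'; rewrite Cb => -[].
  apply: emin' => //; rewrite Cb IioE; split=> //=.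
  by apply: le_lt_trans eb'; apply: emin => //; move: De'; rewrite Cb => -[].
set e := next_in _ _ in De xe ea emin *.
have eb : e < b.
  apply: le_lt_trans eb'; apply: emin; last by [].
  by move: De'; rewrite {1}Cb => -[].
have markE : marked (C b) x = marked (C a) x.
  apply/propext; split=> -[[Dx [lx ub]]|[c Dc xc]].
  - left; split; first by move: Dx; rewrite Cb => -[].
    by split=> // y /ub[z [zx Dz] yz]; exists z => //; move: Dz; rewrite Cb => -[Dz _].
  - by right; exists c => //; move: Dc; rewrite Cb => -[].
  - left; split; first by rewrite Cb IioE.
    split=> // y /ub[z [zx Dz] yz]; exists z => //; split=> //; rewrite Cb IioE.
    by split=> //=; move: zx; rewrite IioE /= => zx; exact: lt_trans xb.
  - right; exists c => //; rewrite Cb IioE; split=> //=.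
    by apply: lt_trans xb; rewrite xc (lt_succ kcard Wsucc).
rewrite markE; case: pselect => //= _; case: pselect => [h|//].
case: (cid h) => c /= [[Dc cx] _]; have cb := lt_trans cx xb.
have rE y : y < b -> rank (C b) y = rank (C a) y.
  move=> yb; apply: eq_rk => z zy; rewrite Cb IioE; split=> [[]//|Dz].
  by split=> //=; exact: lt_trans zy yb.
congr (continuation _ _ c e _ _ x).
- rewrite Xb IioE; apply/seteqP; split=> y /=; first by case=> -[].
  by move=> [Xy ye]; do !split=> //; exact: lt_trans ye eb.
- rewrite /cand rE //; congr (en (xget c _) _); apply/seteqP.
  split=> y /= [Dy yc]; have yb := le_lt_trans yc cb; rewrite (rE _ yb) => r; split=> //.
    by move: Dy; rewrite Cb => -[].
  by rewrite Cb IioE.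
- apply/funext => y; rewrite /upto; case: ifP => // yc.
  have yx := le_lt_trans yc cx; apply: IH => //; exact: lt_trans yx xb.
Qed.

End BaseSequences.

(** * Coherence, lower limits and order types of the base maps *)

Section BaseProperties.
Context {d : Order.disp_t} {W : orderType d} {k : W}.
Hypothesis kcard : is_infinite_cardinal k.
Hypothesis Wsucc : is_cardinal_successor k.
Context (C X : W -> set W).
Hypothesis C_club : forall a, is_limit a ->
  club_in `]-oo, a[%classic (C a) /\ otp_le (C a) k.
Hypothesis CX_acc : forall a b, acc (C a) b ->
  C b = C a `&` `]-oo, b[%classic /\ X b = X a `&` `]-oo, b[%classic.
Context (unp : W -> W * W) (en : W -> W -> seq (W * int)).
Context (code : W * seq (W * int) -> W).
Implicit Types (a b c e x y z : W) (f g h s v : W -> int) (l : seq (W * int)).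
Local Open Scope ring_scope.
Local Open Scope order_scope.

Let wf := succ_wf Wsucc.
Notation F := (base Wsucc C X unp en code).
Notation rank := (rank Wsucc).
Notation cand := (cand Wsucc unp en).

Lemma continuationP G Xe c e l s : (forall x, 0 <= G e x) ->
  let v := continuation code G Xe c e l s in
  (forall b, is_limit b -> b <= e -> cont_at (fun x => v x - G e x) b) /\
  forall x, x <= e -> succ c < x -> 1 <= v x.
Proof.
move=> G0; rewrite /continuation; case: pselect => [h|_].
  by case: (cid h) => v [].
split=> [b lb _|x _ _]; last by rewrite lerDr.
apply: (cont_eqW kcard Wsucc lb) (cont_cst 1 lb) => x _.
by rewrite addrAC subrr add0r.
Qed.

Lemma upto_id (Y : Type) (y0 : Y) e (f : W -> Y) x : x <= e -> upto y0 e f x = f x.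
Proof. by rewrite /upto => ->. Qed.

Section Block.
Variable a : W.
Hypothesis la : is_limit a.

Lemma below_eq y b : y <= b -> b < a ->
  (forall z, y <= z -> z <= b -> ~ marked (C a) z) ->
  below (C a) y = below (C a) b.
Proof.
move=> yb ba nm; apply/seteqP; split=> c [Dc cy]; split=> //.
  exact: lt_le_trans yb.
rewrite ltNge; apply/negP => yc; apply: (nm (succ c)).
- by apply: le_trans yc (ltW _); exact: (lt_succ kcard Wsucc).
- by rewrite (succ_le kcard Wsucc).
- by right; exists c.
Qed.

(** Around an unmarked point the base map is a positive modification of a lower one. Nonnegativity
    at lower levels is assumed because [base_ge0] is itself proved by induction through this
    lemma. *)
Lemma block b : b < a -> ~ marked (C a) b ->
  (forall e x, e < a -> 0 <= F e x) ->
  exists e v, [/\ b <= e, e < a,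
    forall y, is_limit y -> y <= e -> cont_at (fun x => v x - F e x) y
    & forall y, y < a -> (forall z, y <= z -> z <= b -> ~ marked (C a) z) ->
        (forall z, b <= z -> z <= y -> ~ marked (C a) z) ->
        [/\ y <= e, F a y = v y & 1 <= v y]].
Proof.
move=> ba nmb F0; have [De be ea emin] := next_lt kcard Wsucc C_club la ba.
set e := next_in _ _ in De be ea emin.
pose v := if pselect (is_max (below (C a) b) !=set0) is left h then
    let c := projT1 (cid h) in
    continuation code (upto (fun=> 0) e F) (X a `&` [set x | x < e]) c e
      (cand (C a) c) (upto 0 c (F a))
  else fun x => F e x + 1.
have U0 x : 0 <= upto (fun=> 0) e F e x by rewrite upto_id // F0.
have UE : upto (fun=> 0) e F e = F e by rewrite upto_id.
exists e, v; split=> //.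
  rewrite /v; case: pselect => [h|_] y ly ye.
    have [+ _] := continuationP (X a `&` [set x | x < e]) (projT1 (cid h))
      (cand (C a) (projT1 (cid h))) (upto 0 (projT1 (cid h)) (F a)) U0.
    by rewrite UE; apply.
  apply: (cont_eqW kcard Wsucc ly) (cont_cst 1 ly) => x _.
  by rewrite addrAC subrr add0r.
move=> y ya nm1 nm2.
have bE : below (C a) y = below (C a) b.
  by have [yb|/ltW by_] := leP y b; [exact: below_eq|symmetry; exact: below_eq].
have nmy : ~ marked (C a) y.
  by have [yb|/ltW by_] := leP y b; [exact: nm1|exact: nm2].
have ye : y <= e.
  have [yb|by_] := leP y b; first exact: le_trans yb be.
  rewrite leNgt; apply/negP => ey.
  have : below (C a) y e by split.
  by rewrite bE => -[_]; rewrite ltNge be.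
rewrite (base_limit kcard Wsucc X C_club) // /branch_step bE -/e.
split=> //; first by case: pselect => //= _; rewrite /v; case: pselect.
rewrite /v; case: pselect => [h|_]; last by rewrite lerDr F0.
have [_] := continuationP (X a `&` [set x | x < e]) (projT1 (cid h))
  (cand (C a) (projT1 (cid h))) (upto 0 (projT1 (cid h)) (F a)) U0.
apply=> //; case: (cid h) => c /= [+ _]; rewrite -bE => -[Dc cy].
rewrite lt_neqAle (succ_le kcard Wsucc) cy andbT; apply/eqP => e'; apply: nmy.
by right; exists c.
Qed.

Lemma unmarked_near b : is_limit b -> b < a -> ~ marked (C a) b ->
  exists2 m, m < b & forall z, m < z -> z <= b -> ~ marked (C a) z.
Proof.
move=> lb ba nmb; have nacc : ~ acc (C a) b by move=> h; apply: nmb; left.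
have nmz c z : (forall c', C a c' -> c' < b -> c' <= c) -> succ c < z -> z <= b ->
    ~ marked (C a) z.
  move=> cmax cz; rewrite le_eqVlt => /orP[/eqP -> //|zb].
  have cz' : c < z by apply: lt_trans cz; exact: (lt_succ kcard Wsucc).
  case=> [[Dz _]|[c' Dc' zc']]; first by have := cmax z Dz zb; rewrite leNgt cz'.
  have c'z : c' < z by rewrite zc'; exact: (lt_succ kcard Wsucc).
  have := cmax c' Dc' (lt_trans c'z zb).
  by rewrite leNgt => /negP; apply; rewrite -(succ_lt kcard Wsucc) -zc'.
have [[c [Dc cb]]|n] := pselect (below (C a) b !=set0).
  have [c0 [[Dc0 c0b] c0max]] := max_below Wsucc C_club la ba nacc Dc cb.
  exists (succ c0); first by rewrite (succ_limit kcard Wsucc).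
  by move=> z; apply: nmz => c' Dc' c'b; apply: c0max; split.
have [[m mb] _] := lb; exists (succ m); first by rewrite (succ_limit kcard Wsucc).
move=> z mz zb; apply: (nmz m) => // c' Dc' c'b.
by case: n; exists c'.
Qed.

Lemma marked_cofinal b e : is_limit b -> (b = a \/ b < a /\ acc (C a) b) -> e < b ->
  exists x, [/\ e < x, x < b & F a x = 0].
Proof.
move=> lb ab eb; have [c [Dc ec cb ca]] : exists c, [/\ C a c, e < c, c < b & c < a].
  case: ab => [ba|[ba [_ [_ ub]]]].
    rewrite ba in eb *; have [c [Dc ec ca]] := D_cofinal kcard Wsucc C_club la eb.
    by exists c.
  have [|c [+ Dc] ec] := ub (succ e); first by rewrite IioE /= (succ_limit kcard Wsucc).
  rewrite IioE /= => cb; exists c; split=> //; last exact: lt_trans cb ba.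
  by rewrite -(succ_le kcard Wsucc).
exists (succ c); split.
- by apply: lt_trans ec _; exact: (lt_succ kcard Wsucc).
- by rewrite (succ_limit kcard Wsucc).
- apply: (marked0 kcard Wsucc X C_club) => //; last by right; exists c.
  by rewrite (succ_limit kcard Wsucc).
Qed.

End Block.

Lemma base_ge0 a x : 0 <= F a x.
Proof.
move: a x; apply: (wo_ind wf) => a IH x.
have [xa|ax] := ltP x a; last by rewrite (base_top kcard Wsucc).
have [la|nla] := pselect (is_limit a); last first.
  have [amin|[b ab]] := bottom_or_succ kcard Wsucc nla; first by rewrite (base_bottom kcard Wsucc).
  by rewrite ab (base_succ kcard Wsucc); case: ifP => // _; apply: IH; rewrite ab (lt_succ kcard Wsucc).
have [m|nm] := pselect (marked (C a) x); first by rewrite (marked0 kcard Wsucc X C_club).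
have [|e [v [xe ea _ /(_ x xa)]]] := block la xa nm; first by move=> e y /IH.
case=> [z xz zx|z xz zx|_ -> v1]; last exact: le_trans v1.
- by have -> : z = x by apply/eqP; rewrite eq_le zx.
- by have -> : z = x by apply/eqP; rewrite eq_le zx.
Qed.

(** Reduces coherence at [b] to lower levels: at an accumulation point of the club [e] is [b], by
    [base_acc]; at an unmarked limit [e] is the end of the block. *)
Lemma base_cont_limit a b : is_limit a -> is_limit b -> b < a ->
  exists2 e, b <= e & e < a /\ cont_at (fun x => F a x - F e x) b.
Proof.
move=> la lb ba; have [m|nm] := pselect (marked (C a) b).
  exists b => //; split=> //; apply: (cont_eqW kcard Wsucc lb) (cont_cst 0 lb) => x.
  case: m => [ab|[c _ bc]]; last by case: (succ_nlimit kcard Wsucc (a := c)); rewrite -bc.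
  rewrite le_eqVlt => /orP[/eqP ->|xb]; last first.
    by rewrite (base_acc kcard Wsucc C_club CX_acc unp en code la ba ab xb) subrr.
  by rewrite (marked0 kcard Wsucc X C_club) ?(base_top kcard Wsucc) ?subrr //; left.
have [e [v [be ea vc vE]]] := block la ba nm (fun e x _ => base_ge0 e x).
exists e => //; split=> //; have [m mb mP] := unmarked_near la lb ba nm.
apply: (cont_eq kcard Wsucc lb mb) (vc b lb be) => x mx xb.
have [|z xz zb|z bz zx|_ -> //] := vE x.
- exact: le_lt_trans xb ba.
- by apply: mP => //; exact: lt_le_trans xz.
- have -> : z = b by apply/eqP; rewrite eq_le bz (le_trans zx xb).
  exact: mP.
Qed.

Lemma base_coherent a a' b : a' <= a -> is_limit b -> b <= a' ->
  cont_at (fun x => F a' x - F a x) b.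
Proof.
move: a a' b; apply: (wo_ind wf) => a IH a' b.
rewrite le_eqVlt => /orP[/eqP ->|a'a] lb ba'.
  by apply: (cont_eqW kcard Wsucc lb) (cont_cst 0 lb) => x _; rewrite subrr.
have ba := le_lt_trans ba' a'a.
have [la|nla] := pselect (is_limit a); last first.
  have [amin|[c ac]] := bottom_or_succ kcard Wsucc nla.
    by move: a'a; rewrite ltNge amin.
  rewrite ac (lt_succ_le kcard Wsucc) in a'a.
  apply: (cont_eqW kcard Wsucc lb) (IH c _ a' b a'a lb ba') => [x xb|].
    by rewrite ac (base_succ kcard Wsucc) (le_trans xb (le_trans ba' a'a)).
  by rewrite ac (lt_succ kcard Wsucc).
have [e be [ea ce]] := base_cont_limit la lb ba.
apply: (cont_trans kcard Wsucc (g := F e)) => //; last exact: (cont_sym kcard Wsucc).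
have [ae|ea'] := leP a' e; first exact: IH.
by apply: (cont_sym kcard Wsucc) => //; apply: IH => //; exact: ltW.
Qed.

(** At a limit [a] itself and at accumulation points of its club the value is 0 and zeros are
    cofinal. Other limits inherit the property from a lower level through [liminf_cont]. *)
Lemma base_liminf a b : is_limit b -> b <= a -> liminf_at (F a) b.
Proof.
move: a b; apply: (wo_ind wf) => a IH b lb ba.
have [la|nla] := pselect (is_limit a); last first.
  have [amin|[c ac]] := bottom_or_succ kcard Wsucc nla.
    by case: lb => -[x xb] _; move: (lt_le_trans xb ba); rewrite ltNge amin.
  have bc : b <= c.
    rewrite -(lt_succ_le kcard Wsucc) -ac lt_neqAle ba andbT; apply/eqP => e.
    by case: nla; rewrite -e.
  have ca : c < a by rewrite ac (lt_succ kcard Wsucc).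
  apply: (liminf_cont lb) (IH c ca b lb bc).
  by apply: (cont_sym kcard Wsucc) => //; apply: base_coherent => //; exact: ltW.
have zero : (b = a \/ b < a /\ acc (C a) b) -> liminf_at (F a) b.
  move=> h; have b0 : F a b = 0.
    case: h => [->|[ba' ab]]; first exact: base_top.
    by apply: (marked0 kcard Wsucc X C_club) => //; left.
  split=> [e eb|]; last first.
    by have [[e eb] _] := lb; exists e => // x _ _; rewrite b0 base_ge0.
  have [x [ex xb x0]] := marked_cofinal la lb h eb.
  by exists x; rewrite b0 x0.
move: ba; rewrite le_eqVlt => /orP[/eqP ba|ba]; first by apply: zero; left.
have [ab|nab] := pselect (acc (C a) b); first by apply: zero; right.
have [e be [ea ce]] := base_cont_limit la lb ba.
exact: (liminf_cont lb ce (IH e ea b lb be)).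
Qed.

(** Sending a marked point to the first club point at or after it is strictly increasing, and the
    club has order type at most kappa; [a] adds one point. *)
Lemma base_thin_zero a : is_limit a ->
  thin k [set x | x <= a /\ (marked (C a) x \/ x = a)].
Proof.
move=> la; apply: (thin_split (z := a)); last first.
  apply: (thin1 kcard (z := a)) => x [[xa _] /= ax].
  by apply/eqP; rewrite eq_le xa.
have [_ [u uk [phi [[phiK _ _] phi_mono]]]] := C_club la.
pose nx x := next_in (k := k) (C a) (below (C a) x).
have nxP x : x < a -> [/\ C a (nx x), x <= nx x, nx x < a
    & forall c, C a c -> x <= c -> nx x <= c].
  exact: (next_lt kcard Wsucc C_club la).
exists 1%N, (fun=> 0%N), (phi \o nx); split=> [x [_ /= xa]|x y [[_ mx] /= xa] [[_ my] /= ya] xy].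
  split=> //; have [Dn _ _ _] := nxP x xa.
  by have := phiK _ Dn; rewrite IioE /= => /lt_le_trans; apply.
right; split=> //; have [Dx xn _ xmin] := nxP x xa; have [Dy yn _ _] := nxP y ya.
rewrite phi_mono ?inE //; case: my => [my|ey]; last by move: ya; rewrite ey ltxx.
case: mx => [mx|ex]; last by move: xa; rewrite ex ltxx.
case: my => [[Dy' [ly ub]]|[c Dc yc]].
  have [|z [zy Dz] xz] := ub x; first by rewrite IioE.
  apply: lt_le_trans yn; move: zy; rewrite IioE /=; apply: le_lt_trans.
  exact: xmin.
apply: lt_le_trans yn; rewrite yc (lt_succ_le kcard Wsucc); apply: xmin => //.
by rewrite -(lt_succ_le kcard Wsucc) -yc.
Qed.

(** At a limit level with [n >= 1], a convex set with values at least [n] avoids the zeros, hence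
    lies in one block, where the base map is a lower one plus a step function. For [n <= 0] the
    level consists of zeros. *)
Lemma base_thin a : level_thin k a (F a).
Proof.
move: a; apply: (wo_ind wf) => a IH.
have [la|nla] := pselect (is_limit a); last first.
  have [amin|[c ac]] := bottom_or_succ kcard Wsucc nla.
    move=> n I _ In; apply: (thin1 kcard (z := a)) => x [Ix _].
    by have [xa _] := In x Ix; apply/eqP; rewrite eq_le xa amin.
  have ca : c < a by rewrite ac (lt_succ kcard Wsucc).
  move=> n I cI In; apply: (thin_split (z := a)); last first.
    apply: (thin1 kcard (z := a)) => x [[/In[xa _] _] /= ax].
    by apply/eqP; rewrite eq_le xa.
  have xc x : x < a -> x <= c by rewrite ac (lt_succ_le kcard Wsucc).
  apply: thin_sub (IH c ca n _ (convex_lt (z := a) cI) _).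
    by move=> x [[Ix /= xn] xa]; split=> //=; move: xn; rewrite {1}ac (base_succ kcard Wsucc) xc.
  by move=> x [/In[_ +] xa]; rewrite {1}ac (base_succ kcard Wsucc) xc.
move=> n I cI In; have [[x0 [Ix0 x0n]]|nJ] := pselect (exists x, I x /\ F a x = n); last first.
  by apply: (thin1 kcard (z := a)) => x [Ix xn]; case: nJ; exists x.
have [n1|n0] := leP 1 n; last first.
  apply: thin_sub (base_thin_zero la) => x [Ix /= xn].
  have [xa _] := In x Ix; split=> //.
  move: xa; rewrite le_eqVlt => /orP[/eqP|xa]; [by right|left].
  apply: contrapT => nm.
  have [e [v [xe ea _ /(_ x xa)]]] := block la xa nm (fun e y _ => base_ge0 e y).
  case=> [z xz zx|z xz zx|_ Fv v1].
  - by have -> : z = x by apply/eqP; rewrite eq_le zx.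
  - by have -> : z = x by apply/eqP; rewrite eq_le zx.
  - by move: v1; rewrite -Fv xn leNgt n0.
have lt_a x : I x -> x < a.
  move=> Ix; have [xa xn] := In x Ix; rewrite lt_neqAle xa andbT; apply/eqP => e.
  by move: (le_trans n1 xn); rewrite e (base_top kcard Wsucc).
have nm x : I x -> ~ marked (C a) x.
  move=> Ix m; have [_ xn] := In x Ix; move: (le_trans n1 xn).
  by rewrite (marked0 kcard Wsucc X C_club) ?lt_a.
have [e [v [xe ea vc vE]]] := block la (lt_a _ Ix0) (nm _ Ix0) (fun e y _ => base_ge0 e y).
have IE x : I x -> [/\ x <= e, F a x = v x & 1 <= v x].
  move=> Ix; apply: vE; first exact: lt_a.
    by move=> z xz zx0; apply: nm; exact: (cI x z x0).
  by move=> z xz zx0; apply: nm; exact: (cI x0 z x).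
have [l [_ lE]] := compactness kcard Wsucc vc.
have lt := level_thin_st (l := l) (IH e ea); apply: thin_sub (lt n I cI _).
  move=> x [Ix /= xn]; split=> //=; have [xe' Fv _] := IE x Ix.
  by rewrite -xn Fv -lE // addrC subrK.
move=> x Ix; have [xe' Fv _] := IE x Ix; have [_] := In x Ix.
by rewrite -lE // addrC subrK Fv.
Qed.

End BaseProperties.

(** * Enumerations and bookkeeping *)

Section Enumerations.
Context {d : Order.disp_t} {W : orderType d} {k : W}.
Hypothesis kcard : is_infinite_cardinal k.
Hypothesis Wsucc : is_cardinal_successor k.
Local Open Scope ring_scope.
Local Open Scope order_scope.

Notation K := [set x | x < k].

Lemma all_in_map (T : eqType) (P : set W) (f : T -> W) (s : seq T) :
  (forall x, x \in s -> P (f x)) -> all_in P [seq f x | x <- s].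
Proof.
elim: s => //= x s IH Pf; split; first by apply: Pf; rewrite mem_head.
by apply: IH => y ys; apply: Pf; rewrite in_cons ys orbT.
Qed.

Lemma map_inj_in (T : eqType) (U : Type) (A : set T) (f : T -> U) (s t : seq T) :
  (forall x y, A x -> A y -> f x = f y -> x = y) ->
  (forall x, x \in s -> A x) -> (forall x, x \in t -> A x) ->
  [seq f x | x <- s] = [seq f x | x <- t] -> s = t.
Proof.
move=> finj; elim: s t => [|x s IH] [|y t] //= As At [fxy e].
have -> : x = y by apply: finj => //; [apply: As|apply: At]; rewrite mem_head.
by rewrite (IH t) // => z zs; [apply: As|apply: At]; rewrite in_cons zs orbT.
Qed.

Lemma lists_small (c : W) :
  [set l : seq (W * int) | forall p, p \in l -> p.1 <= c] #<= K.
Proof.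
have [e [eK einj]] := cardle_inj k (Iic_small kcard Wsucc c).
have [pk [pkK pkinj]] := pairing_K kcard Wsucc.
have [i [iK iinj]] := nat_K kcard.
have pkK' z : square K z -> K (pk z) by move=> /pkK.
pose f (p : W * int) := pk (e p.1, i (pickle p.2)).
have fK p : p.1 <= c -> K (f p).
  by move=> pc; apply: pkK; split; [apply: eK|exact: iK].
have finj p q : p.1 <= c -> q.1 <= c -> f p = f q -> p = q.
  move=> pc qc /pkinj; have sp (p' : W * int) : p'.1 <= c -> square K (e p'.1, i (pickle p'.2)).
    by move=> pc'; split; [apply: eK|exact: iK].
  move=> /(_ (sp _ pc) (sp _ qc))[] /einj => /(_ pc qc) e1 /iinj e2.
  by case: p q e1 e2 {pc qc} => [p1 p2] [q1 q2] /= -> /(pcan_inj pickleK) ->.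
apply: (inj_cardle (f := fun l => encs pk i [seq f p | p <- l])) => [l lc|l l' lc lc'].
  by apply: (encs_P pkK' iK); apply: all_in_map => p /lc /fK.
move=> /(encs_inj pkK' pkinj iK iinj) h.
apply: (@map_inj_in _ _ [set p | p.1 <= c] f) => //.
by apply: h; apply: all_in_map => p; [move=> /lc /fK|move=> /lc' /fK].
Qed.

Lemma exists_enum : exists en : W -> W -> seq (W * int),
  forall c (l : seq (W * int)), (forall p, p \in l -> p.1 <= c) ->
    exists2 i, i < k & en c i = l.
Proof.
have /choice[en enP] : forall c, exists en : W -> seq (W * int), forall l,
    (forall p, p \in l -> p.1 <= c) -> exists2 i, i < k & en i = l.
  move=> c; have [f [fK finj]] := cardle_inj k (lists_small c).
  have /choice[en enP] : forall i, exists l, (exists l', (forall p, p \in l' -> p.1 <= c) /\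
      f l' = i) -> (forall p, p \in l -> p.1 <= c) /\ f l = i.
    move=> i; have [[l h]|n] := pselect (exists l', (forall p, p \in l' -> p.1 <= c) /\
      f l' = i); first by exists l.
    by exists [::].
  exists en => l lc; exists (f l); first exact: fK.
  have [|lc' e] := enP (f l); first by exists l.
  exact: finj.
by exists en.
Qed.

(** Every pair is named at a stage not before its first coordinate: a padding coordinate [m] gives
    kappa many names to each pair, and these cannot all lie below [j < k]. *)
Lemma exists_unpair : exists unp : W -> W * W, forall j e, j < k -> e < k ->
  exists i, [/\ i < k, j <= i & unp i = (j, e)].
Proof.
have [pk [pkK pkinj]] := pairing_K kcard Wsucc.
pose q z := pk (pk z.1, z.2).
have qs z : square K z.1 -> z.2 < k -> square K (pk z.1, z.2).
  by move=> z1 z2; split=> //; exact: pkK.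
have qinj z w : square K z.1 -> z.2 < k -> square K w.1 -> w.2 < k -> q z = q w ->
    z.1 = w.1 /\ z.2 = w.2.
  move=> z1 z2 w1 w2 /pkinj; move=> /(_ (qs z z1 z2) (qs w w1 w2))[].
  by move=> /pkinj -/(_ z1 w1).
have /choice[unp unpP] : forall i, exists u, forall z, square K z.1 -> z.2 < k ->
    q z = i -> u = z.1.
  move=> i; have [[z [z1 z2 zi]]|n] :=
      pselect (exists z, [/\ square K z.1, z.2 < k & q z = i]); last first.
    by exists (k, k) => z z1 z2 zi; case: n; exists z.
  exists z.1 => w w1 w2 wi; rewrite -zi in wi.
  by have [] := qinj w z w1 w2 z1 z2 wi.
exists unp => j e jk ek; have je : square K (j, e) by [].
have [m [mk jm]] : exists m, m < k /\ j <= q ((j, e), m).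
  apply: contrapT => /forallNP n; apply: (K_initial kcard jk).
  apply: (inj_cardle (f := fun m => q ((j, e), m))) => [m mk /=|m m' mk mk'].
    by rewrite ltNge; apply/negP => h; apply: (n m).
  by move=> /(qinj ((j, e), m) ((j, e), m'))[].
exists (q ((j, e), m)); split=> //; first exact/pkK/qs.
exact: (unpP _ ((j, e), m)).
Qed.

(** Turns sets of nodes, each given by a level and a jump list, into subsets of kappa^+, which is
    what the diamond guesses. *)
Lemma exists_code : exists code : W * seq (W * int) -> W, injective code.
Proof.
have [p pinj] := pairing_W kcard Wsucc; have [i [_ iinj]] := nat_K kcard.
pose f (z : W * int) := p (z.1, i (pickle z.2)).
have finj : injective f.
  by move=> [a m] [b n] /pinj[/= -> /iinj/(pcan_inj pickleK) ->].
exists (fun z => p (z.1, encs p i [seq f x | x <- z.2])).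
move=> [a l] [b l'] /pinj[/= ->] h; congr (_, _).
have aT (s : seq W) : all_in setT s by elim: s.
have := encs_inj (P := setT) (fun z _ => I) (fun z w _ _ => @pinj z w) (fun n => I)
  iinj (aT _) (aT _) h.
exact: (inj_map finj).
Qed.

End Enumerations.

(** * Escape of the base map from the guessed set *)

Section Escape.
Context {d : Order.disp_t} {W : orderType d} {k : W}.
Hypothesis kcard : is_infinite_cardinal k.
Hypothesis Wsucc : is_cardinal_successor k.
Context (C X : W -> set W).
Hypothesis C_club : forall a, is_limit a ->
  club_in `]-oo, a[%classic (C a) /\ otp_le (C a) k.
Context (unp : W -> W * W) (en : W -> W -> seq (W * int)).
Context (code : W * seq (W * int) -> W).
Hypothesis unpP : forall j e, j < k -> e < k ->
  exists i, [/\ i < k, j <= i & unp i = (j, e)].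
Hypothesis enP : forall c (l : seq (W * int)), (forall p, p \in l -> p.1 <= c) ->
  exists2 i, i < k & en c i = l.
Implicit Types (a b c e x y z : W) (f g h s v : W -> int) (l : seq (W * int)).
Local Open Scope ring_scope.
Local Open Scope order_scope.

Let wf := succ_wf Wsucc.
Notation F := (base Wsucc C X unp en code).
Notation rank := (rank Wsucc).
Notation cand := (cand Wsucc unp en).

Lemma rank_iso (D : set W) (phi : W -> W) : set_bij D [set x | x < k] phi ->
  {in D &, {mono phi : x y / x < y}} -> forall c, D c -> rank D c = phi c.
Proof.
move=> [phiK _ phisurj] mono; apply: (wo_ind wf) => c IH Dc.
rewrite /rank rkE; apply: (least_eq wf) => [|v [_ vb]].
  by split=> // y Dy yc; rewrite -/(rank D y) IH // mono ?inE.
rewrite leNgt; apply/negP => vc.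
have [|y Dy yv] := phisurj v; first exact: lt_trans vc (phiK _ Dc).
have yc : y < c by rewrite -mono ?inE // yv.
by have := vb y Dy yc; rewrite -/(rank D y) IH // yv ltxx.
Qed.

Lemma seq_bounded l a : is_limit a -> (forall p, p \in l -> p.1 < a) ->
  exists2 b, b < a & forall p, p \in l -> p.1 <= b.
Proof.
move=> [[x0 x0a] _]; elim: l => [|p l IH] la; first by exists x0.
have [|b ba lb] := IH; first by move=> q ql; apply: la; rewrite in_cons ql orbT.
exists (Order.max b p.1); first by rewrite gt_max ba la // mem_head.
move=> q; rewrite in_cons => /orP[/eqP ->|/lb qb]; rewrite le_max ?lexx ?orbT //.
by rewrite qb.
Qed.

(** Take a club point [c0] beyond the jumps of [l]. The bookkeeping names the list at some stage not
    before the rank of [c0], and order type exactly kappa provides a club point of that rank. *)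
Lemma cand_hits a l : is_limit a -> otp_eq (C a) k ->
  (forall p, p \in l -> p.1 < a) ->
  exists c, [/\ C a c, forall p, p \in l -> p.1 <= c & cand (C a) c = l].
Proof.
move=> la [phi [bij mono]] lla; rewrite IioE in bij.
have rE := rank_iso bij mono; have [phiK phiinj phisurj] := bij.
have [b ba lb] := seq_bounded la lla.
have [c0 [Dc0 bc0 _]] := D_cofinal kcard Wsucc C_club la ba.
have lc0 p : p \in l -> p.1 <= c0 by move=> /lb pb; exact: le_trans pb (ltW bc0).
have [e ek enl] := enP lc0.
have [i [ik ji ui]] := unpP (phiK _ Dc0) ek.
have [c Dc ci] := phisurj i ik.
have c0c : c0 <= c.
  by rewrite leNgt; apply/negP; rewrite -mono ?inE // ci ltNge ji.
exists c; split=> // [p /lc0 pc|]; first exact: le_trans pc c0c.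
rewrite /cand rE // ci ui /=.
suff -> : xget c [set y | [/\ C a y, y <= c & rank (C a) y = phi c0]] = c0 by [].
apply: xget_unique => [|y [Dy _]]; first by split=> //; rewrite rE.
by rewrite rE // => /phiinj; apply; rewrite inE.
Qed.

(** At the point [c] whose candidate is [l] the construction took an escaping continuation if there
    was one, so any escaping [v] makes [F a] itself escape. *)
Lemma escape a l : is_limit a -> otp_eq (C a) k -> (forall p, p \in l -> p.1 < a) ->
  exists c e, [/\ C a c, C a e, c < e < a, forall p, p \in l -> p.1 <= c
    & F a (succ c) = 0 /\ ((exists v, escapes code F (X a) c e l (F a) v) ->
      exists xi l', [/\ xi < e, code (xi, l') < e, ~ X a (code (xi, l'))
        & forall x, x <= xi -> F a x + st l x = F xi x + st l' x])].
Proof.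
move=> la otp lla; have [c [Dc lc cl]] := cand_hits la otp lla.
have ca := D_lt C_club la Dc.
have sca : succ c < a by rewrite (succ_limit kcard Wsucc).
have [De xe ea emin] := next_lt kcard Wsucc C_club la sca.
set e := next_in _ _ in De xe ea emin.
have ce : c < e by rewrite -(succ_le kcard Wsucc).
exists c, e; split=> //; first by rewrite ce.
split; first by apply: (marked0 kcard Wsucc X C_club) => //; right; exists c.
move=> [v [vc v1 [xi [l' [cxi xie codee nX vE]]]]].
have bmax x c' : x <= e -> C a c' -> c' < x -> c' <= c.
  move=> xe' Dc' c'x; rewrite leNgt; apply/negP => cc'.
  have := emin c' Dc'; rewrite (succ_le kcard Wsucc) => /(_ cc').
  by rewrite leNgt (lt_le_trans c'x xe').
pose w := continuation code (upto (fun=> 0) e F) (X a `&` [set x | x < e]) c e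
  (cand (C a) c) (upto 0 c (F a)).
(* No marked point lies in the block after [succ c], so the base map there is the continuation
   chosen at [c]. *)
have Fw x : succ c < x -> x <= e -> F a x = w x.
  move=> cx xe'; have xa := le_lt_trans xe' ea.
  have cx' : c < x by apply: lt_trans cx; exact: (lt_succ kcard Wsucc).
  have nm : ~ marked (C a) x.
    case=> [[Dx [lx ub]]|[c' Dc' xc']].
      have [|y [yx Dy] cy] := ub (succ c); first by rewrite IioE.
      move: yx; rewrite IioE => yx; have := bmax x y xe' Dy yx.
      by rewrite leNgt -(succ_le kcard Wsucc) cy.
    have c'x : c' < x by rewrite xc'; exact: (lt_succ kcard Wsucc).
    have := bmax x c' xe' Dc' c'x.
    by rewrite leNgt -(succ_lt kcard Wsucc) -xc' cx.
  have nE : next_in (k := k) (C a) (below (C a) x) = e.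
    have [Dn xn na nmin] := next_lt kcard Wsucc C_club la xa.
    apply/eqP; rewrite eq_le nmin //= emin //.
    by apply: le_trans xn; exact: ltW.
  rewrite (base_limit kcard Wsucc X C_club) // /branch_step; case: pselect => //= _.
  case: pselect => [h|n]; last first.
    by case: n; exists c; split=> [//|c' [Dc' c'x]]; exact: bmax Dc' c'x.
  rewrite nE; case: (cid h) => c' /= [[Dc' c'x] c'max].
  by have -> : c' = c by apply/eqP; rewrite eq_le (bmax x) //= c'max.
(* Truncated and full data give the same escape condition, since only levels up to [e] and codes
   below [e] occur in it. *)
have : escapes code F (X a `&` [set x | x < e]) c e l (F a) w.
  have eqe G Xe s v' : escapes code G Xe c e (cand (C a) c) s v' <->
      escapes code G Xe c e l s v' by rewrite cl.
  have eqs v' : escapes code (upto (fun=> 0) e F) (X a `&` [set x | x < e]) c e l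
      (upto 0 c (F a)) v' <-> escapes code F (X a `&` [set x | x < e]) c e l (F a) v'.
    have mE x : splice (upto 0 c (F a)) c v' x = splice (F a) c v' x.
      by rewrite /splice /upto; case: (x <= c).
    split=> -[h1 h2 [y [l'' [h3 h4 h5 h6 h7]]]].
      split=> //; first by move: h1; rewrite upto_id.
      exists y, l''; split=> // x xy; have := h7 x xy.
      by rewrite mE upto_id // ltW.
    split=> //; first by rewrite upto_id.
    exists y, l''; split=> // x xy; rewrite mE h7 //.
    by rewrite upto_id // ltW.
  apply/eqs/eqe; rewrite /w /continuation; case: pselect => [h|n].
    by case: (cid h).
  case: n; exists v; apply/eqe/eqs; split=> //.
  by exists xi, l'; split=> // -[].
move=> [_ _ [y [l'' [cy ye codey nXy wE]]]]; exists y, l''; split=> //.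
  by move=> Xy; apply: nXy.
move=> x xy; rewrite -wE //; congr (_ + _); rewrite /splice.
have [//|cx] := leP x c; have [xc|cx'] := leP x (succ c); last first.
  by rewrite Fw // (le_trans xy) // ltW.
have -> : x = succ c by apply/eqP; rewrite eq_le xc (succ_le kcard Wsucc).
by apply: (marked0 kcard Wsucc X C_club) => //; right; exists c.
Qed.

End Escape.

(** * Summary of the properties of the base maps *)

Section GuessedBase.
Context {d : Order.disp_t} {W : orderType d}.
Local Open Scope ring_scope.
Local Open Scope order_scope.

(* [F a] is the base node of level a; every node of level a is a modification
   of it. *)
Record guessed_base (k : W) (F : W -> W -> int)
    (code : W * seq (W * int) -> W) : Prop := GuessedBase {
  gb_code : injective code;
  gb_ge0 : forall a x, 0 <= F a x;
  gb_coherent : forall a a' b, a' <= a -> is_limit b -> b <= a' ->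
    cont_at (fun x => F a' x - F a x) b;
  gb_liminf : forall a b, is_limit b -> b <= a -> liminf_at (F a) b;
  gb_thin : forall a, level_thin k a (F a);
  gb_escape : forall Y E : set W, club_in setT E ->
    exists2 a, E a & is_limit a /\ forall l, (forall p, p \in l -> p.1 < a) ->
      exists c e, [/\ E c, E e, c < e < a, forall p, p \in l -> p.1 <= c
        & F a (succ c) = 0 /\ ((exists v, escapes code F Y c e l (F a) v) ->
          exists xi l', [/\ xi < e, code (xi, l') < e, ~ Y (code (xi, l'))
            & forall x, x <= xi -> F a x + st l x = F xi x + st l' x])] }.

(** The diamond yields a level [a] with club inside [E] and with [X a] equal to [Y] below [a]. The
    codes in an escape lie below [e < a], so escaping [X a] and escaping [Y] amount to the same. *)
Lemma exists_guessed_base (k : W) : is_infinite_cardinal k ->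
  is_cardinal_successor k -> box_diamond k ->
  exists F code, guessed_base k F code.
Proof.
move=> kcard Wsucc [C [X [C_club Xlt CX_acc guess]]].
have [unp unpP] := exists_unpair kcard Wsucc.
have [en enP] := exists_enum kcard Wsucc.
have [code codeI] := exists_code kcard Wsucc.
exists (base Wsucc C X unp en code), code; split=> //.
- exact: (base_ge0 kcard Wsucc X C_club).
- exact: (base_coherent kcard Wsucc C_club CX_acc).
- exact: (base_liminf kcard Wsucc C_club CX_acc).
- by move=> a; exact: (base_thin kcard C_club).
move=> Y E /(guess Y)[a [la Ea] [CE otp YX]]; exists a => //; split=> // l lla.
have [c [e [Dc De cea lc [F0 esc]]]] := escape kcard Wsucc X C_club code unpP enP la otp lla.
exists c, e; split=> //; [exact: CE|exact: CE|split=> // -[v [v1 v2 [xi [l' [h1 h2 h3 h4 h5]]]]]].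
have ea : e < a by case/andP: cea.
have XY z : z < e -> X a z <-> Y z.
  move=> ze; rewrite -YX IioE; split=> [[]//|Yz]; split=> //=.
  exact: lt_trans ze ea.
have [|y [l'' [g1 g2 g3 g4]]] := esc.
  by exists v; split=> //; exists xi, l'; split=> // /XY -/(_ h3).
by exists y, l''; split=> // Yc; apply: g3; apply/XY.
Qed.

End GuessedBase.

(** * The coherent tree and its lexicographic order *)

Section Nodes.
Context {d : Order.disp_t} {W : orderType d} {k : W}.
Hypothesis kcard : is_infinite_cardinal k.
Hypothesis Wsucc : is_cardinal_successor k.
Context (F : W -> W -> int) (code : W * seq (W * int) -> W).
Hypothesis GB : guessed_base k F code.
Implicit Types (a b c e x y z : W) (s t : W -> int) (l : seq (W * int)).
Local Open Scope ring_scope.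
Local Open Scope order_scope.

Let wf := succ_wf Wsucc.

(** A function on all of [W] stands for its restriction to the points up to [a], a sequence of
    length a + 1. *)
Definition node a s := (forall x, x <= a -> 0 <= s x) /\
  forall b, is_limit b -> b <= a -> cont_at (fun x => s x - F a x) b.

Lemma node_repr a s : node a s -> exists l, (forall p, p \in l -> p.1 <= a) /\
  forall x, x <= a -> s x = F a x + st l x.
Proof.
move=> [_ /(compactness kcard Wsucc)[l [la lE]]]; exists l; split=> // x xa.
by rewrite -lE // addrC subrK.
Qed.

Lemma node_at a b s : b <= a -> (forall x, x <= b -> 0 <= s x) ->
  (forall c, is_limit c -> c <= b -> cont_at (fun x => s x - F a x) c) -> node b s.
Proof.
move=> ba s0 sc; split=> // c lc cb; apply: (cont_trans kcard Wsucc lc) (sc c lc cb) _.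
by apply: (cont_sym kcard Wsucc) => //; apply: (gb_coherent GB).
Qed.

Lemma node_st a b s l : b <= a -> (forall x, x <= b -> 0 <= s x) ->
  (forall x, x <= b -> s x = F a x + st l x) -> node b s.
Proof.
move=> ba s0 sE; apply: node_at ba s0 _ => c lc cb.
apply: (cont_eqW kcard Wsucc lc) (st_cont kcard Wsucc l lc) => x xc.
by rewrite sE ?(le_trans xc cb) // addrAC subrr add0r.
Qed.

Lemma node_restr a b s : b <= a -> node a s -> node b s.
Proof.
move=> ba [s0 sc]; apply: (node_at ba) => [x xb|c lc cb].
  exact: s0 (le_trans xb ba).
exact: sc (le_trans cb ba).
Qed.

Lemma node_eq a s t : (forall x, x <= a -> s x = t x) -> node a s -> node a t.
Proof.
move=> st_ [s0 sc]; split=> [x xa|b lb ba]; first by rewrite -st_ ?s0.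
apply: (cont_eqW kcard Wsucc lb) (sc b lb ba) => x xb.
by rewrite st_ ?(le_trans xb).
Qed.

Lemma node_base a : node a (F a).
Proof.
by apply: (@node_st a a (F a) [::]) => // x _; rewrite ?(gb_ge0 GB) // st_nil addr0.
Qed.

Lemma node_cont a b s t c : node a s -> node b t -> is_limit c -> c <= a -> c <= b ->
  cont_at (fun x => t x - s x) c.
Proof.
move=> na nb lc ca cb.
have [_ sc] := node_restr ca na; have [_ tc] := node_restr cb nb.
apply: (cont_trans kcard Wsucc lc) (tc c lc (lexx _)) _.
by apply: (cont_sym kcard Wsucc) => //; exact: sc.
Qed.

Lemma node_diff a b s t : node a s -> node b t -> a <= b ->
  exists l, (forall p, p \in l -> p.1 <= a) /\
    forall x, x <= a -> t x - s x = st l x.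
Proof.
move=> na nb ab.
have [|l [la lE]] := @compactness _ _ _ kcard Wsucc (fun x => t x - s x) a.
  by move=> c lc ca; apply: node_cont na nb _ _ _ => //; exact: le_trans ab.
by exists l.
Qed.

Lemma node_liminf a s b : node a s -> is_limit b -> b <= a -> liminf_at s b.
Proof.
move=> [_ sc] lb ba; apply: (liminf_cont lb (sc b lb ba)).
exact: (gb_liminf GB).
Qed.

Lemma node_thin a s : node a s -> level_thin k a s.
Proof.
move=> /node_repr[l [_ sE]]; apply: level_thin_eq sE _.
by apply: level_thin_st; exact: (gb_thin GB).
Qed.

(* The points of value n before z after which the values up to z are at least n:
   the part of C^s_n between its last point of smaller value and z. *)
Definition last_run s (n : int) z : set W :=
  [set x | [/\ x < z, s x = n & forall w, x <= w -> w < z -> n <= s w]].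

Definition rk0 : nat *l W := (0%N, k).
Definition ranks : set (nat *l W) := [set q : nat *l W | q.2 < k].
(** The order type of the run, as an element of kappa times omega. *)
Definition run_rank s n z : nat *l W :=
  rk wf rk0 ranks (last_run s n z) z.

Lemma wf_lex : well_founded (fun p q : nat *l W => p < q).
Proof. exact: (wf_prodlexi wf_nat wf). Qed.

(** Thinness of the node embeds the run into finitely many copies of kappa, so the collapse never
    falls back on its default. *)
Lemma run_rank_def a s n z : node a s -> z <= a ->
  (forall x, last_run s n z x -> rk_def wf rk0 ranks (last_run s n z) x) /\
  rk_def wf rk0 ranks (last_run s n z) z.
Proof.
move=> ns za.
pose I : set W := [set x | x < z /\ forall w, x <= w -> w < z -> n <= s w].
have cI : convex I.
  move=> x y w [xz xP] [wz wP] xy yw; split; first exact: le_lt_trans wz.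
  by move=> v yv; apply: xP; exact: le_trans yv.
have [|m [h [g [hP gP]]]] := @node_thin a s ns n I cI.
  move=> x [xz xP]; split; first exact: le_trans (ltW xz) za.
  exact: xP.
have sub x : last_run s n z x -> (I `&` [set x | s x = n]) x.
  by move=> [xz sx xP]; split.
pose hg x : nat *l W := (h x, g x).
have hgP x : last_run s n z x -> ranks (hg x) by move=> /sub/hP[].
have hg_mono x y : last_run s n z x -> last_run s n z y -> x < y -> hg x < hg y.
  move=> /sub Ix /sub Iy /(gP x y Ix Iy)[lt|[e lt]]; rewrite /hg ltxi_pair.
    by rewrite leEnat (ltnW lt) leqNgt lt.
  by rewrite e lexx lt.
have emb x : last_run s n z x ->
    rk_def wf rk0 ranks (last_run s n z) x /\
    rk wf rk0 ranks (last_run s n z) x <= hg x.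
  move=> rx; apply: (rk_embed wf wf_lex rk0 (h := hg)) => //.
    by move=> y ry _; exact: hgP.
  by move=> y w ry rw yw _; exact: hg_mono.
split=> [x /emb[]//|].
have [x0 x0k] := infinite_setN0 (K_inf kcard).
exists (m, x0); split=> // y ry _.
have [_ le] := emb y ry; apply: le_lt_trans le _; rewrite ltxi_pair.
by have [lt _] := hP y (sub y ry); rewrite leEnat (ltnW lt) leqNgt lt.
Qed.

Lemma run_rank_lt a s n z : node a s -> z <= a -> (run_rank s n z).2 < k.
Proof.
by move=> ns za; have [_ /(rk_defP wf_lex)[]] := run_rank_def n ns za.
Qed.

Definition point_code s z : nat * seq (nat *l W) :=
  (`|s z|%N, [seq run_rank s n%:Z z | n <- iota 0 `|s z|.+1]).

(** By induction on [n] up to [s y], the values of [t] from [y] to [z] exceed [n]: a value [n] at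
    such a [w] would prolong the run of [n] inherited from before [y], making its order type at [z]
    larger than at [y], against the equality of codes. The claim is the case of [n = s y] at the
    point [y]. *)
Lemma point_code_lt a b s t y z : node a s -> node b t -> y <= a -> z <= b -> y < z ->
  (forall x, x < y -> s x = t x) -> point_code s y = point_code t z -> s y < t y.
Proof.
move=> ns nt ya zb yz ag pE;
have mE : `|s y|%N = `|t z|%N := congr1 fst pE.
have rE : [seq run_rank s n%:Z y | n <- iota 0 `|s y|.+1] =
    [seq run_rank t n%:Z z | n <- iota 0 `|s y|.+1].
  by rewrite {2}mE; exact: (congr1 snd pE).
have sy0 : 0 <= s y by case: ns => s0 _; apply: s0.
have t0 x : x < z -> 0 <= t x.
  by move=> xz; case: nt => t0 _; apply: t0; exact: le_trans (ltW xz) zb.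
have {}rE n : (n <= `|s y|)%N -> run_rank s n%:Z y = run_rank t n%:Z z.
  by move=> ny; move/eq_in_map: rE; apply; rewrite mem_iota add0n ltnS.
suff : forall n, (n <= `|s y|)%N -> forall w, y <= w -> w < z -> n%:Z < t w.
  by move=> /(_ _ (leqnn _) y (lexx y) yz); rewrite gez0_abs.
elim/ltn_ind => n IH ny w yw wz.
have ge v : y <= v -> v < z -> n%:Z <= t v.
  move=> yv vz; case: n IH ny => [_ _|n IH nn]; first exact: t0.
  by have := IH n (ltnSn n) (ltnW nn) v yv vz; lia.
rewrite lt_neqAle ge // andbT; apply/eqP => ew.
have wr : last_run t n%:Z z w.
  by split=> // v wv vz; apply: ge => //; exact: le_trans wv.
have [rdef rdefz] := run_rank_def n%:Z nt zb.
have [_ zlt _] := rk_defP wf_lex rdefz.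
have [Pw wlt _] := rk_defP wf_lex (rdef w wr).
have := zlt w wr wz; rewrite -/(run_rank t n%:Z z) -rE //.
suff -> : run_rank s n%:Z y = rk wf rk0 ranks (last_run t n%:Z z) y.
  have [_ _] : [/\ ranks (rk wf rk0 ranks (last_run t n%:Z z) y),
    _ & _] := rk_defP wf_lex (ex_intro _ _ (conj Pw (fun v rv vy => wlt v rv (lt_le_trans vy yw)))).
  move=> /(_ _ Pw) le /lt_le_trans-/(_ _ (le _)); rewrite ltxx => h.
  by have := h (fun v rv vy => wlt v rv (lt_le_trans vy yw)).
apply: eq_rk => v vy; split=> -[vz sv vP].
  split; [exact: lt_trans vy yz|by rewrite -ag|move=> u vu uz].
  by have [uy|yu] := ltP u y; [rewrite -ag // vP|exact: ge].
split=> //; first by rewrite ag.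
by move=> u vu uy; rewrite ag // vP // (lt_trans uy yz).
Qed.

(** Values are shifted by one so that 0 marks the end; lexicographically a node then precedes its
    proper extensions. *)
Definition hat a s : W -> nat := fun x => if x <= a then `|s x|.+1 else 0%N.

Definition lexlt (f g : W -> nat) :=
  exists z, (forall x, x < z -> f x = g x) /\ (f z < g z)%N.

Lemma hat_le a s b t x : node a s -> node b t -> x <= a -> x <= b ->
  (hat a s x <= hat b t x)%N = (s x <= t x).
Proof.
move=> [s0 _] [t0 _] xa xb; rewrite /hat xa xb ltnS.
by rewrite -lez_nat !gez0_abs ?s0 ?t0.
Qed.

Lemma hat_inj a s b t x : node a s -> node b t -> x <= a ->
  hat a s x = hat b t x -> x <= b /\ s x = t x.
Proof.
move=> ns nt xa e; have xb : x <= b by move: e; rewrite /hat xa; case: ifP.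
by split=> //; apply/eqP; rewrite eq_le -(hat_le ns nt) // -(hat_le nt ns) // e leqnn.
Qed.

Definition pair_code s t l :=
  [seq (point_code s p.1, point_code t p.1, t p.1 - s p.1) | p <- l].

(** If [a < a'], then [point_code_lt] at the two tops gives [s a < s' a], although the values agree
    there. *)
Lemma hat_top a s a' s' z : node a s -> node a' s' -> a < z ->
  (forall x, x < z -> hat a s x = hat a' s' x) ->
  point_code s a = point_code s' a' -> hat a s = hat a' s'.
Proof.
move=> ns ns' az ag ce; have [aa' sa] := hat_inj ns ns' (lexx a) (ag a az).
have sE x : x <= a -> s x = s' x.
  by move=> xa; have [] := hat_inj ns ns' xa (ag x (le_lt_trans xa az)).
have e : a = a'.
  move: aa'; rewrite le_eqVlt => /orP[/eqP//|lt].
  have := point_code_lt ns ns' (lexx a) (lexx a') lt (fun x xa => sE x (ltW xa)) ce.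
  by rewrite sa ltxx.
rewrite -e; apply/funext => x; have [xz|zx] := ltP x z; first by rewrite ag // e.
by rewrite /hat leNgt (lt_le_trans az zx).
Qed.

Lemma lexlt_irr f : ~ lexlt f f.
Proof. by move=> [z [_]]; rewrite ltnn. Qed.

(** Let [z] be the first disagreement of the two pairs. By the opposite inequalities the differences
    [t - s] and [t' - s'] are unequal at [z], so one of them jumps there. Equal codes match this
    jump with one of the other pair at some [p]. If [p = z] the differences agree; otherwise
    [point_code_lt] contradicts an inequality at [z] or the agreement below [z]. *)
Lemma pair_code_chain a s b t l a' s' b' t' l' :
  node a s -> node b t -> a <= b -> (forall p, p \in l -> p.1 <= a) ->
  (forall x, x <= a -> t x - s x = st l x) ->
  node a' s' -> node b' t' -> a' <= b' -> (forall p, p \in l' -> p.1 <= a') ->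
  (forall x, x <= a' -> t' x - s' x = st l' x) ->
  point_code s a = point_code s' a' -> pair_code s t l = pair_code s' t' l' ->
  lexlt (hat a s) (hat a' s') -> lexlt (hat b' t') (hat b t) -> False.
Proof.
move=> ns nt ab la lE ns' nt' ab' la' lE' topE pE ss' tt'.
have [z [ags agt les let_ lt]] : exists z, [/\ forall x, x < z -> hat a s x = hat a' s' x,
    forall x, x < z -> hat b t x = hat b' t' x,
    (hat a s z <= hat a' s' z)%N, (hat b' t' z <= hat b t z)%N
    & ((hat a s z < hat a' s' z) || (hat b' t' z < hat b t z))%N].
  case: ss' => z1 [ag1 lt1]; case: tt' => z2 [ag2 lt2].
  have [z12|z21|z12] := ltgtP z1 z2.
  - exists z1; split=> [|x xz||| ]; rewrite ?lt1 ?(ltnW lt1) ?ag2 //.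
    exact: lt_trans xz z12.
  - exists z2; split=> [x xz|x xz|||]; rewrite ?lt2 ?(ltnW lt2) ?orbT ?ag2 ?ag1 //.
    exact: lt_trans xz z21.
  - rewrite -z12 in ag2 lt2; exists z1; split; rewrite ?lt1 ?(ltnW lt1) ?(ltnW lt2) //.
    by move=> x xz; rewrite ag2.
have [az|za] := ltP a z.
  by apply: (@lexlt_irr (hat a s)); rewrite {2}(hat_top ns ns' az ags topE).
have [az'|za'] := ltP a' z.
  apply: (@lexlt_irr (hat a s)); rewrite -{2}(@hat_top a' s' a s z) //.
  by move=> x xz; rewrite ags.
have zb := le_trans za ab; have zb' := le_trans za' ab'.
have sE x : x < z -> s x = s' x.
  by move=> xz; have [] := hat_inj ns ns' (ltW (lt_le_trans xz za)) (ags x xz).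
have tE x : x < z -> t x = t' x.
  by move=> xz; have [] := hat_inj nt nt' (ltW (lt_le_trans xz zb)) (agt x xz).
rewrite (hat_le ns ns') // in les; rewrite (hat_le nt' nt) // in let_.
have ne : t z - s z <> t' z - s' z.
  move: lt; rewrite !ltnNge (hat_le ns' ns) // (hat_le nt nt') // -!ltNge.
  by move: les let_; lia.
have pm p : p \in [seq q.1 | q <- l] -> exists p', [/\ p' <= a',
    point_code s p = point_code s' p', point_code t p = point_code t' p'
    & t p - s p = t' p' - s' p'].
  move=> /mapP[q ql ->].
  have : (point_code s q.1, point_code t q.1, t q.1 - s q.1) \in pair_code s t l.
    by apply/mapP; exists q.
  by rewrite pE => /mapP[q' /la' q'a e]; exists q'.1; split=> //;
    [exact: (congr1 (fun u => u.1.1) e)|exact: (congr1 (fun u => u.1.2) e)|exact: (congr1 snd e)].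
have pm' p : p \in [seq q.1 | q <- l'] -> exists p', [/\ p' <= a,
    point_code s' p = point_code s p', point_code t' p = point_code t p'
    & t' p - s' p = t p' - s p'].
  move=> /mapP[q ql ->].
  have : (point_code s' q.1, point_code t' q.1, t' q.1 - s' q.1) \in pair_code s' t' l'.
    by apply/mapP; exists q.
  by rewrite -pE => /mapP[q' /la q'a e]; exists q'.1; split=> //;
    [exact: (congr1 (fun u => u.1.1) e)|exact: (congr1 (fun u => u.1.2) e)|exact: (congr1 snd e)].
have [|||] := @st_agree _ _ l l' z.
- move=> x xz; rewrite -lE ?(ltW (lt_le_trans xz za)) //.
  by rewrite -lE' ?(ltW (lt_le_trans xz za')) // sE ?tE.
- by rewrite -lE // -lE'.
- move=> /pm[p [pa' cs ct fE]]; have [zp|pz|zp] := ltgtP z p.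
  + have := point_code_lt nt nt' zb (le_trans pa' ab') zp tE ct.
    by rewrite ltNge let_.
  + have := point_code_lt ns' ns pa' za pz (fun x xp => esym (sE x (lt_trans xp pz))) (esym cs).
    by rewrite sE // ltxx.
  + by apply: ne; rewrite fE zp.
- move=> /pm'[p [pa cs ct fE]]; have [zp|pz|zp] := ltgtP z p.
  + have := point_code_lt ns' ns za' pa zp (fun x xz => esym (sE x xz)) cs.
    by rewrite ltNge les.
  + have := point_code_lt ns ns' pa za' pz (fun x xp => sE x (lt_trans xp pz)) (esym cs).
    by rewrite sE // ltxx.
  + by apply: ne; rewrite fE zp.
Qed.

End Nodes.

(** * The lexicographic order on a set of sequences *)

Section LexOrder.
Context {d : Order.disp_t} {W : orderType d}.

(** Well-foundedness is a parameter of the type so that the order structure, whose totality rests on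
    first differences, can be attached to it. *)
Definition lexord of well_founded (fun x y : W => x < y) := fun P : set (W -> nat) =>
  {f : W -> nat | P f}.

Variables (wf : well_founded (fun x y : W => x < y)) (P : set (W -> nat)).
Notation L := (lexord wf P).

HB.instance Definition _ := gen_eqMixin L.
HB.instance Definition _ := gen_choiceMixin L.

Lemma lexlt_trans (f g h : W -> nat) : lexlt f g -> lexlt g h -> lexlt f h.
Proof.
move=> [y [fg lt]] [z [gh lt']]; have [yz|zy|e] := ltgtP y z.
- exists y; split=> [x xy|]; last by rewrite -gh.
  by rewrite fg // gh // (lt_trans xy).
- exists z; split=> [x xz|]; last by rewrite fg.
  by rewrite fg ?gh // (lt_trans xz).
- rewrite -e in gh lt'; exists y; split=> [x xy|]; first by rewrite fg ?gh.
  exact: leq_trans lt (ltnW lt').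
Qed.

Lemma lexlt_total (f g : W -> nat) : [\/ f = g, lexlt f g | lexlt g f].
Proof.
have [e|n] := pselect (forall x, f x = g x); first by constructor 1; apply/funext.
have [x [xn xmin]] : exists x, f x <> g x /\ forall y, f y <> g y -> x <= y.
  by move: n => /existsNP[x0 x0n]; apply: (wo_min wf (A := [set x | f x <> g x])); exists x0.
have ag y : y < x -> f y = g y.
  by move=> yx; apply: contrapT => /xmin; rewrite leNgt yx.
case: (ltngtP (f x) (g x)) => [lt|lt|//].
  by constructor 2; exists x.
by constructor 3; exists x; split=> // y /ag.
Qed.

Definition lexle (f g : L) : bool := `[< sval f = sval g \/ lexlt (sval f) (sval g) >].

Lemma lexle_refl : reflexive lexle.
Proof. by move=> f; apply/asboolP; left. Qed.

Lemma lexord_inj (f g : L) : sval f = sval g -> f = g.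
Proof. by case: f g => [f Pf] [g Pg] /= e; rewrite e in Pf *; congr exist; exact: Prop_irrelevance. Qed.

Lemma lexle_anti : antisymmetric lexle.
Proof.
move=> f g /andP[/asboolP[/lexord_inj//|fg] /asboolP[/lexord_inj//|gf]].
by have := lexlt_irr (lexlt_trans fg gf).
Qed.

Lemma lexle_trans : transitive lexle.
Proof.
move=> g f h /asboolP[fg|fg] /asboolP[gh|gh]; apply/asboolP.
- by left; rewrite fg.
- by right; rewrite fg.
- by right; rewrite -gh.
- by right; exact: lexlt_trans gh.
Qed.

Lemma lexle_total : total lexle.
Proof.
move=> f g; case: (lexlt_total (sval f) (sval g)) => [e|lt|lt]; apply/orP.
- by left; apply/asboolP; left.
- by left; apply/asboolP; right.
- by right; apply/asboolP; right.
Qed.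

HB.instance Definition _ :=
  Order.Le_isPOrder.Build d L lexle_refl lexle_anti lexle_trans.
HB.instance Definition _ := Order.POrder_isTotal.Build d L lexle_total.

Lemma lexord_ltP (f g : L) : f < g <-> lexlt (sval f) (sval g).
Proof.
rewrite lt_neqAle; split=> [/andP[fg /asboolP[/lexord_inj e|//]]|lt].
  by rewrite e eqxx in fg.
apply/andP; split; last by apply/asboolP; right.
by apply/eqP => e; move: lt; rewrite e => /lexlt_irr.
Qed.

End LexOrder.

(** * The tree of nodes and the Countryman property *)

Section NodeSets.
Context {d : Order.disp_t} {W : orderType d} {k : W}.
Hypothesis kcard : is_infinite_cardinal k.
Hypothesis Wsucc : is_cardinal_successor k.
Context (F : W -> W -> int) (code : W * seq (W * int) -> W).
Hypothesis GB : guessed_base k F code.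
Implicit Types (a b c e x y z : W) (s : W -> int) (l : seq (W * int)).
Local Open Scope ring_scope.
Local Open Scope order_scope.

Let wf := succ_wf Wsucc.

Definition hats : set (W -> nat) := [set f | exists a s, node F a s /\ f = hat a s].

(** The collapse maps [A] onto an initial segment of kappa times omega; the least strict bound of
    the ranks is the required [p], and the given embedding shows that a bound exists. *)
Lemma thin_otp (A : set W) : thin k A -> otp_lt_mul_omega A k.
Proof.
move=> [m [h [g [hP gP]]]]; have wfl := wf_lex Wsucc.
pose hg x : nat *l W := (h x, g x).
have hg_mono x y : A x -> A y -> x < y -> hg x < hg y.
  move=> Ax Ay /(gP x y Ax Ay)[lt|[e lt]]; rewrite /hg ltxi_pair.
    by rewrite leEnat (ltnW lt) leqNgt lt.
  by rewrite e lexx lt.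
pose r := rk wf (rk0 (k := k)) (ranks (k := k)) A.
have emb x : A x -> rk_def wf (rk0 (k := k)) (ranks (k := k)) A x /\ r x <= hg x.
  move=> Ax; apply: (rk_embed wf wfl (rk0 (k := k)) (h := hg)) => //.
    by move=> y Ay _; case: (hP y Ay).
  by move=> y w Ay Aw yw _; exact: hg_mono.
have [x0 x0k] := infinite_setN0 (K_inf kcard).
have ex : [set q : nat *l W | ranks (k := k) q /\ forall x, A x -> r x < q] !=set0.
  exists (m, x0); split=> // y Ay.
  have [_ le] := emb y Ay; apply: le_lt_trans le _; rewrite ltxi_pair.
  by have [lt _] := hP y Ay; rewrite leEnat (ltnW lt) leqNgt lt.
have [[Pp pub] pmin] := leastP wfl (rk0 (k := k)) ex; set p := least _ _ in Pp pub pmin.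
exists p => //; exists r; split; last first.
  have lt x y : A x -> A y -> x < y -> r x < r y.
    by move=> Ax Ay xy; have [_ + _] := rk_defP wfl (emb y Ay).1; apply.
  move=> x y /set_mem Ax /set_mem Ay; apply/idP/idP => [|xy]; last exact: lt.
  apply: contraTT; rewrite -!leNgt le_eqVlt => /orP[/eqP ->//|yx].
  by apply/ltW/lt.
split=> [x Ax /=|x y /set_mem Ax /set_mem Ay e|v [/= vk vp]].
- by have [Pr _ _] := rk_defP wfl (emb x Ax).1; split=> //; exact: pub.
- have [xy|yx|//] := ltgtP x y.
    have [_ /(_ x Ax xy)] := rk_defP wfl (emb y Ay).1.
    by rewrite -/(r x) -/(r y) e ltxx.
  have [_ /(_ y Ay yx)] := rk_defP wfl (emb x Ax).1.
  by rewrite -/(r x) -/(r y) e ltxx.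
have [x [Ax vx]] : exists x, A x /\ v <= r x.
  apply: contrapT => /forallNP n; suff : p <= v by rewrite leNgt vp.
  apply: pmin; split=> // x Ax; rewrite ltNge; apply/negP => vx.
  by apply: (n x).
move: vx; rewrite le_eqVlt => /orP[/eqP ->|vx]; first by exists x.
have [||y [Ay _ <-]] := rk_onto wfl (P := ranks (k := k)) (A := A) (x := x) (v := v)
    (wfU := wf) (v0 := rk0 (k := k)) vk; last by exists y.
  move=> vb; have [_ _ /(_ v vk vb)] := rk_defP wfl (emb x Ax).1.
  by rewrite leNgt vx.
by move=> y Ay _; case: (emb y Ay).
Qed.

Definition to_seq (f : W -> nat) : W -> option nat :=
  fun x => if f x is n.+1 then Some n else None.

Definition nodes : set (W -> option nat) := to_seq @` hats.

Lemma to_seq_hat a s x :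
  to_seq (hat a s) x = if x <= a then Some `|s x|%N else None.
Proof. by rewrite /to_seq /hat; case: ifP. Qed.

Lemma dom_hat a s : dom (to_seq (hat a s)) = `]-oo, a]%classic.
Proof.
rewrite IicE; apply/seteqP; split=> x; rewrite /dom /= to_seq_hat; case: ifP => //.
Qed.

Lemma dom_le a s b t : dom (to_seq (hat a s)) `<=` dom (to_seq (hat b t)) -> a <= b.
Proof. by rewrite !dom_hat !IicE => /(_ a (lexx a)). Qed.

Lemma level_hat a s n x : node F a s ->
  level (to_seq (hat a s)) n x <-> x <= a /\ s x <= n.
Proof.
move=> [s0 _]; rewrite /level /=; split=> [[m]|[xa sn]]; rewrite to_seq_hat.
  by case: ifP => // xa [<-]; rewrite gez0_abs ?s0.
by exists `|s x|%N; rewrite ?xa ?gez0_abs ?s0.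
Qed.

Lemma itv_convex (i : interval W) : convex [set` i].
Proof.
case: i => l u x y z /=; rewrite !itv_boundlr => /andP[lx _] /andP[_ zu] xy yz.
by apply/andP; split; [apply: le_trans lx _|apply: le_trans zu]; rewrite lteBSide.
Qed.

Lemma nodes_Sk : nodes `<=` Sk k.
Proof.
move=> _ [_ [a [s [ns ->]]] <-]; have levP n x := level_hat n x ns.
have linf b : is_limit b -> b <= a -> liminf_at s b.
  by move=> lb ba; exact: (node_liminf GB ns lb ba).
exists a; first exact: dom_hat.
split=> [n _ b|b m lb|n I [[i _ IE] I0 _]].
- rewrite IicE /= => ba [lb ub]; apply/levP; split=> //.
  have [_ [e eb eP]] := linf b lb ba.
  have [|y [+ /levP[_ yn]] ey] := ub (succ e).
    by rewrite IioE /= (succ_limit kcard Wsucc).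
  rewrite IioE /= => yb; apply: le_trans yn; apply: eP => //.
  by rewrite -(succ_le kcard Wsucc).
- rewrite to_seq_hat; case: ifP => // ba [<-].
  have sb : `|s b|%N%:Z = s b by rewrite gez0_abs //; case: ns => s0 _; exact: s0.
  rewrite sb; have [lo [e eb eP]] := linf b lb ba; split=> [x|n n1 ub].
    rewrite IioE /= => /lo[y [xy yb sy]]; exists y; last exact: ltW.
    by split=> //; apply/levP; split=> //; exact: le_trans (ltW yb) ba.
  have [|y [+ /levP[_ yn]] ey] := ub (succ e).
    by rewrite IioE /= (succ_limit kcard Wsucc).
  rewrite IioE /= => yb; apply: le_trans yn; apply: eP => //.
  by rewrite -(succ_le kcard Wsucc).
- have Ia x : I x -> x <= a by rewrite IE => -[]; rewrite IicE.
  have cI : convex I.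
    rewrite IE => x y z [_ xi] [za zi] xy yz; split; last exact: (itv_convex xi zi).
    by move: za; rewrite IicE /=; exact: le_trans.
  have In x : I x -> n%:Z <= s x.
    move=> Ix; rewrite leNgt; apply/negP => sn.
    move: I0 => /seteqP[/(_ x) I0 _]; apply: I0; split=> //; apply/levP; split; first exact: Ia.
    by move: sn; lia.
  apply: thin_otp; apply: thin_sub (node_thin kcard Wsucc GB ns (n := n%:Z) cI _).
    move=> x [/levP[xa sn] Ix]; split=> //=.
    by apply/eqP; rewrite eq_le sn In.
  by move=> x Ix; split; [exact: Ia|exact: In].
Qed.

Lemma in_le x b : (x \in [set y | y <= b]) = (x <= b).
Proof. by apply/idP/idP => [/set_mem|/mem_set]. Qed.

Lemma nodes_coherent : rho2_coherent nodes.
Proof.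
move=> _ _ [_ [a [s [ns ->]]] <-] [_ [b [t [nt ->]]] <-] ab'.
have ab := dom_le ab'; have dE : dom (restr (to_seq (hat b t)) (dom (to_seq (hat a s)))) =
    `]-oo, a]%classic.
  rewrite dom_hat IicE; apply/seteqP; split=> x; rewrite /dom /restr /= in_le.
    by case: ifP.
  by move=> xa; rewrite ifT // to_seq_hat (le_trans xa ab).
have rE x : x <= a -> seq_diff (restr (to_seq (hat b t)) (dom (to_seq (hat a s))))
    (to_seq (hat a s)) x = Some (t x - s x).
  move=> xa; rewrite /seq_diff /restr dom_hat IicE in_le ifT // !to_seq_hat.
  rewrite xa (le_trans xa ab).
  by case: ns nt => s0 _ [t0 _]; rewrite !gez0_abs ?s0 ?t0 // (le_trans xa ab).
split; first by rewrite dE dom_hat.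
have ddE : dom (seq_diff (restr (to_seq (hat b t)) (dom (to_seq (hat a s))))
    (to_seq (hat a s))) = `]-oo, a]%classic.
  rewrite IicE; apply/seteqP; split=> x; last by move=> /= xa; rewrite /dom /= rE.
  rewrite /dom /= /seq_diff to_seq_hat; case: (restr _ _ x) => //= n.
  by case: ifP.
split; first by exists a.
move=> c; rewrite ddE IicE /= => ca lc.
have [e ec eP] := node_cont kcard Wsucc GB ns nt lc ca (le_trans ca ab).
exists e => // x /andP[ex xc]; rewrite !rE ?eP //.
exact: le_trans xc ca.
Qed.

Lemma hats_card : hats #= [set: W].
Proof.
rewrite card_eq_le; apply/andP; split.
  have /choice[c cP] : forall f, exists w, hats f -> exists a l, w = code (a, l) /\
      f = hat a (fun x => F a x + st l x).
    move=> f; have [[a [s [ns ->]]]|n] := pselect (hats f); last by exists k.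
    have [l [la lE]] := node_repr kcard Wsucc ns; exists (code (a, l)) => _.
    exists a, l; split=> //; apply/funext => x; rewrite /hat; case: ifP => // xa.
    by rewrite lE.
  apply: (inj_cardle (f := c)) => // f g /cP[a [l [-> ->]]] /cP[b [l' [-> ->]]].
  by move=> /(gb_code GB)[-> ->].
apply: (inj_cardle (f := fun a => hat a (F a))) => [a _|a b _ _ e].
  by exists a, (F a); split=> //; exact: (node_base kcard Wsucc GB).
have le a' b' : hat a' (F a') = hat b' (F b') -> a' <= b'.
  by move=> /(congr1 (@^~ a')); rewrite /hat lexx; case: ifP.
by apply/eqP; rewrite eq_le !le.
Qed.

Lemma nodes_full : rho2_full nodes.
Proof.
split=> [_ [_ [a [s [ns ->]]] <-]||_ b [_ [a [s [ns ->]]] <-]|_ t [_ [a [s [ns ->]]] <-]].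
- exists (succ a); rewrite dom_hat IicE IioE; apply/seteqP.
  by split=> x /=; rewrite (lt_succ_le kcard Wsucc).
- apply: card_eq_trans hats_card; apply: inj_card_eq => f g _ _ e.
  apply/funext => x; move/(congr1 (@^~ x)): e; rewrite /to_seq.
  by case: (f x) (g x) => [|m] [|n] // [->].
- rewrite dom_hat IicE /= => ba; exists (hat b s).
    by exists b, s; split=> //; exact: (node_restr kcard Wsucc GB ba).
  apply/funext => x; rewrite /restr to_seq_hat IicE in_le.
  by case: ifP => // xb; rewrite to_seq_hat (le_trans xb ba).
- move=> [dE [_ dc]]; pose t' x : int := if t x is Some m then m%:Z else 0.
  have tE x : t x = if x <= a then Some `|t' x|%N else None.
    have : dom t x <-> x <= a by rewrite dE dom_hat IicE.
    rewrite /dom /= /t'; case: (t x) => [m|] /= h; first by rewrite ifT //; apply/h.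
    by case: ifP => // /h.
  exists (hat a t'); last by apply/funext => x; rewrite to_seq_hat tE.
  exists a, t'; split=> //.
  apply: (node_at kcard Wsucc GB (lexx a)) => [x _|c lc ca].
    by rewrite /t'; case: (t x).
  apply: (cont_trans kcard Wsucc lc (g := s)); last by case: ns => _; apply.
  have dfE x : x <= a -> seq_diff t (to_seq (hat a s)) x = Some (t' x - s x).
    move=> xa; rewrite /seq_diff tE to_seq_hat xa.
    rewrite !gez0_abs //; first by case: ns => s0 _; exact: s0.
    by rewrite /t'; case: (t x).
  have [||e ec eP] := dc c => //; first by rewrite /dom /= dfE.
  exists e => // x ex xc; have := eP x; rewrite ex xc => /(_ isT).
  by rewrite !dfE ?(le_trans xc ca) // => -[].
Qed.

Lemma lexord_card : [set: lexord wf hats] #= [set: W].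
Proof.
apply: card_eq_trans hats_card; rewrite card_eq_le; apply/andP; split.
  apply: (inj_cardle (f := sval)) => [[f //]|f g _ _]; exact: lexord_inj.
have /choice[g gP] : forall f, exists g : lexord wf hats, hats f -> sval g = f.
  move=> f; have [hf|n] := pselect (hats f); first by exists (exist _ f hf).
  have h0 : hats (hat k (F k)).
    by exists k, (F k); split=> //; exact: (node_base kcard Wsucc GB).
  by exists (exist _ _ h0).
by apply: (inj_cardle (f := g)) => // f f' /gP e /gP e' ff; rewrite -e ff.
Qed.

(** Pairs are classified by which component is the shorter, its code at the top, and the codes at
    the jumps of the difference. There are at most kappa many classes, each a chain by
    [pair_code_chain]. *)
Lemma lexord_countryman : countryman (lexord wf hats) k.
Proof.
split; first exact: lexord_card.
have [pk [pkK pkinj]] := pairing_K kcard Wsucc.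
have [i [iK iinj]] := nat_K kcard.
have pkK' (z : W * W) : square [set x | x < k] z -> [set x | x < k] (pk z) by move=> /pkK.
pose E := encs pk i.
pose K := [set x | x < k].
have EK u : all_in K u -> K (E u) by move=> h; exact: (encs_P pkK' iK).
have EI u v : all_in K u -> all_in K v -> E u = E v -> u = v.
  exact: (encs_inj pkK' pkinj iK iinj).
pose R : set (nat *l W) := ranks (k := k).
pose code0 (q : nat *l W) : W := pk (i q.1, q.2).
have K0 q : R q -> K (code0 q) by move=> Rq; apply: pkK'; split=> //=; exact: iK.
have I0 q q' : R q -> R q' -> code0 q = code0 q' -> q = q'.
  move=> Rq Rq' /pkinj h; have [] : (i q.1, q.2) = (i q'.1, q'.2).
    by apply: h; split=> //=; exact: iK.
  by case: q q' {Rq Rq' h} => [m x] [m' x'] /= /iinj -> ->.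
pose valid (p : nat * seq (nat *l W)) := forall q, q \in p.2 -> R q.
pose code1 (p : nat * seq (nat *l W)) : W := E (i p.1 :: [seq code0 q | q <- p.2]).
have A1 p : valid p -> all_in K (i p.1 :: [seq code0 q | q <- p.2]).
  move=> vp; split; first exact: iK.
  by apply: (all_in_map (P := K)) => q /vp/K0.
have I1 p p' : valid p -> valid p' -> code1 p = code1 p' -> p = p'.
  move=> vp vp' /(EI _ _ (A1 _ vp) (A1 _ vp'))[/iinj e1 e2].
  have e2' := map_inj_in I0 vp vp' e2.
  by case: p p' e1 e2' {vp vp' e2} => [m u] [m' u'] /= -> ->.
have K1 p : valid p -> K (code1 p) by move=> /A1/EK.
have valid_point a s z : node F a s -> z <= a -> valid (point_code Wsucc s z).
  by move=> ns za q /mapP[n _ ->]; exact: (run_rank_lt kcard Wsucc GB n%:Z ns za).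
pose valid2 (u : (nat * seq (nat *l W)) * (nat * seq (nat *l W)) * int) :=
  valid u.1.1 /\ valid u.1.2.
pose code2 (u : (nat * seq (nat *l W)) * (nat * seq (nat *l W)) * int) : W :=
  E [:: code1 u.1.1; code1 u.1.2; i (pickle u.2)].
have A2 u : valid2 u -> all_in K [:: code1 u.1.1; code1 u.1.2; i (pickle u.2)].
  by move=> [v1 v2]; do !split; [exact: K1|exact: K1|exact: iK].
have I2 u u' : valid2 u -> valid2 u' -> code2 u = code2 u' -> u = u'.
  move=> vu vu' /(EI _ _ (A2 _ vu) (A2 _ vu'))[].
  case: vu vu' => [v1 v2] [v1' v2'] /(I1 _ _ v1 v1') e1 /(I1 _ _ v2 v2') e2.
  move=> /iinj/(pcan_inj pickleK) e3.
  by case: u u' e1 e2 e3 {v1 v2 v1' v2'} => [[? ?] ?] [[? ?] ?] /= -> -> ->.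
pose data := (nat * (nat * seq (nat *l W)) * 
  seq ((nat * seq (nat *l W)) * (nat * seq (nat *l W)) * int))%type.
pose valid3 (D : data) := valid D.1.2 /\ forall u, u \in D.2 -> valid2 u.
pose code3 (D : data) : W := E (i D.1.1 :: code1 D.1.2 :: [seq code2 u | u <- D.2]).
have A3 D : valid3 D -> all_in K (i D.1.1 :: code1 D.1.2 :: [seq code2 u | u <- D.2]).
  move=> [v1 v2]; do !split; [exact: iK|exact: K1|].
  by apply: (all_in_map (P := K)) => u /v2/A2/EK.
have I3 D D' : valid3 D -> valid3 D' -> code3 D = code3 D' -> D = D'.
  move=> vD vD' /(EI _ _ (A3 _ vD) (A3 _ vD'))[/iinj].
  case: vD vD' => [v1 v2] [v1' v2'] e1 /(I1 _ _ v1 v1') e2 /(map_inj_in I2 v2 v2') e3.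
  by case: D D' e1 e2 e3 {v1 v2 v1' v2'} => [[? ?] ?] [[? ?] ?] /= -> -> ->.
pose L := lexord wf hats.
pose typ (f g : L) n (D : data) := exists a s b t l,
  [/\ node F a s, node F b t, a <= b, forall p, p \in l -> p.1 <= a
    & forall x, x <= a -> t x - s x = st l x] /\
  [/\ sval f = hat a s, sval g = hat b t &
    D = (n, point_code Wsucc s a, pair_code Wsucc s t l)].
have typ_valid f g n D : typ f g n D -> valid3 D.
  move=> [a [s [b [t [l [[ns nt ab la _] [_ _ ->]]]]]]]; split.
    exact: (valid_point _ _ _ ns (lexx a)).
  move=> u /mapP[p pl ->]; split; first exact: (valid_point _ _ _ ns (la _ pl)).
  exact: (valid_point _ _ _ nt (le_trans (la _ pl) ab)).
have typ_chain f g f' g' n D : typ f g n D -> typ f' g' n D -> f < f' -> g' < g -> False.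
  move=> [a [s [b [t [l [[ns nt ab la lE] [ef eg ->]]]]]]].
  move=> [a' [s' [b' [t' [l' [[ns' nt' ab' la' lE'] [ef' eg' e]]]]]]].
  move=> /lexord_ltP ff /lexord_ltP gg; rewrite ef ef' in ff; rewrite eg eg' in gg.
  have e1 : point_code Wsucc s a = point_code Wsucc s' a' := congr1 (fun D => D.1.2) e.
  have e2 : pair_code Wsucc s t l = pair_code Wsucc s' t' l' := congr1 snd e.
  exact: (pair_code_chain kcard GB ns nt ab la lE ns' nt' ab' la' lE' e1 e2 ff gg).
have typ_ex (f g : L) a s b t : node F a s -> node F b t -> a <= b ->
    sval f = hat a s -> sval g = hat b t -> forall n, exists D, typ f g n D /\ D.1.1 = n.
  move=> ns nt ab ef eg n; have [l [la lE]] := node_diff kcard Wsucc GB ns nt ab.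
  by exists (n, point_code Wsucc s a, pair_code Wsucc s t l); split=> //; exists a, s, b, t, l.
(* The flag is 0 when the first component is not longer than the second, and 1 when the components
   are exchanged. *)
have /choice[D DP] : forall p : L * L, exists D : data,
    (typ p.1 p.2 0%N D \/ typ p.2 p.1 1%N D).
  move=> [[f hf] [g hg]]; have [a [s [ns ef]]] := hf; have [b [t [nt eg]]] := hg.
  have [ab|/ltW ba] := leP a b.
    have [D [h _]] := typ_ex (exist _ f hf) (exist _ g hg) a s b t ns nt ab ef eg 0%N.
    by exists D; left.
  have [D [h _]] := typ_ex (exist _ g hg) (exist _ f hf) b t a s nt ns ba eg ef 1%N.
  by exists D; right.
have Dv p : valid3 (D p) by case: (DP p) => /typ_valid.
have flag f g n D' : typ f g n D' -> D'.1.1 = n.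
  by move=> [a [s [b [t [l [_ [_ _ ->]]]]]]].
exists (fun x => [set p | code3 (D p) = x]).
  apply/seteqP; split=> // p _; exists (code3 (D p)) => //.
  by rewrite /= in_itv /=; apply: EK; exact: A3.
move=> x xk p q /= Dp Dq; have e : D p = D q by apply: I3 => //; rewrite Dp.
have no n : (typ p.1 p.2 n (D p) /\ typ q.1 q.2 n (D p)) \/
            (typ p.2 p.1 n (D p) /\ typ q.2 q.1 n (D p)) ->
    (p.1 <= q.1) && (p.2 <= q.2) || (q.1 <= p.1) && (q.2 <= p.2).
  have [l1|l1|e1] := ltgtP p.1 q.1; have [l2|l2|e2] := ltgtP p.2 q.2 => //=.
    by case=> [[h1 h2]|[h1 h2]]; [case: (typ_chain _ _ _ _ _ _ h1 h2 l1 l2)|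
      case: (typ_chain _ _ _ _ _ _ h2 h1 l2 l1)].
  by case=> [[h1 h2]|[h1 h2]]; [case: (typ_chain _ _ _ _ _ _ h2 h1 l1 l2)|
    case: (typ_chain _ _ _ _ _ _ h1 h2 l2 l1)].
have tE : (p <= q) || (q <= p) by
  case: (DP p) (DP q) => hp [hq|hq]; rewrite -e in hq;
  [apply: (no 0%N); left|move: (flag _ _ _ _ hp) (flag _ _ _ _ hq) => ->|
   move: (flag _ _ _ _ hp) (flag _ _ _ _ hq) => ->|apply: (no 1%N); right].
by case/orP: tE => h; [left|right].
Qed.

End NodeSets.

(** * Minimality *)

Section BoundedScattered.
Context {d : Order.disp_t} {W : orderType d} {k : W}.
Hypothesis kcard : is_infinite_cardinal k.
Hypothesis Wsucc : is_cardinal_successor k.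
Context (F : W -> W -> int) (code : W * seq (W * int) -> W).
Hypothesis GB : guessed_base k F code.
Implicit Types (a b c e x y z : W) (s g : W -> int) (l : seq (W * int)).
Local Open Scope ring_scope.
Local Open Scope order_scope.

Let wf := succ_wf Wsucc.
Notation L := (lexord (succ_wf Wsucc) (hats F)).

Definition few_jumps g (N : nat) : set (W -> nat) := [set f | exists a s l,
  [/\ (size l <= N)%N, forall x, x <= a -> 0 <= s x,
      forall x, x <= a -> s x = g x + st l x & f = hat a s]].

(** Take [r0] where the least value on the interval is attained; monotonicity forces that value at
    all earlier points. *)
Lemma constant_near (h : rat -> nat) (p q : rat) : p < q ->
  (forall r r', p < r -> r < r' -> r' < q -> (h r <= h r')%N) ->
  exists r0, [/\ p < r0, r0 < q & forall r, p < r -> r < r0 -> h r = h r0].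
Proof.
move=> pq hm; have [pm mq] := midf_lt pq.
have [_ [[r0 [pr0 r0q <-]] mmin]] := wo_min wf_nat
  (A := [set n | exists r, [/\ p < r, r < q & h r = n]])
  (ex_intro _ _ (ex_intro _ _ (And3 pm mq erefl))).
exists r0; split=> // r pr rr0; apply/eqP; rewrite eqn_leq hm //=.
by have := mmin (h r); rewrite leEnat; apply; exists r; split=> //; exact: lt_trans r0q.
Qed.

(** At the least [z] where the family is not constant, the values are nondecreasing along it and at
    least two in number, so they avoid [v z] on one side; [constant_near] then gives a
    subinterval. *)
Lemma first_splitting (v : W -> nat) (p q : rat) (f : rat -> W -> nat) : p < q ->
  (forall r r', p < r -> r < r' -> r' < q -> lexlt (f r) (f r')) ->
  exists z p' q' w, [/\ p <= p', q' <= q, p' < q', w <> v z /\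
      (forall r, p' < r -> r < q' -> f r z = w)
    & forall r r' y, p < r -> r < r' -> r' < q -> y < z -> f r y = f r' y].
Proof.
move=> pq fm; have [pm mq] := midf_lt pq; have [pm' mm'] := midf_lt pm.
have [|z [[r1 [r2 [pr1 r12 r2q ne]]] zmin]] := wo_min wf (A := [set z | exists r r',
    [/\ p < r, r < r', r' < q & f r z <> f r' z]]).
  have [z [_ lt]] := fm _ _ pm' mm' mq.
  exists z; do 2 eexists; split; [exact: pm'|exact: mm'|exact: mq|].
  by move=> e; rewrite e ltnn in lt.
have ag r r' y : p < r -> r < r' -> r' < q -> y < z -> f r y = f r' y.
  move=> pr rr r'q yz; apply: contrapT => e; move: yz; rewrite ltNge zmin //.
  by exists r, r'.
have hm r r' : p < r -> r < r' -> r' < q -> (f r z <= f r' z)%N.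
  move=> pr rr r'q; have [y [fy lt]] := fm r r' pr rr r'q.
  have [zy|yz|e] := ltgtP z y; first by rewrite fy.
    by rewrite (ag r r' y) // ltnn in lt.
  by rewrite e ltnW.
have lt12 : (f r1 z < f r2 z)%N by rewrite ltn_neqAle hm // andbT; apply/eqP.
have [lt|ge] := ltnP (f r1 z) (v z).
  have [|r0 [pr0 r01 cE]] := constant_near (h := fun r => f r z) pr1.
    by move=> r r' pr rr rr1; apply: hm => //; exact: lt_trans rr1 (lt_trans r12 r2q).
  exists z, p, r0, (f r0 z); split=> //.
    exact: ltW (lt_trans r01 (lt_trans r12 r2q)).
  split=> // e; have := hm r0 r1 pr0 r01 (lt_trans r12 r2q).
  by rewrite e leqNgt lt.
have [|r0 [pr0 r01 cE]] := constant_near (h := fun r => f r z) r2q.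
  by move=> r r' pr rr rr1; apply: hm => //; exact: lt_trans pr1 (lt_trans r12 pr).
exists z, r2, r0, (f r0 z); split=> //.
- exact: ltW (lt_trans pr1 r12).
- exact: ltW.
split=> // e; have := hm r2 r0 (lt_trans pr1 r12) pr0 r01.
by rewrite e leqNgt (leq_ltn_trans ge lt12).
Qed.

(** Induction on the number of jumps: on a subinterval the members agree up to [z], with a value at
    [z] other than that of [g]. Comparison with a map containing this common beginning removes at
    least one jump. *)
Lemma few_jumps_scattered N g (p q : rat) (f : rat -> W -> nat) : p < q ->
  (forall r, p < r -> r < q -> few_jumps g N (f r)) ->
  (forall r r', p < r -> r < r' -> r' < q -> lexlt (f r) (f r')) -> False.
Proof.
elim/ltn_ind: N g p q f => N IH g p q f pq fS fm.
have [z [p' [q' [w [pp' qq' pq' [wv wE] ag]]]]] :=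
  first_splitting (fun z => `|g z|.+1) pq fm.
have [pm2 mq2] := midf_lt pq'; have [pm3 mm3] := midf_lt pm2.
have inP r : p' < r -> p < r by exact: le_lt_trans.
have inQ r : r < q' -> r < q by move=> rq; exact: lt_le_trans rq qq'.
(* The value 0 would mean that the members have ended before [z]; agreeing below [z], they would all
   be equal. *)
have w0 : w <> 0%N.
  move=> w0; have [y [ye lt]] := fm _ _ (inP _ pm3) mm3 (inQ _ mq2).
  have [a [s [l [l0 s0 sE fE]]]] := fS _ (inP _ pm2) (inQ _ mq2).
  have := wE _ pm2 mq2; rewrite w0 fE /hat; case: ifP => // /negbT; rewrite -ltNge => az _.
  have zy : z <= y.
    rewrite leNgt; apply/negP => yz; move: lt.
    by rewrite (ag _ _ y (inP _ pm3) mm3 (inQ _ mq2) yz) ltnn.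
  by move: lt; rewrite fE /hat leNgt (lt_le_trans az zy).
have [am [sm [lm [_ sm0 smE fmE]]]] := fS _ (inP _ pm2) (inQ _ mq2).
(* The common beginning up to [z], then [g] shifted to match the value at [z]; the predecessor
   undoes the shift in [hat]. *)
pose g' x := if x <= z then sm x else g x + (w.-1%:Z - g z).
have N0 : (0 < N)%N.
  have [a [s [l [lN s0 sE fE]]]] := fS _ (inP _ pm2) (inQ _ mq2).
  rewrite lt0n; apply/eqP => Ne; move: lN; rewrite Ne leqn0 size_eq0 => /eqP l0.
  have := wE _ pm2 mq2; rewrite fE /hat; case: ifP => [za we|_ we]; last exact: w0.
  by apply: wv; rewrite -we sE // l0 st_nil addr0.
have N1 : (N.-1 < N)%N by rewrite prednK.
apply: (IH N.-1 N1 g' p' q' f pq') => [r pr rq|r r' pr rr rq]; last first.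
  by apply: fm => //; [exact: inP|exact: inQ].
have [a [s [l [lN s0 sE fE]]]] := fS r (inP _ pr) (inQ _ rq).
have za : z <= a.
  by have := wE r pr rq; rewrite fE /hat; case: ifP => // _ e; case: w0.
have zam : z <= am.
  by have := wE _ pm2 mq2; rewrite fmE /hat; case: ifP => // _ e; case: w0.
have sz : s z = w.-1%:Z.
  by have := wE r pr rq; rewrite fE /hat za => <-; rewrite gez0_abs // s0.
have smz : sm z = w.-1%:Z.
  by have := wE _ pm2 mq2; rewrite fmE /hat zam => <-; rewrite gez0_abs // sm0.
have stz : st l z = w.-1%:Z - g z by rewrite -sz sE // addrAC subrr add0r.
pose l' := [seq p0 <- l | z < p0.1].
have stE x : z <= x -> st l x = st l z + st l' x.
  move=> zx; rewrite /l'; elim: (l) => [|p0 l1 IHl]; first by rewrite !st_nil.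
  rewrite /= !st_cons IHl; have [zp|pz] := ltP z p0.1.
    by rewrite st_cons /= add0r addrCA.
  by rewrite (le_trans pz zx) addrA.
exists a, s, l'; split=> //.
  rewrite -ltnS prednK //; apply: leq_trans lN; rewrite size_filter ltn_neqAle count_size andbT.
  apply/eqP => e; have lall : all (fun p0 : W * int => z < p0.1) l by rewrite all_count e.
  have st0 : st l z = 0.
    rewrite /st big_seq_cond big1 // => p0 /andP[p0l /andP[p0z _]].
    by have := allP lall p0 p0l; rewrite ltNge p0z.
  apply: wv; have := sE z za; rewrite st0 addr0 sz => <-.
  by case: (w) w0.
move=> x xa; rewrite /g'; have [xz|zx] := leP x z.
  have st'0 : st l' x = 0.
    rewrite /st big_seq_cond big1 // => p0 /andP[]; rewrite mem_filter => /andP[zp _].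
    by rewrite leNgt (le_lt_trans xz zp).
  rewrite st'0 addr0; have [->|xz'] := eqVneq x z; first by rewrite sz smz.
  have xlz : x < z by rewrite lt_neqAle xz'.
  have fx : f r x = f ((p' + q') / 2) x.
    have [lt|gt|-> //] := ltgtP r ((p' + q') / 2).
      by apply: ag => //; [exact: inP|exact: inQ].
    by symmetry; apply: ag => //; [exact: inP|exact: inQ].
  move: fx; rewrite fE fmE /hat xa (le_trans xz zam) => -[e].
  by rewrite -[s x]gez0_abs ?s0 // e gez0_abs // sm0 // (le_trans xz zam).
by rewrite sE // stE ?(ltW zx) // stz addrA.
Qed.

Lemma bounded_sigma_scattered (A : set L) b :
  (forall f x, A f -> b < x -> sval f x = 0%N) -> sigma_scattered A.
Proof.
move=> Ab; exists (fun N => [set f | A f /\ few_jumps (F b) N (sval f)]).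
  apply/seteqP; split=> [f Af|f [n _ []] //].
  have [a [s [ns fE]]] := svalP f.
  have ab : a <= b.
    rewrite leNgt; apply/negP => /(Ab f a Af); rewrite fE /hat lexx; by [].
  have [l [la lE]] := node_diff kcard Wsucc GB ns (node_base kcard Wsucc GB b) ab.
  exists (size l) => //; split=> //; exists a, s, (oppl l); split=> //.
  - by rewrite size_map.
  - by case: ns.
  - by move=> x xa; rewrite st_opp -lE // opprB addrC subrK.
move=> N [f [fA fm]]; have lt01 : (0 : rat) < 1 by [].
apply: (few_jumps_scattered (f := fun r => sval (f r)) (N := N) (g := F b) lt01).
  by move=> r _ _; case: (fA r).
by move=> r r' _ rr _; apply/lexord_ltP; rewrite fm.
Qed.

End BoundedScattered.

(** * Capturing a cone in an unbounded set of nodes *)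

Section Capture.
Context {d : Order.disp_t} {W : orderType d} {k : W}.
Hypothesis kcard : is_infinite_cardinal k.
Hypothesis Wsucc : is_cardinal_successor k.
Context (F : W -> W -> int) (code : W * seq (W * int) -> W).
Hypothesis GB : guessed_base k F code.
Implicit Types (a b c e x y z : W) (s t : W -> int) (l : seq (W * int)).
Local Open Scope ring_scope.
Local Open Scope order_scope.

Notation node := (node F).

Section Downset.
Variable A : set (W -> nat).
Hypothesis A_hats : A `<=` hats F.
Hypothesis A_unbounded : forall b, exists f x, [/\ A f, b < x & f x <> 0%N].

Definition in_downset a s := exists b t,
  [/\ node b t, A (hat b t), a <= b & forall x, x <= a -> s x = t x].

Lemma in_downset_eq a s t : (forall x, x <= a -> s x = t x) ->
  in_downset a s -> in_downset a t.
Proof.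
move=> st_ [b [t' [nt' At' ab e]]]; exists b, t'; split=> // x xa.
by rewrite -st_ ?e.
Qed.

(* [l'] represents an extension outside the downset of the node of level e
   represented by [l], all new values exceeding the last one. *)
Definition missed e l xi l' : Prop :=
  [/\ e < xi, node xi (fun x => F xi x + st l' x),
      forall x, x <= e -> F xi x + st l' x = F e x + st l x,
      forall x, e < x -> x <= xi -> F e e + st l e < F xi x + st l' x
    & ~ in_downset xi (fun x => F xi x + st l' x)].

Lemma missed_bound : exists B : W -> W, forall e l, (forall p, p \in l -> p.1 <= e) ->
  (exists xi l', missed e l xi l') ->
  exists xi l', [/\ missed e l xi l', xi < B e & code (xi, l') < B e].
Proof.
suff /choice[B BP] : forall e, exists b, forall l, (forall p, p \in l -> p.1 <= e) ->
    (exists xi l', missed e l xi l') ->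
    exists xi l', [/\ missed e l xi l', xi < b & code (xi, l') < b] by exists B.
move=> e; have /choice[g gP] : forall l, exists q : W * seq (W * int),
    (exists xi l', missed e l xi l') -> missed e l q.1 q.2.
  move=> l; have [[xi [l' m]]|n] := pselect (exists xi l', missed e l xi l').
    by exists (xi, l').
  by exists (k, [::]).
have small (h : seq (W * int) -> W) : exists b, forall l,
    (forall p, p \in l -> p.1 <= e) -> h l < b.
  have [|b bP] := bounded kcard Wsucc (A := h @` [set l | forall p, p \in l -> p.1 <= e]).
    exact: card_le_trans (card_image_le _ _) (lists_small kcard Wsucc e).
  by exists b => l le; apply: bP; exists l.
have [b1 b1P] := small (fun l => (g l).1); have [b2 b2P] := small (code \o g).
exists (Order.max b1 b2) => l le ex; exists (g l).1, (g l).2; split; first exact: gP.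
  by rewrite lt_max b1P.
by rewrite lt_max -surjective_pairing [_ < b2]b2P ?orbT.
Qed.

(** Guess the codes of the downset at a level [a], and let a node [t] of [A] reach beyond [a]. At
    the block where its jump list was tested, a missed extension of [t] up to [succ c] would provide
    an escaping continuation; then [t] would leave the downset below [a], which is absurd. *)
Lemma capture : exists c u, node c u /\ forall xi v, node xi v -> c <= xi ->
  (forall x, x <= c -> v x = u x) -> (forall x, c < x -> x <= xi -> u c < v x) ->
  in_downset xi v.
Proof.
pose Y : set W := [set w | exists xi l, w = code (xi, l) /\
  in_downset xi (fun x => F xi x + st l x)].
have YP xi l : Y (code (xi, l)) -> in_downset xi (fun x => F xi x + st l x).
  by move=> [xi' [l' [/(gb_code GB)[-> ->]]]].
have [B BP] := missed_bound.
(* The bound is taken at [succ x] because the node to be extended has level [succ c] with [c] in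
   [E]. *)
pose E := closure_points (fun x => Order.max (succ x) (B (succ x))).
have Ecl : club_in setT E := closure_points_club kcard Wsucc _.
have [a Ea [la esc]] := gb_escape GB Y Ecl.
have [f [x0 [Af ax0 fx0]]] := A_unbounded a.
have [a0 [t [nt0 fE]]] := A_hats Af.
have aa0 : a <= a0.
  apply: ltW; rewrite ltNge; apply/negP => h.
  by move: fx0; rewrite fE /hat leNgt (le_lt_trans h ax0).
have nt : node a t := node_restr kcard Wsucc GB aa0 nt0.
have tB xi s : xi <= a0 -> (forall x, x <= xi -> s x = t x) -> in_downset xi s.
  by move=> xia e; exists a0, t; split=> //; rewrite -fE.
have [l0 [_ l0E]] := node_repr kcard Wsucc nt.
pose l := [seq p <- l0 | p.1 < a].
have lE x : x <= a -> t x = F a x + st l x.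
  move=> xa; rewrite l0E //; congr (_ + _); rewrite /st big_filter_cond.
  apply: eq_bigl => p; have [px|] := boolP (p.1 <= x); last by rewrite andbF.
  have [lp|nlp] := pselect (is_limit p.1).
    by rewrite (introT (asboolP _) lp) !andbF.
  suff -> : p.1 < a by [].
  rewrite lt_neqAle (le_trans px xa) andbT; apply/eqP => pa.
  by apply: nlp; rewrite pa.
have [|c [e [Ec Ee /andP[ce ea] lc [Fc {}esc]]]] := esc l.
  by move=> p; rewrite mem_filter => /andP[].
have sce : succ c < e by have := Ee c ce; rewrite gt_max => /andP[].
have Bce : B (succ c) < e by have := Ee c ce; rewrite gt_max => /andP[].
have ca : succ c <= a by exact: ltW (lt_trans sce ea).
have cc : c <= succ c by exact: ltW (lt_succ kcard Wsucc _).
have nu : node (succ c) t := node_restr kcard Wsucc GB ca nt.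
(* The list has no jump after [c] and [F a] vanishes at [succ c], so the step function is constant
   from [c] on. *)
have stk x : c <= x -> st l x = t (succ c).
  move=> cx; rewrite lE // Fc add0r (st_tail lc cx) (st_tail lc cc) //.
exists (succ c), t; split=> // xi v nv cxi vt vk.
move: cxi; rewrite le_eqVlt => /orP[/eqP e1|cxi].
  by apply: tB; rewrite -e1 //; exact: le_trans ca aa0.
apply: contrapT => nin.
have [lu [luc luE]] := node_repr kcard Wsucc nu.
have [lv [_ lvE]] := node_repr kcard Wsucc nv.
have mis : missed (succ c) lu xi lv.
  split=> //.
  - by apply: (node_eq kcard Wsucc) nv => x /lvE.
  - by move=> x xc; rewrite -luE // -lvE ?vt // (le_trans xc) // ltW.
  - by move=> x cx xxi; rewrite -luE // -lvE // vk.
  - by move=> h; apply: nin; apply: in_downset_eq h => x /lvE.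
have [|xi' [l' [[cxi' nv' vt' vk' nin'] xiB codeB]]] := BP (succ c) lu luc.
  by exists xi, lv.
(* Subtracting that constant compensates the shift by [st l]; the result is positive on the block
   because new values exceed [t (succ c)]. *)
pose v' x : int := if x <= succ c then F e x else
  if x <= xi' then F xi' x + st l' x - t (succ c) else F e x + 1.
have xie : xi' < e := lt_trans xiB Bce.
have [] := esc; last first.
  move=> xi2 [l2 [xi2e _ nY l2E]]; apply: nY; exists xi2, l2; split=> //.
  apply: tB => [|x xxi].
    exact: le_trans (ltW (lt_trans xi2e ea)) aa0.
  by rewrite -l2E // -lE // (le_trans xxi) // ltW // (lt_trans xi2e).
exists v'; split.
- move=> b lb be; have [bc|cb] := leP b (succ c).
    apply: (cont_eqW kcard Wsucc lb) (cont_cst 0 lb) => x xb.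
    by rewrite /v' (le_trans xb bc) subrr.
  have [bxi|xib] := leP b xi'.
    have cc' : cont_at (fun x => (F xi' x + st l' x) - F e x) b.
      by apply: (node_cont kcard Wsucc GB (node_base kcard Wsucc GB e) nv' lb be bxi).
    apply: (cont_eq kcard Wsucc lb cb) (cont_add cc' (cont_cst (- t (succ c)) lb)).
    by move=> x cx xb; rewrite /v' leNgt cx /= (le_trans xb bxi) addrAC.
  have cxib : Order.max (succ c) xi' < b by rewrite gt_max cb.
  apply: (cont_eq kcard Wsucc lb cxib) (cont_cst 1 lb) => x.
  rewrite gt_max => /andP[cx xix] _; rewrite /v' !leNgt cx xix /=.
  by rewrite addrAC subrr add0r.
- move=> x xe cx; rewrite /v' leNgt cx /=; have [xxi|] := leP x xi'.
    have := vk' x cx xxi; rewrite -luE // => h.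
    by rewrite -gtz0_ge1 subr_gt0.
  by move=> _; rewrite lerDr (gb_ge0 GB).
exists xi', l'; split=> //; first exact: lt_trans codeB Bce.
  by move=> /YP.
move=> x xxi; rewrite /splice /v'; have [xc|cx] := leP x c.
  by rewrite -lE ?vt' ?luE // ?(le_trans xc) // (le_trans cc ca).
have [xc|cx'] := leP x (succ c); last by rewrite xxi stk ?subrK // ltW.
have -> : x = succ c by apply/eqP; rewrite eq_le xc (succ_le kcard Wsucc).
by rewrite add0r stk // vt' // luE.
Qed.

End Downset.
End Capture.

(** * Lexicographic coding of countable linear orders *)

Section Words.
Context {d : Order.disp_t} {T : orderType d} (enc : T -> nat) (dec : nat -> option T).
Hypothesis encK : pcancel enc dec.
Local Open Scope ring_scope.
Local Open Scope order_scope.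

Definition sign (z q : T) : int := if z < q then -1 else if q < z then 1 else 0.

(* The signs of z relative to the first elements of an enumeration, up to z
   itself: a lexicographic coding by finitely supported sequences. *)
Definition word (z : T) (n : nat) : int :=
  if (n <= enc z)%N then (if dec n is Some q then sign z q else 0) else 0.

(** Subtraction gives [z0] the zero word; with [z0 = 0], points without a jump add nothing to a
    coding matrix. *)
Definition rel_word (z0 z : T) (n : nat) : int := word z n - word z0 n.

Lemma sign_le z z' q : z < z' -> sign z q <= sign z' q.
Proof.
rewrite /sign => zz; have [zq|qz|e] := ltgtP z q.
- by case: ifP => // _; case: ifP.
- by rewrite ltNge (ltW (lt_trans qz zz)) /= (lt_trans qz zz).
- by rewrite -e ltNge (ltW zz) zz.
Qed.

(** Up to the smaller of the two codes both words list signs, which are monotone in the element. At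
    that place one element is compared with itself, so the words differ. *)
Lemma word_lt z z' : z < z' ->
  exists n, (forall i, (i < n)%N -> word z i = word z' i) /\ word z n < word z' n.
Proof.
move=> zz; have le i : (i <= enc z)%N -> (i <= enc z')%N -> word z i <= word z' i.
  move=> iz iz'; rewrite /word iz iz'; case: (dec i) => [q|//]; exact: sign_le.
pose m := minn (enc z) (enc z').
have mz : (m <= enc z)%N by rewrite geq_minl.
have mz' : (m <= enc z')%N by rewrite geq_minr.
have ne : word z m <> word z' m.
  rewrite /word mz mz' /m; case: (leqP (enc z) (enc z')) => _; rewrite encK /sign.
    by rewrite ltxx zz ltNge (ltW zz).
  by rewrite zz ltxx.
have [n [nn nmin]] := wo_min wf_nat (A := [set i | word z i <> word z' i])
  (ex_intro _ m ne).
have nm : (n <= m)%N by apply: nmin.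
exists n; split=> [i ni|].
  apply: contrapT => /nmin; rewrite leEnat; by rewrite leqNgt ni.
by rewrite lt_neqAle le ?(leq_trans nm) // andbT; apply/eqP.
Qed.

Lemma rel_word_lt z0 z z' : z < z' -> exists n,
  (forall i, (i < n)%N -> rel_word z0 z i = rel_word z0 z' i) /\
  rel_word z0 z n < rel_word z0 z' n.
Proof.
move=> /word_lt[n [e lt]]; exists n; split=> [i /e|]; first by rewrite /rel_word => ->.
by rewrite /rel_word; lia.
Qed.

Lemma rel_word0 z n : rel_word z z n = 0.
Proof. exact: subrr. Qed.

Lemma rel_word_ge z0 z n : -2 <= rel_word z0 z n.
Proof.
have b y : -1 <= word y n /\ word y n <= 1.
  by rewrite /word; case: ifP => // _; case: (dec n) => // q; rewrite /sign; case: (y < q); case: (q < y).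
by have [h1 h2] := b z; have [h3 h4] := b z0; rewrite /rel_word; lia.
Qed.

Lemma rel_word_supp z0 z n : (enc z + enc z0 < n)%N -> rel_word z0 z n = 0.
Proof. by move=> h; rewrite /rel_word /word !ifF ?subrr //; apply/negbTE; lia. Qed.

End Words.

(** * Inscribing integer matrices above a node *)

Section Coding.
Context {d : Order.disp_t} {W : orderType d} {k : W}.
Hypothesis kcard : is_infinite_cardinal k.
Hypothesis Wsucc : is_cardinal_successor k.
Implicit Types (a b c e x y z : W).
Local Open Scope ring_scope.
Local Open Scope order_scope.

Let wf := succ_wf Wsucc.

(* Positions for coding a finitely supported W * nat matrix of integers by a
   finite change of a node of level [top] above [c]. *)
Lemma exists_positions c : exists (top : W) (pos : W -> nat -> W),
  [/\ is_limit top, c < top,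
    forall x n, x < top -> c < pos x n < top,
    forall x n, ~ is_limit (pos x n)
    & forall x n y m, (x < y \/ x = y /\ (n < m)%N) -> pos x n < pos y m].
Proof.
have /choice[w wP] : forall y, exists b, forall n, iter n.+1 succ y < b.
  by move=> y; apply: (bounded_seq kcard Wsucc (fun n => iter n.+1 succ y)).
(* [G x] opens row [x] above [c] and all earlier rows, [w] bounding the finite successors of a
   point; the positions in the row are successors of [G x], hence never limits. *)
pose G := wfrec wf k (fun x g => least k [set v | c < v /\ forall y, y < x -> w (g y) < v]).
have GE x : G x = least k [set v | c < v /\ forall y, y < x -> w (G y) < v].
  rewrite {1}/G wfrecE; congr (least k _); apply/seteqP.
  by split=> v /= [cv h]; split=> // y yx; move: (h y yx); rewrite /cut yx.
have GP x : c < G x /\ forall y, y < x -> w (G y) < G x.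
  have [|b bP] := bounded kcard Wsucc (A := (w \o G) @` [set y | y < x]).
    have h := Iio_small Wsucc x; exact: card_le_trans (card_image_le _ _) h.
  have [c' cc'] := exists_gt kcard Wsucc c.
  have ne : [set v | c < v /\ forall y, y < x -> w (G y) < v] !=set0.
    exists (Order.max b c'); split; first by rewrite lt_max cc' orbT.
    by move=> y yx; rewrite lt_max bP //; exists y.
  by have [+ _] := leastP wf k ne; rewrite -GE.
have [top [ct lt tP]] := closure_points_unbounded kcard Wsucc (w \o G) c.
pose pos x n := iter n.+1 succ (G x).
have gpos x n : G x < pos x n.
  elim: n => [|n IH]; first exact: (lt_succ kcard Wsucc).
  exact: lt_trans IH (lt_succ kcard Wsucc _).
exists top, pos; split=> //.
- move=> x n xt; apply/andP; split; first exact: lt_trans (GP x).1 (gpos x n).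
  exact: lt_trans (wP _ n) (tP x xt).
- by move=> x n; rewrite /pos iterS; exact: (succ_nlimit kcard Wsucc).
- move=> x n y m [xy|[-> nm]].
    exact: lt_trans (wP _ n) (lt_trans ((GP y).2 x xy) (gpos y m)).
  rewrite /pos; elim: m nm => // m IH; rewrite ltnS leq_eqVlt => /orP[/eqP ->|/IH lt'].
    exact: (lt_succ kcard Wsucc).
  exact: lt_trans lt' (lt_succ kcard Wsucc _).
Qed.

Context (c top : W) (pos : W -> nat -> W).
Hypothesis top_lim : is_limit top.
Hypothesis pos_in : forall x n, x < top -> c < pos x n < top.
Hypothesis pos_nlim : forall x n, ~ is_limit (pos x n).
Hypothesis pos_lt : forall x n y m, (x < y \/ x = y /\ (n < m)%N) -> pos x n < pos y m.
Implicit Types (M : W -> nat -> int).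

Definition inscribe M x : int :=
  if pselect (exists q : W * nat, q.1 < top /\ x = pos q.1 q.2) is left h
  then M (projT1 (cid h)).1 (projT1 (cid h)).2 else 0.

Lemma pos_inj x n y m : pos x n = pos y m -> x = y /\ n = m.
Proof.
move=> e; have ne (q : Prop) : pos x n < pos y m \/ pos y m < pos x n -> q.
  by rewrite e ltxx; case.
have [xy|yx|xy] := ltgtP x y; first by apply: ne; left; apply: pos_lt; left.
  by apply: ne; right; apply: pos_lt; left.
split=> //; have [nm|mn|//] := ltngtP n m.
  by apply: ne; left; apply: pos_lt; right.
by apply: ne; right; apply: pos_lt; right.
Qed.

Lemma inscribe_pos M x n : x < top -> inscribe M (pos x n) = M x n.
Proof.
move=> xt; rewrite /inscribe; case: pselect => [h|[]]; last by exists (x, n).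
by case: (cid h) => -[y m] /= [_ /pos_inj[-> ->]].
Qed.

Lemma inscribe_or M x : inscribe M x = 0 \/
  exists y n, [/\ y < top, x = pos y n & inscribe M x = M y n].
Proof.
have [[[y n] [/= yt ->]]|n] := pselect (exists q : W * nat, q.1 < top /\ x = pos q.1 q.2).
  by right; exists y, n; rewrite inscribe_pos.
by left; rewrite /inscribe; case: pselect.
Qed.

Lemma inscribe_ge M (i : int) x : i <= 0 -> (forall y n, i <= M y n) -> i <= inscribe M x.
Proof. by move=> i0 iM; case: (inscribe_or M x) => [->|[y [n [_ _ ->]]]]. Qed.

(** By finite support no nonzero entry lies in some interval ending at [b], and at the limit [b]
    there is no position. *)
Lemma inscribe_cont M (s : seq (W * nat)) b : is_limit b ->
  (forall y n, (y, n) \notin s -> M y n = 0) -> cont_at (inscribe M) b.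
Proof.
move=> lb Ms; have b0 x : is_limit x -> inscribe M x = 0.
  move=> lx; case: (inscribe_or M x) => // -[y [n [_ xE _]]].
  by case: (@pos_nlim y n); rewrite -xE.
have [e eb eP] : exists2 e, e < b & forall q, q \in s -> pos q.1 q.2 < b -> pos q.1 q.2 < e.
  elim: (s) => [|q s' [e eb eP]]; first by have [[x xb] _] := lb; exists x.
  have [qb|bq] := ltP (pos q.1 q.2) b; last first.
    exists e => // q'; rewrite in_cons => /orP[/eqP ->|/eP //].
    by rewrite ltNge bq.
  exists (Order.max e (succ (pos q.1 q.2))); first by rewrite gt_max eb (succ_limit kcard Wsucc).
  move=> q'; rewrite in_cons => /orP[/eqP ->|/eP h /h lt]; rewrite lt_max.
    by rewrite (lt_succ kcard Wsucc) orbT.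
  by rewrite lt.
exists e => // x ex xb; rewrite (b0 b lb).
move: xb; rewrite le_eqVlt => /orP[/eqP -> |xb]; first exact: b0.
case: (inscribe_or M x) => // -[y [n [yt xE ->]]]; apply: Ms; apply/negP => /eP /=.
by rewrite -xE xb ltNge ex => /(_ isT).
Qed.

Lemma inscribe_agree M M' z n : z < top ->
  (forall y m, y < z -> M y m = M' y m) -> (forall m, (m < n)%N -> M z m = M' z m) ->
  forall x, x < pos z n -> inscribe M x = inscribe M' x.
Proof.
move=> zt Mz Mn x xz; have E y m : y < top -> pos y m < pos z n -> M y m = M' y m.
  move=> yt lt; have [yz|zy|yz] := ltgtP y z; first exact: Mz.
    by move: lt; rewrite ltNge ltW //; apply: pos_lt; left.
  rewrite yz in lt *; apply: Mn; rewrite ltnNge leq_eqVlt; apply/negP => /orP[/eqP e|nm].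
    by rewrite e ltxx in lt.
  by move: lt; rewrite ltNge ltW //; apply: pos_lt; right.
case: (inscribe_or M x) => [e|[y [m [yt xE ->]]]].
  case: (inscribe_or M' x) => [->//|[y [m [yt xE ->]]]].
  rewrite xE in xz e *; rewrite -E //; move: e; by rewrite inscribe_pos.
rewrite xE in xz *; by rewrite inscribe_pos // E.
Qed.

Lemma inscribe_eq M M' : (forall y m, y < top -> M y m = M' y m) ->
  inscribe M = inscribe M'.
Proof.
move=> MM; apply/funext => x; case: (inscribe_or M x) => [e|[y [m [yt xE ->]]]].
  case: (inscribe_or M' x) => [->//|[y [m [yt xE ->]]]].
  rewrite xE in e *; rewrite -MM //; move: e; by rewrite inscribe_pos.
by rewrite xE inscribe_pos // MM.
Qed.

End Coding.

(** * Embedding the whole order into an unbounded suborder *)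

Section Embedding.
Context {d : Order.disp_t} {W : orderType d} {k : W}.
Hypothesis kcard : is_infinite_cardinal k.
Hypothesis Wsucc : is_cardinal_successor k.
Context (F : W -> W -> int) (code : W * seq (W * int) -> W).
Hypothesis GB : guessed_base k F code.
Implicit Types (a b c e x y z : W) (s t u : W -> int) (l : seq (W * int)).
Implicit Types (M : W -> nat -> int).
Local Open Scope ring_scope.
Local Open Scope order_scope.

Notation node := (node F).
Notation L := (lexord (succ_wf Wsucc) (hats F)).

Section Graft.
Context (c top : W) (pos : W -> nat -> W) (u : W -> int).
Hypothesis top_lim : is_limit top.
Hypothesis c_top : c < top.
Hypothesis pos_in : forall x n, x < top -> c < pos x n < top.
Hypothesis pos_nlim : forall x n, ~ is_limit (pos x n).
Hypothesis pos_lt : forall x n y m, (x < y \/ x = y /\ (n < m)%N) -> pos x n < pos y m.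
Hypothesis nu : node c u.

(** The entries of [M] will be at least -2, so the shift by [u c + 3] keeps new values above [u c],
    as [capture] requires. The last value [u c + 1], at [succ T], is below all copied values and
    imitates the end of a node. *)
Definition graft M T s x : int :=
  if x <= c then u x else
  if x <= top then F top x + (inscribe top pos M x + (u c + 3)) else
  if x <= T then s x + (u c + 3) else u c + 1.

Let uc0 : 0 <= u c. Proof. by case: nu => u0 _; apply: u0. Qed.

Lemma graft_gt M T s x : node T s -> (forall y n, -2 <= M y n) -> c < x ->
  u c < graft M T s x.
Proof.
move=> [s0 _] M2 cx; rewrite /graft leNgt cx /=.
case: ifP => _.
  have h1 := gb_ge0 GB top x.
  by have := inscribe_ge top pos_lt x (isT : (-2 <= 0 :> int)) M2; lia.
by case: ifP => [/s0|_]; lia.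
Qed.

Lemma graft_node M (S : seq (W * nat)) T s : top <= T -> node T s ->
  (forall y n, -2 <= M y n) -> (forall y n, (y, n) \notin S -> M y n = 0) ->
  node (succ T) (graft M T s).
Proof.
move=> tT ns M2 MS; apply: (node_at kcard Wsucc GB (lexx (succ T))) => [x _|b lb].
  have [xc|cx] := leP x c; first by rewrite /graft xc; case: nu => u0 _; exact: u0.
  by have := graft_gt ns M2 cx; lia.
rewrite le_eqVlt => /orP[/eqP e|bT].
  by case: (succ_nlimit kcard Wsucc (a := T)); rewrite -e.
rewrite (lt_succ_le kcard Wsucc) in bT.
have bsT : b <= succ T by rewrite (le_trans bT) // ltW // (lt_succ kcard Wsucc).
have nF := node_base kcard Wsucc GB (succ T).
have [bc|cb] := leP b c.
  apply: (cont_eqW kcard Wsucc lb) (node_cont kcard Wsucc GB nF nu lb bsT bc) => x xb.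
  by rewrite /graft (le_trans xb bc).
have [bt|tb] := leP b top.
  have c1 := node_cont kcard Wsucc GB nF (node_base kcard Wsucc GB top) lb bsT bt.
  have c2 := inscribe_cont kcard Wsucc top pos_nlim pos_lt lb MS.
  have c3 := cont_add c1 (cont_add c2 (cont_cst (u c + 3) lb)).
  apply: (cont_eq kcard Wsucc lb cb) c3 => x cx xb.
  by rewrite /graft leNgt cx (le_trans xb bt) /= addrAC.
have c1 := node_cont kcard Wsucc GB nF ns lb bsT bT.
apply: (cont_eq kcard Wsucc lb tb) (cont_add c1 (cont_cst (u c + 3) lb)) => x tx xb.
by rewrite /graft !leNgt tx (lt_trans c_top tx) /= -leNgt (le_trans xb bT) addrAC.
Qed.

Lemma graft_lt M M' T T' s s' z n : z < top -> top <= T -> top <= T' ->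
  (forall y m, y < z -> M y m = M' y m) -> (forall m, (m < n)%N -> M z m = M' z m) ->
  M z n < M' z n ->
  exists w, [/\ w <= succ T, w <= succ T', forall x, x < w -> graft M T s x = graft M' T' s' x
    & graft M T s w < graft M' T' s' w].
Proof.
move=> zt tT tT' My Mz lt; have /andP[cp pt] := pos_in n zt.
have le T0 : top <= T0 -> pos z n <= succ T0.
  move=> h; apply: le_trans (ltW pt) (le_trans h (ltW _)).
  exact: (lt_succ kcard Wsucc).
exists (pos z n); split; [exact: le|exact: le|move=> x xp|].
  rewrite /graft; case: ifP => // _; rewrite (le_trans (ltW xp) (ltW pt)).
  by rewrite (inscribe_agree pos_lt zt My Mz xp).
rewrite /graft leNgt cp (ltW pt) /= !(inscribe_pos pos_lt) //.
by move: lt; lia.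
Qed.

(* The part of a node above [top] is kept, the part below is coded by its jumps
   relative to the base node; its end, if below [top], is a jump down. *)
Definition profile (f : W -> nat) (D : W * (W -> int) * seq (W * int)) : Prop :=
  let: (T, s, l) := D in
  [/\ top <= T, node T s,
    forall x, x < top -> (forall y, y < x -> f y <> 0%N) -> (f x)%:Z = 1 + F top x + st l x,
    (forall y, y < top -> f y <> 0%N) -> forall x, x <= T -> (f x)%:Z = s x + 1
    & forall x, f x <> 0%N -> x <= T].

Lemma exists_profile (f : W -> nat) : hats F f -> exists D, profile f D.
Proof.
move=> [a [s [ns ->]]]; have s0 : forall x, x <= a -> 0 <= s x by case: ns.
have fE x : x <= a -> (hat a s x)%:Z = s x + 1.
  by move=> xa; rewrite /hat xa intS gez0_abs ?s0 // addrC.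
have fn x : hat a s x <> 0%N -> x <= a by rewrite /hat; case: ifP.
have nF := node_base kcard Wsucc GB top.
have [ta|at_] := leP top a.
  have [l [_ lE]] := node_diff kcard Wsucc GB nF ns ta.
  exists (a, s, l); split=> // x xt _; have xa := le_trans (ltW xt) ta.
  by rewrite fE // -lE ?(ltW xt) //; lia.
have [l [_ lE]] := node_diff kcard Wsucc GB ns nF (ltW at_).
(* A node ending at [a < top] receives an extra jump at [succ a] that brings the coded value there
   down to 0. *)
exists (top, F top, (succ a, - (1 + F top (succ a) - st l (succ a))) :: oppl l).
have sat : succ a < top by rewrite (succ_limit kcard Wsucc).
split=> //.
- move=> x xt xn; rewrite st_cons /= st_opp.
  have [xa|ax] := leP x a.
    rewrite leNgt (lt_le_trans _ (_ : succ x <= succ a)) ?(lt_succ kcard Wsucc) //; last first.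
      by rewrite (succ_le kcard Wsucc) (lt_succ_le kcard Wsucc).
    by rewrite fE //= add0r -lE //; lia.
  have -> : x = succ a.
    apply/eqP; rewrite eq_le (succ_le kcard Wsucc) ax andbT leNgt; apply/negP => h.
    by have := xn _ h; rewrite /hat leNgt (lt_succ kcard Wsucc).
  rewrite lexx (introF (asboolP _) (succ_nlimit kcard Wsucc (a := a))) /=.
  by rewrite /hat leNgt (lt_succ kcard Wsucc) /=; lia.
- by move=> h; case: (h _ sat); rewrite /hat leNgt (lt_succ kcard Wsucc).
- by move=> x /fn xa; exact: le_trans (ltW at_).
Qed.

Definition jump_matrix l y n : int := rel_word (@pickle int) unpickle 0 (jump l y) n.

Lemma jump_matrix_ge l y n : -2 <= jump_matrix l y n.
Proof. exact: rel_word_ge. Qed.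

Lemma jump_matrix_supp l : exists S : seq (W * nat), forall y n, (y, n) \notin S ->
  jump_matrix l y n = 0.
Proof.
exists [seq (p.1, n) | p <- l, n <- iota 0 (pickle (jump l p.1) + pickle (0 : int)).+1].
move=> y n; rewrite /jump_matrix; have [->|j0] := eqVneq (jump l y) 0.
  by move=> _; rewrite rel_word0.
move=> nS; apply: rel_word_supp; rewrite ltnNge; apply/negP => h.
move/negP: nS; apply; have /mapP[p pl py] := jump_mem (elimN eqP j0).
apply/allpairsPdep; exists p, n; split=> //; last by rewrite py.
by rewrite mem_iota add0n -py ltnS.
Qed.

(** Let [z] be the first difference. If [z < top], jumps agree before [z] and increase at [z], so
    the matrices first differ in row [z]. Above [top] the matrices agree and the copied parts
    decide; a node that has ended shows the small value [u c + 1]. *)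
Lemma profile_lt f g T s l T' s' l' : hats F f -> hats F g ->
  profile f (T, s, l) -> profile g (T', s', l') -> lexlt f g ->
  exists w, [/\ w <= succ T, w <= succ T',
    forall x, x < w -> graft (jump_matrix l) T s x = graft (jump_matrix l') T' s' x
    & graft (jump_matrix l) T s w < graft (jump_matrix l') T' s' w].
Proof.
move=> hf hg [tT ns f1 f2 f3] [tT' ns' g1 g2 g3] [z [ag lt]].
have hat0 h y : hats F h -> y <= z -> h y = 0%N -> h z = 0%N.
  move=> [a [r [_ ->]]] yz; rewrite /hat; case: ifP => // /negbT; rewrite -ltNge => ay _.
  by rewrite leNgt (lt_le_trans ay yz).
have gn y : y < z -> g y <> 0%N.
  by move=> yz /(hat0 g y hg (ltW yz)) g0; rewrite g0 in lt.
have fn y : y < z -> f y <> 0%N by move=> yz; rewrite ag //; exact: gn.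
have lE x : x < top -> x <= z -> (f x)%:Z - (g x)%:Z = st l x - st l' x.
  move=> xt xz; rewrite f1 ?g1 //; [|move=> y yx..]; last 2 first.
  - by apply: gn; exact: lt_le_trans xz.
  - by apply: fn; exact: lt_le_trans xz.
  by lia.
have lag x : x < top -> x < z -> st l x = st l' x.
  by move=> xt xz; have := lE x xt (ltW xz); rewrite ag //; lia.
have jE y : y < top -> y < z -> jump l y = jump l' y.
  move=> yt yz; have := lag y yt yz; rewrite !st_jump.
  rewrite (@stlt_eq _ _ l l' y); last by move=> x xy; apply: lag; exact: lt_trans xy _.
  exact: addrI.
have [zt|tz] := ltP z top.
  have jlt : jump l z < jump l' z.
    have := lE z zt (lexx z); rewrite !st_jump (@stlt_eq _ _ l l' z).
      by move: lt; lia.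
    by move=> x xz; apply: lag => //; exact: lt_trans xz zt.
  have [n [ne nlt]] := rel_word_lt (@pickleK int) 0 jlt.
  apply: (@graft_lt _ _ T T' s s' z n) => // y m yz.
  by rewrite /jump_matrix jE // (lt_trans yz zt).
have f2' x : x <= T -> (f x)%:Z = s x + 1.
  by apply: f2 => y yt; apply: fn; exact: lt_le_trans tz.
have g2' x : x <= T' -> (g x)%:Z = s' x + 1.
  by apply: g2 => y yt; apply: gn; exact: lt_le_trans tz.
have sE x : x < z -> s x = s' x.
  move=> xz; have h1 := f2' x (f3 x (fn x xz)); have h2 := g2' x (g3 x (gn x xz)).
  by rewrite ag // in h1; lia.
(* Coherence: nodes that agree below the limit [top] agree at [top]. *)
have ztop : top < z.
  rewrite lt_neqAle tz andbT; apply/eqP => e.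
  have [y yt yP] := node_cont kcard Wsucc GB ns' ns top_lim tT' tT.
  have := yP y (lexx _) (ltW yt); rewrite sE -?e // subrr => h.
  by move: lt; rewrite -e; have := f2' top tT; have := g2' top tT'; lia.
have gz : g z <> 0%N by move=> g0; rewrite g0 in lt.
have zT' : z <= T' by exact: g3.
have cz : c < z by exact: lt_trans ztop.
exists z; split.
- rewrite leNgt; apply/negP => h; have := f3 _ (fn _ h).
  by rewrite leNgt (lt_succ kcard Wsucc).
- exact: le_trans zT' (ltW (lt_succ kcard Wsucc _)).
- move=> x xz; rewrite /graft; case: ifP => // _; case: ifP => [_|xt].
    rewrite (inscribe_eq pos_lt (M := jump_matrix l) (M' := jump_matrix l')) //.
    by move=> y m yt; rewrite /jump_matrix jE // (lt_trans yt ztop).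
  by rewrite (f3 x (fn x xz)) (g3 x (gn x xz)) sE.
- rewrite /graft !leNgt cz ztop /= -!leNgt zT'; case: ifP => zT.
    by have := f2' z zT; have := g2' z zT'; move: lt; lia.
  by have [s0' _] := ns'; have := s0' z zT'; lia.
Qed.

End Graft.

Lemma hat_lt a s b t w : node a s -> node b t -> w <= a -> w <= b ->
  (forall x, x < w -> s x = t x) -> s w < t w -> lexlt (hat a s) (hat b t).
Proof.
move=> ns nt wa wb e lt; exists w; split=> [x xw|].
  by rewrite /hat (le_trans (ltW xw) wa) (le_trans (ltW xw) wb) e.
by rewrite ltnNge (hat_le nt ns) // -ltNge.
Qed.

(** Each node is profiled, grafted onto [u] and extended into [A] by [capture]. Two grafts first
    differ within their common domain, so the extensions keep the order. *)
Lemma embed_unbounded (A : set (W -> nat)) : A `<=` hats F ->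
  (forall b, exists f x, [/\ A f, b < x & f x <> 0%N]) ->
  exists phi : L -> W -> nat, (forall f, A (phi f)) /\
    forall f g, f < g -> lexlt (phi f) (phi g).
Proof.
move=> AF Aub; have [c [u [nu cap]]] := capture kcard Wsucc GB AF Aub.
have [top [pos [lt ct pin pnl plt]]] := exists_positions kcard Wsucc c.
have ext (f : L) : exists q : (W * (W -> int) * seq (W * int)) * (W * (W -> int)),
    [/\ profile top (sval f) q.1, node q.2.1 q.2.2, A (hat q.2.1 q.2.2), succ q.1.1.1 <= q.2.1
    & forall x, x <= succ q.1.1.1 ->
        q.2.2 x = graft c top pos u (jump_matrix q.1.2) q.1.1.1 q.1.1.2 x].
  have [[[T s] l] p] := exists_profile lt ct nu (svalP f); have [tT ns _ _ _] := p.
  have [S SP] := jump_matrix_supp l.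
  have ng := graft_node ct pnl plt nu tT ns (jump_matrix_ge l) SP.
  have [|x xc|x cx xT|b [t [nt At Tb tE]]] := cap _ _ ng.
  - exact: le_trans (ltW ct) (le_trans tT (ltW (lt_succ kcard Wsucc _))).
  - by rewrite /graft xc.
  - exact: (graft_gt ct plt nu ns (jump_matrix_ge l)).
  - by exists ((T, s, l), (b, t)); split=> // x xT; rewrite /= -tE.
have /choice[q qP] := ext; exists (fun f => hat (q f).2.1 (q f).2.2).
split=> [f|f g /lexord_ltP fg]; first by case: (qP f).
case: (qP f) (qP g) => [pf nf _ Tf ef] [pg ng _ Tg eg].
case: (q f) (q g) pf nf Tf ef pg ng Tg eg => [[[T s] l] [b t]] [[[T' s'] l'] [b' t']] /=.
move=> pf nf Tf ef pg ng Tg eg.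
have [w [wT wT' ag wlt]] := profile_lt lt ct pin plt nu (svalP f) (svalP g) pf pg fg.
apply: (@hat_lt _ _ _ _ w) => //; [exact: le_trans Tf|exact: le_trans Tg|move=> x xw|].
  by rewrite ef ?eg ?ag // (le_trans (ltW xw)).
by rewrite ef ?eg.
Qed.

(** Rationals are inscribed as words in a single row [x0], everything else being fixed. *)
Lemma embed_rat : exists phi : rat -> L, forall r r', r < r' -> phi r < phi r'.
Proof.
have [top [pos [lt ct pin pnl plt]]] := exists_positions kcard Wsucc k.
have nk := node_base kcard Wsucc GB k; have nt := node_base kcard Wsucc GB top.
have [[x0 x0t] _] := lt.
pose M r y n : int := if y == x0 then rel_word (@pickle rat) unpickle 0 r n else 0.
have M2 r y n : -2 <= M r y n by rewrite /M; case: ifP => // _; exact: rel_word_ge.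
have MS r y n : (y, n) \notin [seq (x0, n) |
    n <- iota 0 (pickle r + pickle (0 : rat)).+1] -> M r y n = 0.
  rewrite /M; have [-> h|//] := eqVneq y x0; apply: rel_word_supp.
  rewrite ltnNge; apply/negP => nr; move/negP: h; apply; apply/mapP.
  by exists n; rewrite // mem_iota add0n ltnS.
have ng r := graft_node ct pnl plt nk (lexx top) nt (M2 r) (MS r).
have hg r : hats F (hat (succ top) (graft k top pos (F k) (M r) top (F top))).
  by exists (succ top), (graft k top pos (F k) (M r) top (F top)).
exists (fun r => exist _ _ (hg r)) => r r' rr; apply/lexord_ltP => /=.
have [n [ne nlt]] := rel_word_lt (@pickleK rat) 0 rr.
have [y m yx|m mn||w [wT wT' ag wlt]] := graft_lt ct pin plt nk
  (M := M r) (M' := M r') (F top) (F top) (n := n) x0t (lexx _) (lexx _).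
- by rewrite /M lt_eqF.
- by rewrite /M eqxx ne.
- by rewrite /M eqxx.
exact: (hat_lt (ng r) (ng r') wT wT' ag wlt).
Qed.

Lemma unbounded_of_not_sigma (A : set L) : ~ sigma_scattered A ->
  forall b, exists f x, [/\ (sval @` A) f, b < x & f x <> 0%N].
Proof.
move=> nA b; apply: contrapT => n; apply: nA.
apply: (bounded_sigma_scattered kcard GB (b := b)) => f x Af bx.
by apply: contrapT => fx; apply: n; exists (sval f), x; split=> //; exists f.
Qed.

Lemma embed_into (A : set L) :
  (forall b, exists f x, [/\ (sval @` A) f, b < x & f x <> 0%N]) ->
  exists phi : L -> L, (forall f, A (phi f)) /\ {mono phi : x y / x < y}.
Proof.
move=> ub; have [|phi [phiA phi_lt]] := embed_unbounded _ ub.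
  by move=> _ [f _ <-]; exact: svalP f.
have /choice[psi psiP] : forall f, exists g : L, A g /\ sval g = phi f.
  by move=> f; have [g Ag e] := phiA f; exists g.
exists psi; split=> [f|]; first by case: (psiP f).
apply/leW_mono/le_mono => f g fg; apply/lexord_ltP.
by rewrite (psiP f).2 (psiP g).2; exact: phi_lt.
Qed.

Lemma lexord_minimal : minimal_non_sigma_scattered L.
Proof.
split=> [[B BE Bs]|A /unbounded_of_not_sigma]; last exact: embed_into.
(* If every piece had bounded levels, countably many bounds would have a common bound [b0], and a
   node of level [b0] would lie in no piece. *)
have [n ub] : exists n, forall b, exists f x,
    [/\ (sval @` (B n)) f, b < x & f x <> 0%N].
  apply: contrapT => /forallNP nub.
  have /choice[b bP] n : exists b, forall f x, (sval @` (B n)) f -> b < x -> f x = 0%N.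
    have /existsNP[b bn] := nub n; exists b => f x Bf bx.
    by apply: contrapT => fx; apply: bn; exists f, x.
  have [b0 b0P] := bounded_seq kcard Wsucc b.
  have hb : hats F (hat b0 (F b0)).
    by exists b0, (F b0); split=> //; exact: (node_base kcard Wsucc GB).
  have : [set: L] (exist _ _ hb) by [].
  rewrite BE => -[n _ Bn].
  have Bh : [set sval g | g in B n] (hat b0 (F b0)) by exists (exist _ _ hb).
  by have := bP n _ b0 Bh (b0P n); rewrite /hat lexx.
(* The whole order, and with it the rationals, embeds into this piece, which is therefore not
   scattered. *)
have [phi [phiB phi_mono]] := embed_into ub.
have [psi psi_lt] := embed_rat.
apply: (Bs n); exists (phi \o psi); split=> [q|]; first exact: phiB.
by apply/leW_mono/le_mono => q r qr; rewrite /= phi_mono; exact: psi_lt.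
Qed.

End Embedding.

Theorem theorem7p5 (d : Order.disp_t) (W : orderType d) (kappa : W)
    (kappa_card : is_infinite_cardinal kappa)
    (W_succ : is_cardinal_successor kappa)
    (diamond : box_diamond kappa) :
  (exists T : set (W -> option nat),
     [/\ T `<=` Sk kappa, rho2_coherent T & rho2_full T]) /\
  (exists (d' : Order.disp_t) (L : orderType d'),
     [/\ minimal_non_sigma_scattered L,
         [set: L] #= [set: W] & countryman L kappa]).
Proof.
have [F [code GB]] := exists_guessed_base kappa_card W_succ diamond.
split.
  exists (nodes F); split; first exact: (nodes_Sk kappa_card W_succ GB).
    exact: (nodes_coherent kappa_card W_succ GB).
  exact: (nodes_full kappa_card W_succ GB).
exists d, (lexord (succ_wf W_succ) (hats F)); split.
- exact: (lexord_minimal kappa_card W_succ GB).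
- exact: (lexord_card kappa_card W_succ GB).
- exact: (lexord_countryman kappa_card W_succ GB).
Qed.
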